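(* Let $A$ be a closed polar set in a domain $D\subset\mathbb{C}$ and let $f$ be holomorphic on $D\setminus A$. Let $B\subset A$ be such that $B\cap A'=\varnothing$, where $A'$ is the set of accumulation points of $A$ in $D$, and assume $f$ does not extend holomorphically to (a neighbourhood of) any point of $B$. Then the set $$\{(z,f(z)):z\in D\setminus A\}\cup\big((A\setminus B)\times\mathbb{C}\big)$$ is complete pluripolar in $D\times\mathbb{C}$.
   Context: A set $E\subset\Omega$ ($\Omega\subset\mathbb{C}^n$ open) is complete pluripolar in $\Omega$ if there is a plurisubharmonic $u$ on $\Omega$ with $\{u=-\infty\}=E$. *)

(* Defs.v *)
From mathcomp Require Import all_boot all_algebra complex.
From mathcomp Require Import all_classical all_reals all_analysis.
Import numFieldNormedType.Exports.
Import GRing.Theory Num.Theory.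

Set Implicit Arguments.
Unset Strict Implicit.
Unset Printing Implicit Defensive.

Local Open Scope classical_set_scope.
Local Open Scope ring_scope.

(* The complex plane, with its canonical numClosedField / normed / topological structure. *)
Definition Cplx (R : realType) : numClosedFieldType := R[i].

Section Defs.
Variable R : realType.
Local Notation C := (Cplx R).

Definition usc_on (T : topologicalType) (U : set T) (u : T -> \bar R) : Prop :=
  forall x, U x -> forall c : R, (u x < c%:E)%E -> \forall y \near x, (u y < c%:E)%E.

Definition circle_mean (u : C -> \bar R) (a : C) (r : R) : \bar R :=
  (((2 * pi)^-1)%:E *
    \int[@lebesgue_measure R]_(t in `[0%R, (2 * pi)%R])
       u ((a + (r%:C)%C * (cos t +i* sin t)%C)%R : C))%E.

Definition subharmonic_on (U : set C) (u : C -> \bar R) : Prop :=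
  [/\ forall z, U z -> (u z < +oo)%E,
      usc_on U u &
      forall (a : C) (r : R), U a -> 0 < r -> closed_ball a (r%:C)%C `<=` U ->
        (u a <= circle_mean u a r)%E].

Definition cline (a b : C * C) (z : C) : C * C := (a.1 + z * b.1, a.2 + z * b.2).

Definition psh_on (Om : set (C * C)) (u : C * C -> \bar R) : Prop :=
  [/\ open Om,
      forall p, Om p -> (u p < +oo)%E,
      usc_on Om u &
      forall a b : C * C,
        subharmonic_on [set z | Om (cline a b z)] (fun z => u (cline a b z))].

Definition complete_pluripolar (Om E : set (C * C)) : Prop :=
  exists u : C * C -> \bar R,
    psh_on Om u /\ [set p | Om p /\ u p = -oo%E] = E.

Definition polar (A : set C) : Prop :=
  forall a : C, exists r : R, 0 < r /\
    exists u : C -> \bar R,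
      [/\ subharmonic_on (ball a (r%:C)%C) u,
          exists2 z, ball a (r%:C)%C z & u z != -oo%E &
          A `&` ball a (r%:C)%C `<=` [set z | u z = -oo%E]].

Definition holomorphic_on (U : set C) (f : C -> C) : Prop :=
  forall z, U z -> derivable f z 1.

Definition domain (D : set C) : Prop := [/\ open D, connected D & D !=set0].

Definition closed_in (D A : set C) : Prop :=
  A `<=` D /\ forall z, D z -> closure A z -> A z.

Definition accum_in (D A : set C) : set C := D `&` limit_point A.

End Defs.

(* Main.v *)
(* The defining function is a sum of continuous plurisubharmonic functions [psi_k] on [D * C], with
   [psi_k <= 2^-(k+1)] on an exhausting sequence of boxes, [psi_k <= -1/2] on larger and larger
   parts of the given set and, at every other point, [psi_k >= -2^-k] from some [k] on.
   Away from [A] the model is [e ln|w - f z|] truncated at the level -1. Near the part of [A] that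
   has to be avoided it is replaced by a constant, after adding a logarithmic potential of
   near-extremal points, very negative on that part and negligible at a distance from it; an
   exhaustion function of the domain dominates out of the box. At a point [b] of [B] the graph
   accumulates on [{b} * C]. As [f] does not extend to [b], every small circle about [b] meets
   [{|f| large}], and a potential of points of these circles gives a function of [z] close to -1 off
   a small disc and close to 0 on a smaller one, which bounds the model from below where [|f|] is not
   large, so that the model can be glued to a constant across [{b} * C].
   Subharmonicity of a continuous function is tested against harmonic polynomials: this condition is
   local and stable under maxima, and is equivalent to the sub-mean value inequality. *)
Require Import Defs.
From mathcomp Require Import finmap.
From mathcomp Require Import all_boot all_order all_algebra complex.
From mathcomp Require Import all_classical all_reals all_analysis measurable_realfun.
From mathcomp Require Import ring lra.
Import numFieldNormedType.Exports.
Import Order.TTheory GRing.Theory Num.Theory.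
Set Implicit Arguments.
Unset Strict Implicit.
Unset Printing Implicit Defensive.
Local Open Scope classical_set_scope.
Local Open Scope ring_scope.

(** A summand must be plurisubharmonic on all of [D * C] but is prescribed on one box only; cutting
    the models off at the level -1 lets a global floor take over outside. Asking for the bounds only
    from some [k] on makes this feasible: the [k]-th summand may ignore graph points over the
    [1/(k+1)]-neighbourhood of [A], and is controlled over finitely many points of [B]. Points of
    [B] are isolated in [A], so [B] is countable and finite lists exhaust it. The delicate place is
    a fibre over [b] in [B]: the summand must be almost nonnegative on the fibre, although the
    graph, where it is near -1, accumulates there; the freedom to ignore the graph close to [b]
    leaves room for the barrier. Polarity only provides local subharmonic functions without
    regularity. Finite averages of truncated logarithms stand in for an Evans potential, so that
    everything glued is continuous; integrals of semicontinuous functions occur only for the given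
    local functions and for the final limit. *)

Ltac rlra := repeat match goal with H : forall _, _ |- _ => clear H end; lra.

(** * Modulus and complex differentiability *)

Definition modc {R : realType} (z : Cplx R) : R := Normc.normc z.
Definition toC {R : realType} (x : R) : Cplx R := (x%:C)%C.
Definition mkC {R : realType} (x y : R) : Cplx R := (x +i* y)%C.
Definition reC {R : realType} (z : Cplx R) : R := complex.Re z.
Definition imC {R : realType} (z : Cplx R) : R := complex.Im z.

Section Modulus.
Variable R : realType.
Local Notation C := (Cplx R).
Implicit Types z w : C.

Lemma normE z : `|z| = toC (modc z). Proof. by []. Qed.
Lemma modc0 : modc (0 : C) = 0. Proof. exact: Normc.normc0. Qed.
Lemma modc1 : modc (1 : C) = 1. Proof. exact: Normc.normc1. Qed.
Lemma modcM z w : modc (z * w) = modc z * modc w. Proof. exact: Normc.normcM. Qed.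
Lemma modcV z : modc z^-1 = (modc z)^-1. Proof. exact: Normc.normcV. Qed.
Lemma modcN z : modc (- z) = modc z. Proof. exact: normcN. Qed.
Lemma ler_modcD z w : modc (z + w) <= modc z + modc w.
Proof. exact: le_normcD. Qed.
Lemma modc_ge0 z : 0 <= modc z. Proof. by case: z => a b; exact: sqrtr_ge0. Qed.
Lemma modc_eq0 z : (modc z == 0) = (z == 0).
Proof. by apply/eqP/eqP => [/Normc.eq0_normc//|->]; exact: modc0. Qed.
Lemma modc_gt0 z : (0 < modc z) = (z != 0).
Proof. by rewrite lt_def modc_eq0 modc_ge0 andbT. Qed.
Lemma modcX z n : modc (z ^+ n) = modc z ^+ n.
Proof. by elim: n => [|n IH]; rewrite ?expr0 ?modc1// !exprS modcM IH. Qed.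
Lemma modc_sym z w : modc (z - w) = modc (w - z).
Proof. by rewrite -modcN opprB. Qed.
Lemma ler_modcB z w : modc (z - w) <= modc z + modc w.
Proof. by rewrite -(modcN w); exact: ler_modcD. Qed.
Lemma ler_modc_dist z w u : modc (z - u) <= modc (z - w) + modc (w - u).
Proof. by rewrite (le_trans _ (ler_modcD _ _))// addrA subrK. Qed.
Lemma ler_modc_sub z w : modc z - modc w <= modc (z - w).
Proof. by rewrite lerBlDr (le_trans _ (ler_modcD _ _))// subrK. Qed.
Lemma modc_toC (x : R) : modc (toC x) = `|x|.
Proof. by rewrite /modc/toC/= expr0n/= addr0 sqrtr_sqr. Qed.
Lemma modc_sqr z : modc z ^+ 2 = reC z ^+ 2 + imC z ^+ 2.
Proof. by case: z => a b; rewrite /modc /= sqr_sqrtr// addr_ge0// sqr_ge0. Qed.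
Lemma ler_reC z : `|reC z| <= modc z.
Proof.
rewrite -ler_sqr ?nnegrE ?modc_ge0// modc_sqr real_normK ?num_real//.
by rewrite lerDl sqr_ge0.
Qed.
Lemma ler_imC z : `|imC z| <= modc z.
Proof.
rewrite -ler_sqr ?nnegrE ?modc_ge0// modc_sqr real_normK ?num_real//.
by rewrite lerDr sqr_ge0.
Qed.
Lemma mkCE z : z = mkC (reC z) (imC z). Proof. by case: z. Qed.
Lemma reCD z w : reC (z + w) = reC z + reC w. Proof. by case: z w => [a b] []. Qed.
Lemma imCD z w : imC (z + w) = imC z + imC w. Proof. by case: z w => [a b] []. Qed.
Lemma reCN z : reC (- z) = - reC z. Proof. by case: z. Qed.
Lemma imCN z : imC (- z) = - imC z. Proof. by case: z. Qed.
Lemma reCB z w : reC (z - w) = reC z - reC w. Proof. by rewrite reCD reCN. Qed.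
Lemma imCB z w : imC (z - w) = imC z - imC w. Proof. by rewrite imCD imCN. Qed.
Lemma reCM z w : reC (z * w) = reC z * reC w - imC z * imC w.
Proof. by case: z w => [a b] []. Qed.
Lemma imCM z w : imC (z * w) = reC z * imC w + imC z * reC w.
Proof. by case: z w => [a b] []. Qed.
Lemma reC_mk (x y : R) : reC (mkC x y) = x. Proof. by []. Qed.
Lemma imC_mk (x y : R) : imC (mkC x y) = y. Proof. by []. Qed.
Lemma Cext z w : reC z = reC w -> imC z = imC w -> z = w.
Proof. by case: z w => [a b] [c d] /= -> ->. Qed.
Lemma modc_mk (x y : R) : modc (mkC x y) <= `|x| + `|y|.
Proof.
rewrite -ler_sqr ?nnegrE ?modc_ge0 ?addr_ge0// modc_sqr reC_mk imC_mk.
rewrite sqrrD !real_normK ?num_real// addrAC lerDl.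
by rewrite mulrn_wge0// mulr_ge0.
Qed.
Lemma toCD (x y : R) : toC (x + y) = toC x + toC y.
Proof. exact: (rmorphD (real_complex R)). Qed.
Lemma toCM (x y : R) : toC (x * y) = toC x * toC y.
Proof. exact: (rmorphM (real_complex R)). Qed.
Lemma toCN (x : R) : toC (- x) = - toC x.
Proof. exact: (rmorphN (real_complex R)). Qed.
Lemma reC_toC (x : R) : reC (toC x) = x. Proof. by []. Qed.
Lemma imC_toC (x : R) : imC (toC x) = 0. Proof. by []. Qed.
Lemma toC_nat n : toC n%:R = n%:R :> C.
Proof. exact: (rmorph_nat (real_complex R)). Qed.
Lemma lt_toC (x y : R) : (toC x < toC y) = (x < y). Proof. exact: ltcR. Qed.
Lemma le_toC (x y : R) : (toC x <= toC y) = (x <= y). Proof. exact: lecR. Qed.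

(** The order of [C] only compares numbers with equal imaginary parts, so a positive radius is real:
    this is the bridge from the complex radii of the topology to the real radii used below. *)
Lemma posC (e : C) : 0 < e -> exists2 d : R, 0 < d & e = toC d.
Proof.
case: e => a b; rewrite ltcE/= => /andP[/eqP b0 a0]; exists a => //.
by rewrite b0.
Qed.

Lemma nearCP (z0 : C) (P : C -> Prop) :
  (\forall z \near z0, P z) <->
  exists2 d : R, 0 < d & forall z, modc (z - z0) < d -> P z.
Proof.
split.
  move=> /nbhs_ballP[e /= /posC[d d0 ->] H]; exists d => // z zd; apply: H.
  by rewrite -ball_normE /= distrC normE lt_toC.
move=> [d d0 H]; apply/nbhs_ballP; exists (toC d) => /=.
  by rewrite -[X in X < _]/(toC 0) lt_toC.
by move=> z; rewrite -ball_normE/= distrC normE lt_toC => /H.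
Qed.

Lemma ballCE (a : C) (r : R) z : ball a (toC r) z <-> modc (z - a) < r.
Proof. by rewrite -ball_normE/= distrC normE lt_toC. Qed.

(** [closed_ball] is the closure of the open ball. A point at distance exactly [r] is reached by
    shrinking it slightly towards the centre, by the factor [1 - t]. *)
Lemma closed_ballCE (a : C) (r : R) z : 0 < r ->
  closed_ball a (toC r) z <-> modc (z - a) <= r.
Proof.
move=> r0; split => [cz|zr].
  apply/ler_addgt0Pr => e e0.
  have [|y [/ballCE ya zy]] := cz [set y | modc (y - z) < e].
    by apply/nearCP; exists e.
  rewrite (le_trans (ler_modc_dist _ y _))// addrC lerD// ltW// modc_sym.
  by [].
move=> B /nearCP[d d0 Bd].
pose M := modc (z - a) + d; have M0 : 0 < M by rewrite ltr_wpDl ?modc_ge0.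
pose t := d / (2 * M); have t0 : 0 < t by rewrite divr_gt0// mulr_gt0.
have t1 : t <= 1.
  by rewrite ler_pdivrMr ?mulr_gt0// mul1r /M; have := modc_ge0 (z - a); rlra.
exists (z - toC t * (z - a)); split; last first.
  apply: Bd; rewrite addrC addrA addNr sub0r modcN modcM modc_toC gtr0_norm//.
  rewrite /t mulrAC ltr_pdivrMr ?mulr_gt0//.
  by rewrite ltr_pM2l// /M; have := modc_ge0 (z - a); rlra.
apply/ballCE; have -> : z - toC t * (z - a) - a = toC (1 - t) * (z - a).
  by rewrite toCD toCN mulrBl mul1r addrAC.
rewrite modcM modc_toC ger0_norm ?subr_ge0//.
have [->|] := eqVneq (z - a) 0; first by rewrite modc0 mulr0.
rewrite -modc_gt0 => za0; apply: lt_le_trans zr.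
by rewrite gtr_pMl// gtrBl.
Qed.

Lemma contP (v : C -> R) (z0 : C) : {for z0, continuous v} <->
  forall e : R, 0 < e -> exists2 d : R, 0 < d &
    forall z, modc (z - z0) < d -> `|v z - v z0| < e.
Proof.
split.
  move=> /cvgrPdist_lt H e e0.
  have /nearCP[d d0 Hd] := H e e0; exists d => // z /Hd; by rewrite distrC.
move=> H; apply: (proj2 (@cvgrPdist_lt _ _ _ (nbhs z0) _ v (v z0))) => e e0; apply/nearCP.
by have [d d0 Hd] := H e e0; exists d => // z /Hd; rewrite distrC.
Qed.

Lemma contCP (v : C -> C) (z0 : C) : {for z0, continuous v} <->
  forall e : R, 0 < e -> exists2 d : R, 0 < d &
    forall z, modc (z - z0) < d -> modc (v z - v z0) < e.
Proof.
split.
  move=> /cvgrPdist_lt H e e0.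
  have e0' : 0 < toC e by rewrite -[X in X < _]/(toC 0) lt_toC.
  have /nearCP[d d0 Hd] := H _ e0'; exists d => // z /Hd.
  by rewrite distrC normE lt_toC.
move=> H; apply: (proj2 (@cvgrPdist_lt _ _ _ (nbhs z0) _ v (v z0))) => e /posC[e' e0 ->]; apply/nearCP.
by have [d d0 Hd] := H e' e0; exists d => // z /Hd; rewrite distrC normE lt_toC.
Qed.

(** Complex differentiability with the quotient cleared and real radii; the non-strict inequality
    lets [z = z0] be included. *)
Definition hol (f : C -> C) (z0 : C) := exists c : C, forall e : R, 0 < e ->
  exists2 d : R, 0 < d & forall z, modc (z - z0) < d ->
    modc (f z - f z0 - c * (z - z0)) <= e * modc (z - z0).

Lemma holP (f : C -> C) (z0 : C) : derivable f z0 1 <-> hol f z0.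
Proof.
split.
  move=> /cvg_ex[c Hc]; have {}Hc := proj1 (cvgrPdist_le _ _) Hc; exists c => e e0.
  have e0' : 0 < toC e by rewrite -[X in X < _]/(toC 0) lt_toC.
  have := Hc (dnbhs_filter (0:C)) _ e0'; rewrite /dnbhs /= => /nearCP[d d0 Hd]; exists d => // z zd.
  have [->|zz] := eqVneq z z0; first by rewrite !subrr mulr0 subrr modc0 mulr0.
  have h0 : z - z0 != 0 by rewrite subr_eq0.
  have := Hd (z - z0); rewrite subr0 => /(_ zd h0) /=.
  rewrite [X in X + z0]mulr1 subrK normE le_toC => H.
  rewrite -ler_pdivrMr ?modc_gt0// -modcV -modcM (le_trans _ H)//.
  by rewrite -[leRHS]modcN opprB mulrBl mulfK// le_eqVlt [X in modc (X - _) == _]mulrC eqxx.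
move=> [c Hc]; apply/cvg_ex; exists c; apply: (proj2 (@cvgrPdist_le _ _ _ _ _ _ _)) => e /posC[e' e0 ->].
have [d d0 Hd] := Hc _ e0; rewrite /dnbhs/=; apply/nearCP; exists d => // h.
rewrite subr0 => hd h0 /=; rewrite [X in X + z0]mulr1 normE le_toC.
have := Hd (h + z0); rewrite addrK => /(_ hd).
rewrite -ler_pdivrMr ?modc_gt0// -modcV -modcM => H; rewrite (le_trans _ H)//.
by rewrite -[leLHS]modcN opprB mulrBl mulfK// le_eqVlt [X in modc (X - _) == _]mulrC eqxx.
Qed.

Lemma hol_cont f z0 : hol f z0 -> {for z0, continuous f}.
Proof.
move=> /holP /derivable1_diffP h.
by apply: differentiable_continuous.
Qed.

Lemma hol_cst (c : C) z0 : hol (fun=> c) z0.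
Proof. by apply/holP; exact: derivable_cst. Qed.
Lemma hol_id z0 : hol id z0.
Proof. by apply/holP; exact: derivable_id. Qed.
Lemma holD f g z0 : hol f z0 -> hol g z0 -> hol (fun z => f z + g z) z0.
Proof. by move=> /holP hf /holP hg; apply/holP; exact: (derivableD hf hg). Qed.
Lemma holN f z0 : hol f z0 -> hol (fun z => - f z) z0.
Proof. by move=> /holP hf; apply/holP; exact: (derivableN hf). Qed.
Lemma holB f g z0 : hol f z0 -> hol g z0 -> hol (fun z => f z - g z) z0.
Proof. by move=> hf hg; apply: holD => //; exact: holN. Qed.
Lemma holM f g z0 : hol f z0 -> hol g z0 -> hol (fun z => f z * g z) z0.
Proof. by move=> /holP hf /holP hg; apply/holP; exact: (derivableM hf hg). Qed.
Lemma holV f z0 : f z0 != 0 -> hol f z0 -> hol (fun z => (f z)^-1) z0.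
Proof. by move=> f0 /holP hf; apply/holP; exact: (derivableV f0 hf). Qed.
Lemma holX f n z0 : hol f z0 -> hol (fun z => f z ^+ n) z0.
Proof.
move=> hf; elim: n => [|n IH]; first exact: hol_cst.
by under eq_fun do rewrite exprS; exact: holM.
Qed.
Lemma hol_poly (p : {poly C}) z0 : hol (fun z => p.[z]) z0.
Proof.
elim/poly_ind: p => [|p c IH]; first by under eq_fun do rewrite horner0; exact: hol_cst.
under eq_fun do rewrite hornerMXaddC.
by apply: holD (hol_cst _ _); apply: holM => //; exact: hol_id.
Qed.

Lemma hol_near f g z0 : (\forall z \near z0, f z = g z) -> hol f z0 -> hol g z0.
Proof.
move=> /nearCP[d d0 fg] [c hc]; exists c => e e0; have [d' d'0 H] := hc _ e0.
exists (Num.min d d'); first by rewrite lt_min d0.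
move=> z; rewrite lt_min => /andP[zd zd'].
by rewrite -fg// -fg ?subrr ?modc0//; exact: H.
Qed.

Lemma hol_affine f a b z0 : hol f (a + z0 * b) -> hol (fun z => f (a + z * b)) z0.
Proof.
move=> [c hc]; exists (c * b) => e e0.
pose B := modc b + 1; have B0 : 0 < B by rewrite ltr_wpDl ?modc_ge0.
have [d d0 H] := hc (e / B) (divr_gt0 e0 B0).
exists (d / B); first by rewrite divr_gt0.
move=> z zd; have zbE : a + z * b - (a + z0 * b) = (z - z0) * b.
  by rewrite mulrBl opprD addrACA subrr add0r.
have {H} := H (a + z * b); rewrite zbE modcM.
have bB : modc b <= B by rewrite lerDl.
have lt1 : modc (z - z0) * modc b < d.
  by rewrite (le_lt_trans (ler_wpM2l (modc_ge0 _) bB))// -ltr_pdivlMr.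
have -> : c * b * (z - z0) = c * ((z - z0) * b) by ring.
move=> /(_ lt1) /le_trans; apply.
have -> : e / B * (modc (z - z0) * modc b) = e * modc (z - z0) * (modc b / B) by ring.
by rewrite ler_piMr ?mulr_ge0 ?modc_ge0 ?(ltW e0)// ler_pdivrMr// mul1r.
Qed.

End Modulus.

(** * Integrals over segments and boundaries of rectangles *)

Definition segint {R : realType} (phi : R -> R) (a b : R) : R :=
  Rintegral (@lebesgue_measure R) `[a, b]%classic phi.
(** Continuity is two-sided even at the end points: the integrands all come from functions
    continuous at the points of the path as points of the plane or of the line. *)
Definition ctn {R : realType} (phi : R -> R) (a b : R) :=
  forall x, a <= x <= b -> {for x, continuous phi}.

Section IntervalIntegral.
Variable R : realType.
Implicit Types (phi psi : R -> R) (a b : R).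

Lemma ctn_sub phi a b a' b' : a <= a' -> b' <= b -> ctn phi a b -> ctn phi a' b'.
Proof.
move=> aa bb h x /andP[ax xb]; apply: h.
by rewrite (le_trans aa ax) (le_trans xb bb).
Qed.

Lemma ctn_integrable phi a b : ctn phi a b ->
  (@lebesgue_measure R).-integrable `[a, b] (EFin \o phi).
Proof.
move=> h; apply: continuous_compact_integrable; first exact: segment_compact.
apply: continuous_in_subspaceT => x; rewrite inE/= in_itv/= => ab; exact: h.
Qed.

Lemma RintD phi psi a b : ctn phi a b -> ctn psi a b ->
  segint (fun x => phi x + psi x) a b = segint phi a b + segint psi a b.
Proof. by move=> h1 h2; rewrite /segint RintegralD//; exact: ctn_integrable. Qed.

Lemma RintZ c phi a b : ctn phi a b ->
  segint (fun x => c * phi x) a b = c * segint phi a b.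
Proof. by move=> h; rewrite /segint RintegralZl//; exact: ctn_integrable. Qed.

Lemma Rint_cst c a b : a <= b -> segint (fun=> c) a b = c * (b - a).
Proof.
rewrite /segint Rintegral_cst//= lebesgue_measure_itv/= lte_fin le_eqVlt.
by move=> /predU1P[->|->//]; rewrite ltxx subrr.
Qed.

Lemma eq_Rint phi psi a b : (forall x, a <= x <= b -> phi x = psi x) ->
  segint phi a b = segint psi a b.
Proof.
by move=> h; apply: eq_Rintegral => x; rewrite inE/= in_itv/= => /h.
Qed.

Lemma le_Rint phi psi a b : ctn phi a b -> ctn psi a b ->
  (forall x, a <= x <= b -> phi x <= psi x) -> segint phi a b <= segint psi a b.
Proof.
move=> h1 h2 h; apply: le_Rintegral => //; try exact: ctn_integrable.
Qed.

Lemma Rint_abs phi a b M : a <= b -> ctn phi a b ->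
  (forall x, a <= x <= b -> `|phi x| <= M) -> `|segint phi a b| <= M * (b - a).
Proof.
move=> ab h hM; have cM c : ctn (fun=> c) a b by move=> x _; exact: cst_continuous.
rewrite ler_norml; apply/andP; split.
  rewrite -mulNr -(Rint_cst (- M) ab) le_Rint// => x /hM.
  by rewrite ler_norml => /andP[].
by rewrite -(Rint_cst M ab) le_Rint// => x /hM; rewrite ler_norml => /andP[].
Qed.

Lemma Rint_split phi a m b : a <= m <= b -> ctn phi a b ->
  segint phi a b = segint phi a m + segint phi m b.
Proof.
move=> /andP[am mb] h.
have /ctn_integrable h2 := ctn_sub am (lexx b) h.
have := @Rintegral_itvB R phi (BLeft a) (BRight b) m (ctn_integrable h).
rewrite !bnd_simp => /(_ am mb); rewrite -/(segint phi a b) -/(segint phi a m).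
rewrite Rintegral_itv_obnd_cbnd; last first.
  by apply: integrableS h2 => //; apply: subset_itvr; rewrite bnd_simp.
by rewrite -/(segint phi m b) => <-; rewrite addrC subrK.
Qed.

Lemma Rint_id a b : a <= b -> segint id a b = (b ^+ 2 - a ^+ 2) / 2.
Proof.
rewrite le_eqVlt => /predU1P[->|ab].
  by rewrite /segint set_itv1 Rintegral_set1 subrr mul0r.
pose F := fun x : R => x ^+ 2 / 2.
have dF (x : R) : is_derive x 1 F x.
  have h := @is_deriveM R R id id x 1 1 1 (is_derive_id _ _) (is_derive_id _ _).
  have h2 := is_deriveZ 2^-1 h.
  apply: (is_derive_eq _ (_ : 2^-1 *: (x *: 1 + x *: 1) = x)).
    suff -> : F = (2^-1 \*: (id * id)) by [].
    by apply: funext => y /=; rewrite /F /GRing.scale/= mulrC.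
  by rewrite /GRing.scale/=; field.
rewrite /segint /Rintegral (@continuous_FTC2 R id F)//=.
- by rewrite /F; field.
- by apply: continuous_subspaceT => x; exact: cvg_id.
- have cF : continuous F.
    move=> x; apply: differentiable_continuous; apply/derivable1_diffP.
    by have [] := dF x.
  split.
  + by move=> x _; have [] := dF x.
  + by apply: cvg_at_right_filter; exact: cF.
  + by apply: cvg_at_left_filter; exact: cF.
- by move=> x _; rewrite derive1E; have [_ ->] := dF x.
Qed.

End IntervalIntegral.

(** * Complex-valued integrals and rectangles *)

Section ContourIntegral.
Variable R : realType.
Local Notation C := (Cplx R).
Implicit Types (F G : R -> C) (H : C -> C).

Lemma contRP (phi : R -> R) (x : R) : {for x, continuous phi} <->
  forall e : R, 0 < e -> exists2 d : R, 0 < d &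
    forall y, `|y - x| < d -> `|phi y - phi x| < e.
Proof.
split=> [/cvgrPdist_lt h e e0|h].
  have [d /= d0 Hd] := h e e0; exists d => // y yd.
  by rewrite distrC; apply: Hd; rewrite /= distrC.
apply/cvgrPdist_lt => e e0; have [d d0 Hd] := h e e0.
exists d => //= y yd; rewrite distrC; apply: Hd; by rewrite distrC.
Qed.

Definition pathcont F (x : R) := forall e : R, 0 < e ->
  exists2 d : R, 0 < d & forall y, `|y - x| < d -> modc (F y - F x) < e.

Definition pctn F a b := forall x, a <= x <= b -> pathcont F x.

Lemma pathcont_re F x : pathcont F x -> {for x, continuous (reC \o F)}.
Proof.
move=> h; apply/contRP => e e0; have [d d0 Hd] := h e e0; exists d => // y /Hd.
by apply: le_lt_trans; rewrite /= -reCB; exact: ler_reC.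
Qed.
Lemma pathcont_im F x : pathcont F x -> {for x, continuous (imC \o F)}.
Proof.
move=> h; apply/contRP => e e0; have [d d0 Hd] := h e e0; exists d => // y /Hd.
by apply: le_lt_trans; rewrite /= -imCB; exact: ler_imC.
Qed.
Lemma pathcont_comp H F (K x : R) : 0 < K -> {for F x, continuous H} ->
  (forall y, modc (F y - F x) <= K * `|y - x|) -> pathcont (H \o F) x.
Proof.
move=> K0 /contCP h hK e e0; have [d d0 Hd] := h e e0.
exists (d / K); first exact: divr_gt0.
move=> y yd; apply: Hd; rewrite (le_lt_trans (hK y))//.
by rewrite mulrC -ltr_pdivlMr.
Qed.

Definition Cint F a b : C := mkC (segint (reC \o F) a b) (segint (imC \o F) a b).

Lemma pctn_re F a b : pctn F a b -> ctn (reC \o F) a b.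
Proof. by move=> h x /h; exact: pathcont_re. Qed.
Lemma pctn_im F a b : pctn F a b -> ctn (imC \o F) a b.
Proof. by move=> h x /h; exact: pathcont_im. Qed.
Lemma CintD F G a b : pctn F a b -> pctn G a b ->
  Cint (fun t => F t + G t) a b = Cint F a b + Cint G a b.
Proof.
move=> hF hG; apply: Cext; rewrite ?reCD ?imCD !(reC_mk, imC_mk) -RintD;
  try exact: pctn_re; try exact: pctn_im.
- by apply: eq_Rint => x _ /=; rewrite reCD.
- by apply: eq_Rint => x _ /=; rewrite imCD.
Qed.

Lemma CintZ c F a b : pctn F a b -> Cint (fun t => c * F t) a b = c * Cint F a b.
Proof.
move=> hF; have hr := pctn_re hF; have hi := pctn_im hF.
have hZ k (phi : R -> R) : ctn phi a b -> ctn (fun x => k * phi x) a b.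
  by move=> h x /h hx; apply: cvgM => //; exact: cvg_cst.
apply: Cext; rewrite ?reCM ?imCM !(reC_mk, imC_mk).
- rewrite -RintZ// -[RHS]addrC -mulNr -RintZ// -RintD; try exact: hZ.
  by apply: eq_Rint => x _ /=; rewrite reCM mulNr addrC.
- rewrite -RintZ// -RintZ// -RintD; try exact: hZ.
  by apply: eq_Rint => x _ /=; rewrite imCM.
Qed.

Lemma Cint_cst c a b : a <= b -> Cint (fun=> c) a b = c * toC (b - a).
Proof.
move=> ab; apply: Cext; rewrite ?reCM ?imCM !(reC_mk, imC_mk, reC_toC, imC_toC).
  by rewrite [LHS]Rint_cst// mulr0 subr0.
by rewrite [LHS]Rint_cst// mulr0 add0r.
Qed.

Lemma eq_Cint F G a b : (forall x, a <= x <= b -> F x = G x) ->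
  Cint F a b = Cint G a b.
Proof.
by move=> h; congr mkC; apply: eq_Rint => x /h /= ->.
Qed.

Lemma Cint_toC a b : a <= b -> Cint toC a b = toC ((b ^+ 2 - a ^+ 2) / 2).
Proof.
move=> ab; apply: Cext; rewrite ?(reC_mk, imC_mk, reC_toC, imC_toC).
  exact: Rint_id.
by rewrite (@eq_Rint _ _ (fun=> 0))// Rint_cst// mul0r.
Qed.

Lemma Cint_split F a m b : a <= m <= b -> pctn F a b ->
  Cint F a b = Cint F a m + Cint F m b.
Proof.
move=> amb h; apply: Cext; rewrite ?reCD ?imCD !(reC_mk, imC_mk).
  by apply: Rint_split => //; exact: pctn_re.
by apply: Rint_split => //; exact: pctn_im.
Qed.

(** The factor 2 comes from estimating real and imaginary parts separately. It does no harm: the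
    Cauchy estimate resting on it is applied to powers, which removes constants. *)
Lemma Cint_bound F a b M : a <= b -> pctn F a b ->
  (forall x, a <= x <= b -> modc (F x) <= M) -> modc (Cint F a b) <= 2 * M * (b - a).
Proof.
move=> ab h hM; rewrite (le_trans (modc_mk _ _))// -mulrA mulr_natl mulr2n lerD//.
  apply: Rint_abs => //; first exact: pctn_re.
  by move=> x /hM; apply: le_trans; exact: ler_reC.
apply: Rint_abs => //; first exact: pctn_im.
by move=> x /hM; apply: le_trans; exact: ler_imC.
Qed.

Definition iC : C := mkC 0 1.

Definition contour H (x x' y y' : R) : C :=
  Cint (fun t => H (mkC t y)) x x' + iC * Cint (fun t => H (mkC x' t)) y y'
  - Cint (fun t => H (mkC t y')) x x' - iC * Cint (fun t => H (mkC x t)) y y'.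

Definition inrect (x x' y y' : R) (z : C) := x <= reC z <= x' /\ y <= imC z <= y'.

Definition rcont H x x' y y' :=
  forall z, inrect x x' y y' z -> {for z, continuous H}.

Lemma pctn_hor H x x' y : (forall t, x <= t <= x' -> {for mkC t y, continuous H}) ->
  pctn (fun t => H (mkC t y)) x x'.
Proof.
move=> h t /h ht; apply: (@pathcont_comp H (fun t => mkC t y) 1) => // s.
rewrite mul1r (le_trans _ (_ : `|s - t| + `|y - y| <= _))//; first exact: modc_mk.
by rewrite subrr normr0 addr0.
Qed.

Lemma pctn_ver H x y y' : (forall t, y <= t <= y' -> {for mkC x t, continuous H}) ->
  pctn (fun t => H (mkC x t)) y y'.
Proof.
move=> h t /h ht; apply: (@pathcont_comp H (fun t => mkC x t) 1) => // s.
rewrite mul1r (le_trans _ (_ : `|x - x| + `|s - t| <= _))//; first exact: modc_mk.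
by rewrite subrr normr0 add0r.
Qed.

Lemma rcont_hor H x x' y y' t : rcont H x x' y y' -> y <= t <= y' ->
  pctn (fun s => H (mkC s t)) x x'.
Proof. by move=> h ht; apply: pctn_hor => s hs; apply: h. Qed.
Lemma rcont_ver H x x' y y' t : rcont H x x' y y' -> x <= t <= x' ->
  pctn (fun s => H (mkC t s)) y y'.
Proof. by move=> h ht; apply: pctn_ver => s hs; apply: h. Qed.

Definition onrect (x x' y y' : R) (z : C) := inrect x x' y y' z /\
  [\/ reC z = x, reC z = x', imC z = y | imC z = y'].

Definition bcont H x x' y y' :=
  forall z, onrect x x' y y' z -> {for z, continuous H}.

Lemma rcont_bcont H x x' y y' : rcont H x x' y y' -> bcont H x x' y y'.
Proof. by move=> h z [hz _]; exact: h. Qed.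

Lemma bcont_sides H x x' y y' : x <= x' -> y <= y' -> bcont H x x' y y' ->
  [/\ pctn (fun t => H (mkC t y)) x x', pctn (fun t => H (mkC t y')) x x',
      pctn (fun t => H (mkC x t)) y y' & pctn (fun t => H (mkC x' t)) y y'].
Proof.
move=> xx yy h; split.
- by apply: pctn_hor => t ht; apply: h; split; [split=> //=; rewrite lexx yy|constructor 3].
- by apply: pctn_hor => t ht; apply: h; split; [split=> //=; rewrite lexx yy|constructor 4].
- by apply: pctn_ver => t ht; apply: h; split; [split=> //=; rewrite lexx xx|constructor 1].
- by apply: pctn_ver => t ht; apply: h; split; [split=> //=; rewrite lexx xx|constructor 2].
Qed.

Lemma contourD H1 H2 x x' y y' : x <= x' -> y <= y' ->
  bcont H1 x x' y y' -> bcont H2 x x' y y' ->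
  contour (fun z => H1 z + H2 z) x x' y y' = contour H1 x x' y y' + contour H2 x x' y y'.
Proof.
move=> xx yy /bcont_sides[]// a1 a2 a3 a4 /bcont_sides[]// b1 b2 b3 b4.
rewrite /contour.
rewrite (CintD a1 b1) (CintD a2 b2) (CintD a3 b3) (CintD a4 b4).
by ring.
Qed.

Lemma contourZ c H x x' y y' : x <= x' -> y <= y' -> bcont H x x' y y' ->
  contour (fun z => c * H z) x x' y y' = c * contour H x x' y y'.
Proof.
move=> xx yy /bcont_sides[]// a1 a2 a3 a4; rewrite /contour.
by rewrite (CintZ c a1) (CintZ c a2) (CintZ c a3) (CintZ c a4); ring.
Qed.

Lemma eq_contour H1 H2 x x' y y' : x <= x' -> y <= y' ->
  (forall z, onrect x x' y y' z -> H1 z = H2 z) ->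
  contour H1 x x' y y' = contour H2 x x' y y'.
Proof.
move=> xx yy h; congr (_ + _ * _ - _ - _ * _); apply: eq_Cint => t ht; apply: h.
- by split; [split=> //=; rewrite lexx yy|constructor 3].
- by split; [split=> //=; rewrite lexx xx|constructor 2].
- by split; [split=> //=; rewrite lexx yy|constructor 4].
- by split; [split=> //=; rewrite lexx xx|constructor 1].
Qed.

Lemma contour_vsplit H x m x' y y' : x <= m <= x' -> y <= y' -> rcont H x x' y y' ->
  contour H x x' y y' = contour H x m y y' + contour H m x' y y'.
Proof.
move=> xmx yy h; rewrite /contour.
rewrite (@Cint_split (fun t => H (mkC t y)) x m x')//; last by apply: (rcont_hor h); rewrite lexx.
rewrite (@Cint_split (fun t => H (mkC t y')) x m x')//; last by apply: (rcont_hor h); rewrite lexx yy.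
by ring.
Qed.

Lemma contour_hsplit H x x' y m y' : x <= x' -> y <= m <= y' -> rcont H x x' y y' ->
  contour H x x' y y' = contour H x x' y m + contour H x x' m y'.
Proof.
move=> xx ymy h; rewrite /contour.
rewrite (@Cint_split (fun t => H (mkC x t)) y m y')//; last by apply: (rcont_ver h); rewrite lexx.
rewrite (@Cint_split (fun t => H (mkC x' t)) y m y')//; last by apply: (rcont_ver h); rewrite lexx xx.
by ring.
Qed.

Lemma modc_iC : modc iC = 1.
Proof. by rewrite /modc /= expr0n /= add0r expr1n sqrtr1. Qed.

Lemma contour_bound H x y l M : 0 <= l -> bcont H x (x + l) y (y + l) ->
  (forall z, onrect x (x + l) y (y + l) z -> modc (H z) <= M) ->
  modc (contour H x (x + l) y (y + l)) <= 8 * M * l.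
Proof.
move=> l0 hb hM; have ll u : u <= u + l by rewrite lerDl.
have -> : 8 * M * l = 2 * M * l + 2 * M * l + 2 * M * l + 2 * M * l by ring.
have B F a : pctn F a (a + l) -> (forall t, a <= t <= a + l -> modc (F t) <= M) ->
    modc (Cint F a (a + l)) <= 2 * M * l.
  by move=> hF hFM; rewrite -[X in _ * X](addrK a l) [l + a]addrC Cint_bound.
have [h1 h2 h3 h4] := bcont_sides (ll x) (ll y) hb.
rewrite /contour; rewrite (le_trans (ler_modcB _ _))// lerD//; last first.
  rewrite modcM modc_iC mul1r B//.
  by move=> t ht; apply: hM; split; [split => //=; rewrite lexx ll|constructor 1].
rewrite (le_trans (ler_modcB _ _))// lerD//; last first.
  rewrite B//.
  by move=> t ht; apply: hM; split; [split => //=; rewrite lexx ll|constructor 4].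
rewrite (le_trans (ler_modcD _ _))// lerD//; last first.
  rewrite modcM modc_iC mul1r B//.
  by move=> t ht; apply: hM; split; [split => //=; rewrite lexx ll|constructor 2].
rewrite B//.
by move=> t ht; apply: hM; split; [split => //=; rewrite lexx ll|constructor 3].
Qed.

Lemma cont_affine (c0 c1 : C) z : {for z, continuous (fun z => c0 + c1 * z)}.
Proof.
apply: hol_cont; apply: holD; first exact: hol_cst.
by apply: holM; [exact: hol_cst|exact: hol_id].
Qed.

Lemma pctn_toC a b : pctn toC a b.
Proof.
move=> x _ e e0; exists e => // y; by rewrite -toCN -toCD modc_toC.
Qed.

Lemma Cint_affine (c0 c1 : C) a b : a <= b -> Cint (fun t => c0 + c1 * toC t) a b =
  c0 * toC (b - a) + c1 * toC ((b ^+ 2 - a ^+ 2) / 2).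
Proof.
move=> ab; have cc (c : C) : pctn (fun=> c) a b.
  by move=> x _ e e0; exists 1 => // y _; rewrite subrr modc0.
rewrite (@CintD (fun=> c0) (fun t => c1 * toC t))//; last first.
  move=> x _; apply: (@pathcont_comp (fun z => c1 * z) toC 1) => //; last first.
    by move=> y; rewrite -toCN -toCD modc_toC mul1r.
  by apply: hol_cont; apply: holM; [exact: hol_cst|exact: hol_id].
by rewrite Cint_cst// CintZ ?Cint_toC//; exact: pctn_toC.
Qed.

Lemma contour_affine (c0 c1 : C) x x' y y' : x <= x' -> y <= y' ->
  contour (fun z => c0 + c1 * z) x x' y y' = 0.
Proof.
move=> xx yy; rewrite /contour.
have mkE a b : mkC a b = toC a + iC * toC b :> C.
  by apply: Cext; rewrite ?reCD ?imCD ?reCM ?imCM /=; ring.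
have hor t : Cint (fun s => c0 + c1 * mkC s t) x x' =
   (c0 + c1 * (iC * toC t)) * toC (x' - x) + c1 * toC ((x' ^+ 2 - x ^+ 2) / 2).
  rewrite -Cint_affine//; apply: eq_Cint => s _; rewrite mkE; ring.
have ver t : Cint (fun s => c0 + c1 * mkC t s) y y' =
   (c0 + c1 * toC t) * toC (y' - y) + c1 * iC * toC ((y' ^+ 2 - y ^+ 2) / 2).
  rewrite -Cint_affine//; apply: eq_Cint => s _; rewrite mkE; ring.
rewrite !hor !ver.
by rewrite !toCD !toCN; ring.
Qed.

End ContourIntegral.

(** * Goursat's theorem *)

Section Goursat.
Variable R : realType.
Local Notation C := (Cplx R).
Implicit Types (H : C -> C) (x y l : R).

Definition sq H x y l := contour H x (x + l) y (y + l).
Definition insq x y l (z : C) := inrect x (x + l) y (y + l) z.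

Lemma sq_quarter H x y l : 0 <= l -> rcont H x (x + l) y (y + l) ->
  sq H x y l = sq H x y (l / 2) + sq H (x + l / 2) y (l / 2)
    + sq H x (y + l / 2) (l / 2) + sq H (x + l / 2) (y + l / 2) (l / 2).
Proof.
move=> l0 h; have lE u : u + l = u + l / 2 + l / 2 by field.
have h2 : 0 <= l / 2 by rewrite divr_ge0.
have ll u : u <= u + l / 2 by rewrite lerDl.
have ll2 u : u <= u + l by rewrite lerDl.
have hl u : u + l / 2 <= u + l by rewrite lE.
rewrite /sq (@contour_vsplit _ H x (x + l / 2) (x + l))//; last by rewrite ll hl.
rewrite (@contour_hsplit _ H x (x + l / 2) y (y + l / 2) (y + l))//; last 2 first.
- by rewrite ll hl.
- move=> z [/andP[a b] c]; apply: h; split=> //.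
  by rewrite a (le_trans b (hl _)).
rewrite (@contour_hsplit _ H (x + l / 2) (x + l) y (y + l / 2) (y + l))//; last 2 first.
- by rewrite ll hl.
- move=> z [/andP[a b] c]; apply: h; split=> //.
  by rewrite b (le_trans (ll _) a).
by rewrite !lE; ring.
Qed.

(** The threshold is proportional to the area, so that one of the four quarters of a bad square is
    bad for the same [e]. *)
Definition bad H (e : R) x y l := e * l ^+ 2 < modc (sq H x y l).

Lemma bad_quarter H e x y l : 0 <= l -> rcont H x (x + l) y (y + l) ->
  bad H e x y l -> exists p : R * R,
   [/\ p.1 = x \/ p.1 = x + l / 2, p.2 = y \/ p.2 = y + l / 2 & bad H e p.1 p.2 (l / 2)].
Proof.
move=> l0 h; apply: contraPP => /forallNP hn; rewrite /bad; apply/negP.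
have nb a b : a = x \/ a = x + l / 2 -> b = y \/ b = y + l / 2 ->
    modc (sq H a b (l / 2)) <= e * (l / 2) ^+ 2.
  move=> ha hb; rewrite leNgt; apply/negP => hb'; apply: (hn (a, b)); by split.
rewrite -leNgt sq_quarter//.
have -> : e * l ^+ 2 = e * (l / 2) ^+ 2 + e * (l / 2) ^+ 2 + e * (l / 2) ^+ 2 + e * (l / 2) ^+ 2 by field.
do 3 (rewrite (le_trans (ler_modcD _ _))// lerD//; last by apply: nb; auto).
by apply: nb; auto.
Qed.

Section Bisect.
Variables (H : C -> C) (e x0 y0 l0 : R).
Hypothesis l00 : 0 < l0.
Hypothesis cH : rcont H x0 (x0 + l0) y0 (y0 + l0).
Hypothesis b0 : bad H e x0 y0 l0.

Let len n : R := l0 / 2 ^+ n.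
(** A choice of a bad quarter. The default [p] of [xget] is never taken along the sequence [P], as
    [PS] shows. *)
Let nxt n (p : R * R) : R * R := xget p [set q : R * R |
  [/\ q.1 = p.1 \/ q.1 = p.1 + len n / 2, q.2 = p.2 \/ q.2 = p.2 + len n / 2
    & bad H e q.1 q.2 (len n / 2)]].
Let P := fix P (n : nat) : R * R := if n is m.+1 then nxt m (P m) else (x0, y0).

Local Lemma len_gt0 n : 0 < len n. 
Proof. by rewrite divr_gt0// exprn_gt0. Qed.
Local Lemma lenS n : len n.+1 = len n / 2. Proof. by rewrite /len exprS invfM mulrA mulrAC. Qed.

Local Lemma PS n : [/\ x0 <= (P n).1, (P n).1 + len n <= x0 + l0, y0 <= (P n).2,
   (P n).2 + len n <= y0 + l0 & bad H e (P n).1 (P n).2 (len n)].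
Proof.
elim: n => [|n [a b c d bd]]; first by rewrite /len /= expr0 divr1.
have [|q [q1 q2 qb]] := bad_quarter (ltW (len_gt0 n)) _ bd.
  move=> z [/andP[z1 z2] /andP[z3 z4]]; apply: cH; split.
    by rewrite (le_trans a z1) (le_trans z2 b).
  by rewrite (le_trans c z3) (le_trans z4 d).
have := @xgetPex _ (P n) [set q : R * R |
  [/\ q.1 = (P n).1 \/ q.1 = (P n).1 + len n / 2, q.2 = (P n).2 \/ q.2 = (P n).2 + len n / 2
    & bad H e q.1 q.2 (len n / 2)]] (ex_intro _ q _).
case; first by split.
rewrite -[xget _ _]/(P n.+1) lenS => h1 h2 h3.
have l0n := len_gt0 n.
by split=> //; [case: h1 => ->|case: h1 => ->|case: h2 => ->|case: h2 => ->]; rlra.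
Qed.

Local Lemma PSS n : [/\ (P n).1 <= (P n.+1).1, (P n.+1).1 + len n.+1 <= (P n).1 + len n,
   (P n).2 <= (P n.+1).2 & (P n.+1).2 + len n.+1 <= (P n).2 + len n].
Proof.
have [a b c d bd] := PS n.
have [|q [q1 q2 qb]] := bad_quarter (ltW (len_gt0 n)) _ bd.
  move=> z [/andP[z1 z2] /andP[z3 z4]]; apply: cH; split.
    by rewrite (le_trans a z1) (le_trans z2 b).
  by rewrite (le_trans c z3) (le_trans z4 d).
have := @xgetPex _ (P n) [set q : R * R |
  [/\ q.1 = (P n).1 \/ q.1 = (P n).1 + len n / 2, q.2 = (P n).2 \/ q.2 = (P n).2 + len n / 2
    & bad H e q.1 q.2 (len n / 2)]] (ex_intro _ q _).
case; first by split.
rewrite -[xget _ _]/(P n.+1) lenS => h1 h2 h3.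
have l0n := len_gt0 n.
by split=> //; [case: h1 => ->|case: h1 => ->|case: h2 => ->|case: h2 => ->]; rlra.
Qed.

Local Lemma Pmono n k : [/\ (P n).1 <= (P (k + n)).1, (P (k + n)).1 + len (k + n) <= (P n).1 + len n,
   (P n).2 <= (P (k + n)).2 & (P (k + n)).2 + len (k + n) <= (P n).2 + len n].
Proof.
elim: k => [|k [a b c d]]; first by rewrite add0n.
have [a' b' c' d'] := PSS (k + n); rewrite addSn.
by split; [exact: le_trans a a'|exact: le_trans b' b|exact: le_trans c c'|exact: le_trans d' d].
Qed.

Local Lemma nest n m : (P n).1 <= (P m).1 + len m /\ (P n).2 <= (P m).2 + len m.
Proof.
have [/subnK <-|/ltnW/subnK <-] := leqP n m.
  have [a b c d] := Pmono n (m - n); have := ltW (len_gt0 (m - n + n)); split; rlra.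
have [a b c d] := Pmono m (n - m); have := ltW (len_gt0 (n - m + m)); split; rlra.
Qed.

(** The common point has for coordinates the suprema of the left and bottom sides of the nested
    squares; by [nest] these stay below all right and top sides. *)
Lemma bisect_limit : exists z : C, inrect x0 (x0 + l0) y0 (y0 + l0) z /\
  forall d : R, 0 < d -> exists x y l, [/\ 0 < l < d, x0 <= x /\ x + l <= x0 + l0,
     y0 <= y /\ y + l <= y0 + l0, insq x y l z & bad H e x y l].
Proof.
pose X := sup (range (fun n => (P n).1)); pose Y := sup (range (fun n => (P n).2)).
have hX n : (P n).1 <= X <= (P n).1 + len n.
  apply/andP; split.
    apply: sup_ubound; last by exists n.
    by exists ((P 0).1 + len 0) => _ [m _ <-]; have [] := nest m 0.
  apply: ge_sup; first by exists (P 0).1; exists 0%N.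
  by move=> _ [m _ <-]; have [] := nest m n.
have hY n : (P n).2 <= Y <= (P n).2 + len n.
  apply/andP; split.
    apply: sup_ubound; last by exists n.
    by exists ((P 0).2 + len 0) => _ [m _ <-]; have [] := nest m 0.
  apply: ge_sup; first by exists (P 0).2; exists 0%N.
  by move=> _ [m _ <-]; have [] := nest m n.
exists (mkC X Y); split.
  have := hX 0%N; have := hY 0%N; rewrite /len /= expr0 divr1 => a b; by split.
move=> d d0.
have [n hn] : exists n, len n < d.
  have [n hn] := ltr_add_invr (divr_gt0 d0 l00); rewrite add0r in hn.
  exists n; rewrite /len ltr_pdivrMr ?exprn_gt0// mulrC -ltr_pdivrMr//.
  rewrite -[ltLHS]invf_div -[ltRHS]invrK ltf_pV2 ?posrE ?divr_gt0// ?invr_gt0 ?exprn_gt0//.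
  apply: le_lt_trans hn.
  rewrite lef_pV2 ?posrE ?exprn_gt0// -natrX ler_nat; exact: ltn_expl.
exists (P n).1, (P n).2, (len n); have [a b c d' bd] := PS n; split => //.
by rewrite len_gt0.
Qed.

End Bisect.

Lemma goursat H x y l : 0 < l -> (forall z, insq x y l z -> hol H z) -> sq H x y l = 0.
Proof.
move=> l0 hH.
have cH : rcont H x (x + l) y (y + l) by move=> z /hH /hol_cont.
apply/eqP; rewrite -modc_eq0; apply/negPn/negP; rewrite modc_eq0 -modc_gt0 => J0.
pose e := modc (sq H x y l) / (2 * l ^+ 2).
have l20 : 0 < l ^+ 2 by rewrite exprn_gt0.
have e0 : 0 < e by rewrite divr_gt0// mulr_gt0.
have b0 : bad H e x y l.
  rewrite /bad; have -> : e * l ^+ 2 = modc (sq H x y l) / 2 by rewrite /e; field; exact: lt0r_neq0.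
  by rewrite ltr_pdivrMr// ltr_pMr// ltr1n.
have [z [zS hz]] := bisect_limit l0 cH b0.
have [c hc] := hH z zS.
(* The affine part integrates to 0; the error is at most [e / 16 * (2 * l1)] on a square of side
   [l1], and [contour_bound] contributes [8 * l1], which gives exactly the threshold
   [e * l1 ^+ 2]. *)
have e16 : 0 < e / 16 by rewrite divr_gt0.
have [d d0 hd] := hc _ e16.
have [x1 [y1 [l1 [/andP[l10 l1d] [xx1 x1l] [yy1 y1l] zi]]]] := hz (d / 2) (divr_gt0 d0 (ltr0n _ 2)).
rewrite /bad ltNge => /negP; apply.
pose c0 := H z - c * z.
pose E := fun u => H u - (c0 + c * u).
have cH1 : rcont H x1 (x1 + l1) y1 (y1 + l1).
  move=> u [/andP[u1 u2] /andP[u3 u4]]; apply: cH; split.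
    by rewrite (le_trans xx1 u1) (le_trans u2 x1l).
  by rewrite (le_trans yy1 u3) (le_trans u4 y1l).
have cE : rcont E x1 (x1 + l1) y1 (y1 + l1).
  move=> u hu; apply: hol_cont; apply: holB.
    have [/andP[u1 u2] /andP[u3 u4]] := hu; apply: hH; split.
      by rewrite (le_trans xx1 u1) (le_trans u2 x1l).
    by rewrite (le_trans yy1 u3) (le_trans u4 y1l).
  apply: holD; first exact: hol_cst.
  by apply: holM; [exact: hol_cst|exact: hol_id].
have -> : sq H x1 y1 l1 = sq E x1 y1 l1.
  rewrite /sq -[RHS]addr0 -(@contour_affine _ c0 c x1 (x1 + l1) y1 (y1 + l1)) ?lerDl ?ltW//.
  rewrite -(@contourD _ E (fun z => c0 + c * z)) ?lerDl ?(ltW l10)//; last 2 first.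
  - exact: rcont_bcont.
  - by move=> u _; exact: cont_affine.
  apply: eq_contour; rewrite ?lerDl ?(ltW l10)// => u _.
  by apply/esym; exact: subrK.
have -> : e * l1 ^+ 2 = 8 * (e / 16 * (2 * l1)) * l1 by field.
apply: contour_bound => //; [exact: ltW|exact: rcont_bcont|].
move=> u [ui _].
have uz : modc (u - z) <= 2 * l1.
  rewrite [u - z]mkCE (le_trans (modc_mk _ _))// reCB imCB.
  have [/andP[a1 a2] /andP[a3 a4]] := ui; have [/andP[b1 b2] /andP[b3 b4]] := zi.
  rewrite mulr_natl mulr2n lerD//; rewrite ler_norml; apply/andP; split; rlra.
have -> : E u = H u - H z - c * (u - z) by rewrite /E /c0; ring.
apply: le_trans (hd _ _) _; first by rewrite (le_lt_trans uz)// mulrC -ltr_pdivlMr.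
by rewrite ler_wpM2l// ltW.
Qed.

Lemma insq_sub x y l x' y' d z : x <= x' -> x' + d <= x + l ->
  y <= y' -> y' + d <= y + l -> insq x' y' d z -> insq x y l z.
Proof.
move=> a b c e [/andP[z1 z2] /andP[z3 z4]]; split.
  by rewrite (le_trans a z1) (le_trans z2 b).
by rewrite (le_trans c z3) (le_trans z4 e).
Qed.

Ltac rect_side := solve [by constructor 1; rlra|by constructor 2; rlra|by constructor 3; rlra|by constructor 4; rlra].

Lemma goursat_corner_step H x y l z0 (a b : bool) : 0 < l ->
  rcont H x (x + l) y (y + l) ->
  (forall z, insq x y l z -> z != z0 -> hol H z) ->
  reC z0 = x + a%:R * l -> imC z0 = y + b%:R * l ->
  sq H x y l = sq H (x + a%:R * (l / 2)) (y + b%:R * (l / 2)) (l / 2).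
Proof.
move=> l0 cH hH ra ib; rewrite sq_quarter//; last exact: ltW.
have l20 : 0 < l / 2 by rewrite divr_gt0.
have Z x' y' : x <= x' -> x' + l / 2 <= x + l -> y <= y' -> y' + l / 2 <= y + l ->
    [\/ reC z0 < x', x' + l / 2 < reC z0, imC z0 < y' | y' + l / 2 < imC z0] ->
    sq H x' y' (l / 2) = 0.
  move=> h1 h2 h3 h4 h5; apply: goursat => // z hz; apply: hH.
    exact: insq_sub hz.
  by apply: contraPneq hz => -> [/andP[? ?] /andP[? ?]]; case: h5; rlra.
have half2 u : u + l / 2 + l / 2 = u + l by field.
case: a b ra ib => [] []; rewrite ?(mul1r, mul0r, addr0) => ra ib.
- rewrite (Z x y) ?(Z (x + l / 2) y) ?(Z x (y + l / 2)) ?add0r//; try rlra; rect_side.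
- rewrite (Z x y) ?(Z (x + l / 2) (y + l / 2)) ?(Z x (y + l / 2)) ?add0r ?addr0//; try rlra; rect_side.
- rewrite (Z x y) ?(Z (x + l / 2) (y + l / 2)) ?(Z (x + l / 2) y) ?add0r ?addr0//; try rlra; rect_side.
- rewrite (Z (x + l / 2) y) ?(Z (x + l / 2) (y + l / 2)) ?(Z x (y + l / 2)) ?add0r ?addr0//; try rlra; rect_side.
Qed.

(** The exceptional point is the corner selected by [a] and [b]. The three quarters away from it
    contribute 0, so the square can be shrunk to that corner without changing the integral, which
    tends to 0 because [H] is bounded. *)
Lemma goursat_corner H x y l z0 (a b : bool) M : 0 < l ->
  rcont H x (x + l) y (y + l) ->
  (forall z, insq x y l z -> modc (H z) <= M) ->
  (forall z, insq x y l z -> z != z0 -> hol H z) ->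
  reC z0 = x + a%:R * l -> imC z0 = y + b%:R * l ->
  sq H x y l = 0.
Proof.
move=> l0 cH hM hH ra ib.
have key n : modc (sq H x y l) <= 8 * `|M| * (l / 2 ^+ n).
  have d0 : 0 < l / 2 ^+ n by rewrite divr_gt0// exprn_gt0.
  suff [x' [y' [h1 h2 h3 h4 [h5 [h6 ->]]]]] : exists x' y', [/\ x <= x',
      x' + l / 2 ^+ n <= x + l, y <= y', y' + l / 2 ^+ n <= y + l &
      reC z0 = x' + a%:R * (l / 2 ^+ n) /\ imC z0 = y' + b%:R * (l / 2 ^+ n) /\
      sq H x y l = sq H x' y' (l / 2 ^+ n)].
    apply: contour_bound; first exact: ltW.
      by apply: rcont_bcont => z hz; apply: cH; exact: insq_sub hz.
    move=> z [hz _]; rewrite (le_trans (hM z _)) ?ler_norm//.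
    exact: insq_sub hz.
  elim: n {d0} => [|n [x' [y' [h1 h2 h3 h4 [h5 [h6 E]]]]]].
    by exists x, y; rewrite expr0 divr1; split.
  have d0 : 0 < l / 2 ^+ n by rewrite divr_gt0// exprn_gt0.
  have dE : l / 2 ^+ n.+1 = l / 2 ^+ n / 2 by rewrite exprSr invfM mulrA.
  rewrite dE; set d := l / 2 ^+ n in d0 h2 h4 h5 h6 E *.
  have ha : 0 <= a%:R * (d / 2) <= d / 2 by case: (a); rewrite ?mul0r ?mul1r; rlra.
  have hb : 0 <= b%:R * (d / 2) <= d / 2 by case: (b); rewrite ?mul0r ?mul1r; rlra.
  exists (x' + a%:R * (d / 2)), (y' + b%:R * (d / 2)); split; [rlra|rlra|rlra|rlra|].
  split; first by rewrite h5; rlra.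
  split; first by rewrite h6; rlra.
  rewrite E; apply: (@goursat_corner_step _ _ _ _ z0) => // z hz.
    by apply: cH; exact: insq_sub hz.
  by apply: hH; exact: insq_sub hz.
apply/eqP; rewrite -modc_eq0 eq_le modc_ge0 andbT.
apply/ler_addgt0Pr => e e0; rewrite add0r.
pose N := 8 * `|M| * l; have N0 : 0 <= N by rewrite !mulr_ge0// ltW.
have [n hn] : exists n : nat, N / e < n%:R.
  have := archi_boundP (divr_ge0 N0 (ltW e0)); by exists (Num.bound (N / e)).
rewrite (le_trans (key n))// mulrA -/N ler_pdivrMr ?exprn_gt0// mulrC -ler_pdivrMr//.
apply: (le_trans (ltW hn)).
by rewrite -natrX ler_nat ltnW// ltn_expl.
Qed.

End Goursat.

(** * Compactness and the maximum modulus principle on squares *)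

Section Compactness.
Variable R : realType.
Local Notation C := (Cplx R).

Lemma compact_rect (x x' y y' : R) : compact [set z : C | inrect x x' y y' z].
Proof.
have -> : [set z : C | inrect x x' y y' z] =
    (fun p : R * R => mkC p.1 p.2) @` (`[x, x']%classic `*` `[y, y']%classic).
  apply/seteqP; split => [z [zx zy]|_ [[a b] [/= ha hb] <-]].
    by exists (reC z, imC z) => /=; [rewrite !in_itv/=; split|rewrite -mkCE].
  by move: ha hb; rewrite !in_itv/= => ha hb; split.
apply: continuous_compact; last by apply: compact_setX; exact: segment_compact.
apply: continuous_subspaceT => p.
apply: (proj2 (@cvgrPdist_lt _ _ _ (nbhs p) _ _ _)) => e /posC[d d0 ->].
have d20 : 0 < d / 2 by rewrite divr_gt0.
exists (ball p.1 (d / 2), ball p.2 (d / 2)) => /=.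
  by split; exact: nbhsx_ballx.
move=> [a b] [/= ha hb]; rewrite normE lt_toC.
rewrite (le_lt_trans (modc_mk _ _))// [ltRHS]splitr ltrD//.
Qed.

Lemma bounded_closed_compactC (K : set C) (M : R) : closed K ->
  (forall z, K z -> modc z <= M) -> compact K.
Proof.
move=> cK hM; apply: (subclosed_compact cK (@compact_rect (- M) M (- M) M)).
move=> z /hM hz; split; rewrite -ler_norml; apply: le_trans hz.
  exact: ler_reC.
exact: ler_imC.
Qed.

(** Without a maximum the interiors of the sets [v < v y], for [y] in [K], cover [K]; among finitely
    many such [y] the one with the largest value is not covered. *)
Lemma usc_max (T : ptopologicalType) (K : set T) (v : T -> \bar R) : compact K -> K !=set0 ->
  (forall x, K x -> forall c : \bar R, (v x < c)%E -> \forall y \near x, (v y < c)%E) ->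
  exists2 x0, K x0 & forall x, K x -> (v x <= v x0)%E.
Proof.
move=> cK [k0 Kk0] husc; apply: contrapT => hn.
have hmax x : K x -> exists2 y, K y & (v x < v y)%E.
  move=> Kx; apply: contrapT => hx; apply: hn; exists x => // y Ky.
  by rewrite leNgt; apply/negP => h; apply: hx; exists y.
move: cK; rewrite compact_cover => /(_ T K (fun y => [set x | (v x < v y)%E]°)).
case.
- by move=> y _; exact: open_interior.
- by move=> x Kx; have [y Ky xy] := hmax x Kx; exists y => //; exact: husc.
move=> D DK KD.
have Dn : exists d, d \in D.
  by have [d /= dD _] := KD _ Kk0; exists d.
have [d [dD dmax]] : exists d, d \in D /\ forall d', d' \in D -> (v d' <= v d)%E.
  have [d0 d0D] := Dn.
  have : exists2 d, d \in enum_fset D & forall d', d' \in enum_fset D -> (v d' <= v d)%E.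
    have := d0D; rewrite -[d0 \in D]/(d0 \in enum_fset D).
    elim: (enum_fset D) d0 {d0D} => // a s IH d _.
    case: s IH => [|b s] IH.
      by exists a; rewrite ?mem_head// => d'; rewrite inE => /eqP ->.
    have [m ms hm] := IH b (mem_head _ _).
    have [am|ma] := leP (v a) (v m).
      exists m; first by rewrite in_cons ms orbT.
      by move=> d'; rewrite in_cons => /predU1P[->//|]; exact: hm.
    exists a; first exact: mem_head.
    move=> d'; rewrite in_cons => /predU1P[->//|/hm h].
    by rewrite (le_trans h)// ltW.
  by move=> [d dD hd]; exists d; split.
have Kd : K d by apply: set_mem; exact: DK.
have [e /= eD /interior_subset/= vde] := KD d Kd.
by have := dmax e eD; rewrite leNgt vde.
Qed.

Lemma cont_max (K : set C) (v : C -> R) : compact K -> K !=set0 ->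
  (forall x, K x -> {for x, continuous v}) ->
  exists2 x0, K x0 & forall x, K x -> v x <= v x0.
Proof.
move=> cK K0 hv; have [|x0 Kx0 h] := @usc_max _ K (EFin \o v) cK K0.
  move=> x Kx [c| |] //=; last by move=> _; near=> y; rewrite ltry.
  rewrite lte_fin => xc; have /contP h := hv x Kx.
  have [d d0 hd] := h _ (eqbRL (subr_gt0 _ _) xc).
  apply/nearCP; exists d => // y /hd; rewrite lte_fin => /ltr_distlDr; rlra.
by exists x0 => // x /h.
Unshelve. all: by end_near.
Qed.

Lemma cont_bounded (K : set C) (v : C -> R) : compact K ->
  (forall x, K x -> {for x, continuous v}) -> exists2 M, 0 < M & forall x, K x -> v x <= M.
Proof.
move=> cK hv; have [->|/set0P K0] := eqVneq K set0; first by exists 1.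
have [x0 Kx0 h] := cont_max cK K0 hv; exists (`|v x0| + 1); first by rewrite ltr_wpDl.
by move=> x /h /le_trans; apply; have := ler_norm (v x0); rlra.
Qed.

Lemma cont_modc (H : C -> C) z : {for z, continuous H} ->
  {for z, continuous (fun z => modc (H z))}.
Proof.
move=> /contCP h; apply/contP => e e0; have [d d0 hd] := h e e0; exists d => // y /hd.
apply: le_lt_trans; rewrite ler_norml; apply/andP; split.
  by rewrite lerNl opprB modc_sym ler_modc_sub.
exact: ler_modc_sub.
Qed.

End Compactness.

(** * Cauchy estimate and maximum modulus at the centre of a square *)

Section MaxModulus.
Variable R : realType.
Local Notation C := (Cplx R).
Implicit Types (g : C -> C) (z : C).

Definition csq (z0 : C) (l : R) z := inrect (reC z0 - l) (reC z0 + l) (imC z0 - l) (imC z0 + l) z.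
Definition bsq (z0 : C) (l : R) z := onrect (reC z0 - l) (reC z0 + l) (imC z0 - l) (imC z0 + l) z.

Lemma bsq_modc z0 l z : 0 <= l -> bsq z0 l z -> l <= modc (z - z0).
Proof.
move=> l0 [_]; have := ler_reC (z - z0); have := ler_imC (z - z0).
rewrite reCB imCB !ler_norml => /andP[h1 h2] /andP[h3 h4].
by case=> h; rlra.
Qed.

Lemma csq_modc z0 l z : csq z0 l z -> modc (z - z0) <= 2 * l.
Proof.
move=> [/andP[a b] /andP[c d]]; rewrite [z - z0]mkCE (le_trans (modc_mk _ _))//.
by rewrite reCB imCB mulr_natl mulr2n lerD// ler_norml; apply/andP; split; rlra.
Qed.

Lemma im_inv (z : C) : imC z^-1 = - imC z / (reC z ^+ 2 + imC z ^+ 2).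
Proof. by case: z => a b; rewrite mulNr. Qed.
Lemma re_inv (z : C) : reC z^-1 = reC z / (reC z ^+ 2 + imC z ^+ 2).
Proof. by case: z => a b. Qed.

Lemma side_ge (l x : R) (phi : R -> R) : 0 < l -> ctn phi (x - l) (x + l) ->
  (forall t, x - l <= t <= x + l -> (2 * l)^-1 <= phi t) -> 1 <= segint phi (x - l) (x + l).
Proof.
move=> l0 c h; have l20 : 0 < 2 * l by rewrite mulr_gt0.
have -> : 1 = segint (fun=> (2 * l)^-1) (x - l) (x + l).
  rewrite Rint_cst; last by rlra.
  by field; rewrite lt0r_neq0.
by apply: le_Rint => // t _; exact: cst_continuous.
Qed.

Lemma frac_ge (l s : R) : 0 < l -> - l <= s <= l -> (2 * l)^-1 <= l / (s ^+ 2 + l ^+ 2).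
Proof.
move=> l0 /andP[h1 h2]; have l2 : 0 < l ^+ 2 by rewrite exprn_gt0.
have s2 : 0 <= s ^+ 2 by rewrite sqr_ge0.
have sl : s ^+ 2 <= l ^+ 2 by nra.
rewrite ler_pdivlMr; last rlra.
rewrite mulrC ler_pdivrMr ?mulr_gt0//; nra.
Qed.

(** The exact value is [2 * pi], but a lower bound suffices: on each side, of length [2 * l], the
    relevant component is [l / (s ^+ 2 + l ^+ 2)], at least [(2 * l)^-1]. *)
Lemma winding_ge z0 l : 0 < l ->
  4 <= imC (contour (fun z => (z - z0)^-1) (reC z0 - l) (reC z0 + l) (imC z0 - l) (imC z0 + l)).
Proof.
move=> l0; set x := reC z0; set y := imC z0.
have xx : x - l <= x + l by rlra.
have yy : y - l <= y + l by rlra.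
have bc : bcont (fun z => (z - z0)^-1) (x - l) (x + l) (y - l) (y + l).
  move=> z hz; have := bsq_modc (ltW l0) hz => lz.
  apply: hol_cont; apply: holV.
    by rewrite -modc_gt0 (lt_le_trans l0).
  by apply: holB; [exact: hol_id|exact: hol_cst].
have [c1 c2 c3 c4] := bcont_sides xx yy bc.
rewrite /contour !(imCB, imCD, imCM).
have ir : reC (iC R) = 0 by []. have ii : imC (iC R) = 1 by [].
rewrite ir ii !mul0r !mul1r !add0r !(imC_mk, reC_mk).
have e1 : 1 <= segint (imC \o (fun t => (mkC t (y - l) - z0)^-1)) (x - l) (x + l).
  apply: side_ge => //; first exact: pctn_im.
  move=> t /andP[h1 h2] /=; rewrite im_inv !imCB !reCB reC_mk imC_mk -/x -/y.
  have -> : - (y - l - y) = l by ring.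
  have -> : (y - l - y) = - l by ring.
  by rewrite sqrrN; apply: frac_ge => //; apply/andP; split; rlra.
have e2 : 1 <= segint (reC \o (fun t => (mkC (x + l) t - z0)^-1)) (y - l) (y + l).
  apply: side_ge => //; first exact: pctn_re.
  move=> t /andP[h1 h2] /=; rewrite re_inv !imCB !reCB reC_mk imC_mk -/x -/y.
  have -> : x + l - x = l by ring.
  by rewrite [l ^+ 2 + _]addrC; apply: frac_ge => //; apply/andP; split; rlra.
have e3 : 1 <= - segint (imC \o (fun t => (mkC t (y + l) - z0)^-1)) (x - l) (x + l).
  rewrite -mulN1r -RintZ; last exact: pctn_im.
  apply: side_ge => //.
    by move=> u hu; apply: cvgM; [exact: cvg_cst|exact: (pctn_im c2)].
  move=> t /andP[h1 h2] /=; rewrite im_inv !imCB !reCB reC_mk imC_mk -/x -/y.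
  have -> : y + l - y = l by ring.
  rewrite mulN1r mulNr opprK; apply: frac_ge => //; apply/andP; split; rlra.
have e4 : 1 <= - segint (reC \o (fun t => (mkC (x - l) t - z0)^-1)) (y - l) (y + l).
  rewrite -mulN1r -RintZ; last exact: pctn_re.
  apply: side_ge => //.
    by move=> u hu; apply: cvgM; [exact: cvg_cst|exact: (pctn_re c3)].
  move=> t /andP[h1 h2] /=; rewrite re_inv !imCB !reCB reC_mk imC_mk -/x -/y.
  have -> : x - l - x = - l by ring.
  rewrite sqrrN mulN1r mulNr opprK [l ^+ 2 + _]addrC.
  by apply: frac_ge => //; apply/andP; split; rlra.
by rewrite /comp in e1 e2 e3 e4 *; rlra.
Qed.


(** Cauchy's formula with an estimated winding number: the difference quotient integrates to 0, so
    [g z0] times the integral of [(z - z0)^-1], of modulus at least 4, is the integral of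
    [g z / (z - z0)], of modulus at most [16 * M]. *)
Lemma cauchy_csq g z0 l M : 0 < l -> (forall z, csq z0 l z -> hol g z) ->
  (forall z, bsq z0 l z -> modc (g z) <= M) -> modc (g z0) <= 4 * M.
Proof.
move=> l0 hg hM; have zz : csq z0 l z0 by split; apply/andP; split; rlra.
have [c hc] := hg z0 zz.
pose G z := if z == z0 then c else (g z - g z0) * (z - z0)^-1.
have Gh z : csq z0 l z -> z != z0 -> hol G z.
  move=> hz zn; apply: (@hol_near _ (fun z => (g z - g z0) * (z - z0)^-1)).
    apply/nearCP; exists (modc (z - z0)); first by rewrite modc_gt0 subr_eq0.
    move=> u hu; rewrite /G; case: eqVneq => // uz.
    by move: hu; rewrite uz modc_sym ltxx.
  apply: holM; first by apply: holB; [exact: hg|exact: hol_cst].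
  apply: holV; first by rewrite subr_eq0.
  by apply: holB; [exact: hol_id|exact: hol_cst].
have Gc z : csq z0 l z -> {for z, continuous G}.
  move=> hz; have [->|zn] := eqVneq z z0; last by apply: hol_cont; exact: Gh.
  apply/contCP => e e0; have [d d0 hd] := hc (e / 2) (divr_gt0 e0 (ltr0n _ 2)).
  exists d => // u ud; rewrite /G eqxx; case: eqVneq => [_|un].
    by rewrite subrr modc0.
  have u0 : u - z0 != 0 by rewrite subr_eq0.
  have -> : (g u - g z0) / (u - z0) - c = (g u - g z0 - c * (u - z0)) / (u - z0).
    by rewrite [RHS]mulrBl mulfK.
  rewrite modcM modcV ltr_pdivrMr ?modc_gt0//.
  apply: (le_lt_trans (hd u ud)); rewrite ltr_pM2r ?modc_gt0//.
  by rewrite ltr_pdivrMr// ltr_pMr// ltr1n.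
have [B B0 hB] : exists2 B, 0 < B & forall z, csq z0 l z -> modc (G z) <= B.
  apply: (@cont_bounded R (csq z0 l) (fun z => modc (G z))).
    exact: compact_rect.
  by move=> z /Gc; exact: cont_modc.
set x := reC z0; set y := imC z0.
have xl : x - l + l = x by rlra.
have yl : y - l + l = y by rlra.
have Gr : rcont G (x - l) (x + l) (y - l) (y + l) by [].
(* Cutting through [z0] makes it a corner of all four quarters, as [goursat_corner] requires. *)
have Z (a b : bool) : sq G (x - a%:R * l) (y - b%:R * l) l = 0.
  have sub z : insq (x - a%:R * l) (y - b%:R * l) l z -> csq z0 l z.
    move=> [/andP[h1 h2] /andP[h3 h4]]; rewrite /csq -/x -/y.
    move: h1 h2 h3 h4.
    by case: (a); case: (b); rewrite ?mul1r ?mul0r => h1 h2 h3 h4;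
      split; apply/andP; split; rlra.
  apply: (@goursat_corner _ _ _ _ _ z0 a b B) => //.
  - by move=> z hz; apply: Gc; exact: sub.
  - by move=> z hz; apply: hB; exact: sub.
  - by move=> z hz; apply: Gh; exact: sub.
  - by rewrite subrK.
  - by rewrite subrK.
have J0 : contour G (x - l) (x + l) (y - l) (y + l) = 0.
  rewrite (@contour_vsplit _ G (x - l) x (x + l))//; [|by apply/andP; split; rlra|by rlra].
  rewrite (@contour_hsplit _ G (x - l) x (y - l) y (y + l))//; last 3 first.
  - by rlra.
  - by apply/andP; split; rlra.
  - by move=> z [/andP[h1 h2] h]; apply: Gr; split => //; rewrite h1; rlra.
  rewrite (@contour_hsplit _ G x (x + l) (y - l) y (y + l))//; last 3 first.
  - by rlra.
  - by apply/andP; split; rlra.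
  - by move=> z [/andP[h1 h2] h]; apply: Gr; split => //; rewrite h2 andbT; rlra.
  have := Z true true; have := Z true false; have := Z false true; have := Z false false.
  rewrite !mul1r !mul0r !subr0 /sq !xl !yl => -> -> -> ->.
  by rewrite !addr0.
have xx : x - l <= x + l by rlra.
have yy : y - l <= y + l by rlra.
pose W z := (z - z0)^-1.
have bz z : bsq z0 l z -> z - z0 != 0.
  by move=> /(bsq_modc (ltW l0)) h; rewrite -modc_gt0 (lt_le_trans l0).
have Wc : bcont W (x - l) (x + l) (y - l) (y + l).
  move=> z hz; apply: hol_cont; apply: holV; first exact: bz.
  by apply: holB; [exact: hol_id|exact: hol_cst].
have gWc : bcont (fun z => g z * W z) (x - l) (x + l) (y - l) (y + l).
  move=> z hz; apply: hol_cont; apply: holM; first by apply: hg; case: hz.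
  apply: holV; first exact: bz.
  by apply: holB; [exact: hol_id|exact: hol_cst].
have E : contour (fun z => g z * W z) (x - l) (x + l) (y - l) (y + l) =
    g z0 * contour W (x - l) (x + l) (y - l) (y + l).
  have Gb : bcont G (x - l) (x + l) (y - l) (y + l) by exact: rcont_bcont.
  have Wc2 : bcont (fun z => g z0 * W z) (x - l) (x + l) (y - l) (y + l).
    move=> z hz; apply: hol_cont; apply: holM; first exact: hol_cst.
    apply: holV; first exact: bz.
    by apply: holB; [exact: hol_id|exact: hol_cst].
  transitivity (contour (fun z => G z + g z0 * W z) (x - l) (x + l) (y - l) (y + l)).
    apply: eq_contour => // z hz; rewrite /G; case: eqVneq => [zE|zn].
      by have := bz _ hz; rewrite zE subrr eqxx.
    by rewrite -mulrDl subrK.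
  by rewrite (contourD xx yy Gb Wc2) J0 add0r (contourZ (g z0) xx yy Wc).
have W4 : 4 <= modc (contour W (x - l) (x + l) (y - l) (y + l)).
  by apply: (le_trans (winding_ge z0 l0)); apply: le_trans (ler_norm _) (ler_imC _).
have M0 : 0 <= M.
  apply: le_trans (modc_ge0 _) (hM (mkC (x + l) y) _).
  by split; [split => /=; apply/andP; split; rlra|constructor 2].
have : modc (contour (fun z => g z * W z) (x - l) (x + l) (y - l) (y + l)) <= 16 * M.
  have -> : x + l = x - l + (2 * l) by ring.
  have -> : y + l = y - l + (2 * l) by ring.
  have -> : 16 * M = 8 * (M / l) * (2 * l) by field; exact: lt0r_neq0.
  have xE : x - l + 2 * l = x + l by ring.
  have yE : y - l + 2 * l = y + l by ring.
  apply: contour_bound; first rlra.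
    by rewrite xE yE.
  rewrite xE yE => z hz; rewrite modcM /W modcV ler_pM ?modc_ge0 ?invr_ge0 ?modc_ge0//.
    exact: hM.
  by rewrite lef_pV2 ?posrE//; [exact: bsq_modc (ltW l0) hz|rewrite modc_gt0 bz].
rewrite E modcM => h.
have := le_trans (ler_wpM2l (modc_ge0 (g z0)) W4) h; rlra.
Qed.

Lemma bernoulli (h : R) n : 0 <= h -> 1 + n%:R * h <= (1 + h) ^+ n.
Proof.
move=> h0; elim: n => [|n IH]; first by rewrite mul0r addr0 expr0.
rewrite exprS; apply: le_trans (ler_wpM2l _ IH); last by rlra.
rewrite -natr1; have : 0 <= n%:R :> R by []; nra.
Qed.

(** The Cauchy estimate for [g ^+ n] reads [|g z0|^n <= 4 * M^n]; letting [n] grow removes the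
    factor 4. *)
Lemma max_modulus_csq g z0 l M : 0 < l -> (forall z, csq z0 l z -> hol g z) ->
  (forall z, bsq z0 l z -> modc (g z) <= M) -> modc (g z0) <= M.
Proof.
move=> l0 hg hM.
have key n : modc (g z0) ^+ n <= 4 * M ^+ n.
  rewrite -modcX; apply: (@cauchy_csq (fun z => g z ^+ n) z0 l) => // z hz.
    by apply: holX; exact: hg.
  rewrite modcX lerXn2r ?nnegrE ?modc_ge0//; last exact: hM.
  by apply: le_trans (modc_ge0 _) (hM z hz).
rewrite leNgt; apply/negP => Mg.
have M0 : 0 <= M.
  apply: le_trans (modc_ge0 _) (hM (mkC (reC z0 + l) (imC z0)) _).
  by split; [split => /=; apply/andP; split; rlra|constructor 2].
have [M0'|Mp] := leP M 0.
  have := key 1%N; rewrite !expr1 => h; have : M = 0 by rlra.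
  by move=> ME; move: h Mg; rewrite ME; rlra.
pose h := modc (g z0) / M - 1.
have h0 : 0 < h by rewrite subr_gt0 ltr_pdivlMr// mul1r.
have hn n : 1 + n%:R * h <= 4.
  apply: le_trans (bernoulli n (ltW h0)) _; rewrite /h addrC subrK.
  by rewrite expr_div_n ler_pdivrMr ?exprn_gt0.
have [n hn'] : exists n : nat, 4 / h < n%:R.
  have := archi_boundP (divr_ge0 (ler0n R 4) (ltW h0)); by exists (Num.bound (4 / h)).
have := hn n; move: hn'; rewrite ltr_pdivrMr// => h1 h2; rlra.
Qed.

End MaxModulus.

(** * Subharmonicity of continuous functions, tested on harmonic polynomials *)

Section TestFunctions.
Variable R : realType.
Local Notation C := (Cplx R).
Implicit Types (u v : C -> R) (z : C) (g : C -> C).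

(* [tst v z0]: no harmonic polynomial [Re p], made strictly superharmonic by subtracting
   [e |z - z0|^2], touches [v] from above at [z0]; unlike the submean inequality,
   this form of subharmonicity at [z0] only depends on the germ of [v]. *)
Definition tst v (z0 : C) := forall (p : {poly C}) (e d : R), 0 < e -> 0 < d ->
  exists2 z, modc (z - z0) < d & v z0 + reC (p.[z] - p.[z0]) < v z + e * modc (z - z0) ^+ 2.

(** A whole neighbourhood is required because sums are treated through the sub-mean value
    inequality, which uses the test at every point of a disc. *)
Definition csh v (z0 : C) := exists2 d : R, 0 < d &
  forall z, modc (z - z0) < d -> {for z, continuous v} /\ tst v z.

Lemma cont_cst (c : R) (z0 : C) : {for z0, continuous (fun=> c : R)}.
Proof. exact: (@cst_continuous C R c z0). Qed.
Lemma cont_add u v (z0 : C) : {for z0, continuous u} -> {for z0, continuous v} ->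
  {for z0, continuous (fun z => u z + v z)}.
Proof. by move=> hu hv; exact: (cvgD hu hv). Qed.
Lemma cont_mul u v (z0 : C) : {for z0, continuous u} -> {for z0, continuous v} ->
  {for z0, continuous (fun z => u z * v z)}.
Proof. by move=> hu hv; exact: (cvgM hu hv). Qed.
Lemma cont_modcB (c : C) (z0 : C) : {for z0, continuous (fun z => modc (z - c))}.
Proof.
apply: cont_modc; apply: hol_cont; apply: holB; [exact: hol_id|exact: hol_cst].
Qed.
Lemma cont_modc_sqr (c : C) (z0 : C) : {for z0, continuous (fun z => modc (z - c) ^+ 2)}.
Proof. apply: cont_mul; exact: cont_modcB. Qed.

Lemma csh_near v z0 : csh v z0 -> exists2 d : R, 0 < d & forall z, modc (z - z0) < d -> csh v z.
Proof.
move=> [d d0 h]; exists d => // z zd; exists (d - modc (z - z0)); first by rewrite subr_gt0.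
by move=> y; rewrite ltrBrDr => yz; apply: h; exact: le_lt_trans (ler_modc_dist _ z _) yz.
Qed.

Lemma csh_cont v z0 : csh v z0 -> {for z0, continuous v}.
Proof. by move=> [d d0 /(_ z0)]; rewrite subrr modc0 => /(_ d0)[]. Qed.
Lemma csh_tst v z0 : csh v z0 -> tst v z0.
Proof. by move=> [d d0 /(_ z0)]; rewrite subrr modc0 => /(_ d0)[]. Qed.

(** A minorant touching [v] at [z0] hands its test on to [v]. Stability under maxima, and the
    subharmonicity of minus the logarithm of a distance, come from this. *)
Lemma tst_ge u v z0 (d : R) : 0 < d -> (forall z, modc (z - z0) < d -> u z <= v z) ->
  u z0 = v z0 -> tst u z0 -> tst v z0.
Proof.
move=> d0 uv e0 h p e d' e_gt0 d'0.
have [|z] := h p e (Num.min d d') e_gt0; first by rewrite lt_min d0.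
rewrite lt_min => /andP[zd zd'] hz; exists z => //; rewrite -e0.
by rewrite (lt_le_trans hz)// lerD2r uv.
Qed.

Lemma cont_near u v z0 (d : R) : 0 < d -> (forall z, modc (z - z0) < d -> u z = v z) ->
  {for z0, continuous u} -> {for z0, continuous v}.
Proof.
move=> d0 uv /contP h; apply/contP => e e0; have [d' d'0 hd] := h e e0.
exists (Num.min d d'); first by rewrite lt_min d0.
move=> z; rewrite lt_min => /andP[zd zd']; rewrite -!uv ?subrr ?modc0//.
exact: hd.
Qed.

Lemma csh_eq u v z0 (d : R) : 0 < d -> (forall z, modc (z - z0) < d -> u z = v z) ->
  csh u z0 -> csh v z0.
Proof.
move=> d0 uv [d' d'0 h]; exists (Num.min d d'); first by rewrite lt_min d0.
move=> z; rewrite lt_min => /andP[zd zd']; have [cu tu] := h z zd'.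
have s0 : 0 < d - modc (z - z0) by rewrite subr_gt0.
have hh y : modc (y - z) < d - modc (z - z0) -> u y = v y.
  by rewrite ltrBrDr => yz; apply: uv; exact: le_lt_trans (ler_modc_dist _ z _) yz.
split; first exact: cont_near hh cu.
apply: (tst_ge s0 _ _ tu); last by rewrite uv.
by move=> y /hh ->.
Qed.

Lemma cont_maxr u v z0 : {for z0, continuous u} -> {for z0, continuous v} ->
  {for z0, continuous (fun z => Num.max (u z) (v z))}.
Proof.
move=> /contP hu /contP hv; apply/contP => e e0.
have [d d0 hd] := hu e e0; have [d' d'0 hd'] := hv e e0.
exists (Num.min d d'); first by rewrite lt_min d0.
move=> z; rewrite lt_min => /andP[/hd + /hd'].
rewrite !ltr_norml => /andP[a1 a2] /andP[b1 b2].
by rewrite /Num.max; case: ifP; case: ifP; rewrite ?ltNge ?negbK => h1 h2; try apply/andP; split; rlra.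
Qed.

Lemma csh_max u v z0 : csh u z0 -> csh v z0 -> csh (fun z => Num.max (u z) (v z)) z0.
Proof.
move=> [d d0 h] [d' d'0 h']; exists (Num.min d d'); first by rewrite lt_min d0.
move=> z; rewrite lt_min => /andP[/h[cu tu] /h'[cv tv]]; split; first exact: cont_maxr.
have [uv|uv] := leP (u z) (v z).
  apply: (tst_ge (ltr01) _ _ tv) => [y _|]; first by rewrite le_max lexx orbT.
  by rewrite /=; apply/esym/max_idPr.
apply: (tst_ge (ltr01) _ _ tu) => [y _|]; first by rewrite le_max lexx.
by rewrite /=; apply/esym/max_idPl/ltW.
Qed.

Lemma csh_scale (c : R) v z0 : 0 < c -> csh v z0 -> csh (fun z => c * v z) z0.
Proof.
move=> c0 [d d0 h]; exists d => // z /h[cv tv]; split.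
  by apply: cont_mul => //; exact: cont_cst.
move=> p e d' e0 d'0; have [y yd hy] := tv (toC c^-1 *: p) (e / c) d' (divr_gt0 e0 c0) d'0.
exists y => //; move: hy; rewrite !hornerZ -mulrBr reCM reC_toC imC_toC mul0r subr0.
rewrite -(ltr_pM2l c0) !mulrDr !mulrA divff ?gt_eqF// mul1r.
by rewrite [c * e / c]mulrAC divff ?gt_eqF// mul1r.
Qed.

Lemma csh_addc (c : R) v z0 : csh v z0 -> csh (fun z => v z + c) z0.
Proof.
move=> [d d0 h]; exists d => // z /h[cv tv]; split.
  by apply: cont_add => //; exact: cont_cst.
move=> p e d' e0 d'0; have [y yd hy] := tv p e d' e0 d'0.
by exists y => //; rewrite !(addrAC _ c) ltrD2r.
Qed.

(** Lets [(1 - P / m) ^ m] replace the complex exponential of [- P], at the cost of a quadratic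
    error. *)
Lemma modc_1B_exp (x : C) : modc (1 - x) <= expR (- reC x + modc x ^+ 2 / 2).
Proof.
rewrite -ler_sqr ?nnegrE ?modc_ge0 ?expR_ge0// -expRM_natl [in leLHS]modc_sqr.
rewrite reCB imCB [reC 1]/= [imC 1]/= sub0r sqrrN.
apply: le_trans (expR_ge1Dx _); rewrite modc_sqr.
by rewrite le_eqVlt; apply/orP; left; apply/eqP; field.
Qed.

Lemma eq_le_trans' (x y w : R) : x = y -> y <= w -> x <= w. Proof. by move=> ->. Qed.

(** If the test failed for [p], then [g] times the exponential of [- P], with [P = p - p(z0)], would
    on the boundary of a small square have modulus at most [|g z0|] times [expR (- e * l ^+ 2)],
    against the maximum modulus principle at the centre. *)
Lemma tst_lnabs g z0 : g z0 != 0 ->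
  (exists2 d : R, 0 < d & forall z, modc (z - z0) < d -> hol g z) ->
  tst (fun z => ln (modc (g z))) z0.
Proof.
move=> g0 [d1 d10 hg] p e d e0 d0.
have [d2 d20 hd2] : exists2 d : R, 0 < d & forall z, modc (z - z0) < d -> g z != 0.
  have /hol_cont/cont_modc/contP hc : hol g z0 by apply: hg; rewrite subrr modc0.
  have [|d' d'0 hd'] := hc (modc (g z0)); first by rewrite modc_gt0.
  exists d' => // z /hd'; apply: contraTneq => ->.
  by rewrite modc0 sub0r normrN ger0_norm ?modc_ge0// ltxx.
pose l := Num.min d (Num.min d1 d2) / 4.
have l0 : 0 < l by rewrite divr_gt0// !lt_min d0 d10.
have ld z : csq z0 l z -> [/\ modc (z - z0) < d, modc (z - z0) < d1 & modc (z - z0) < d2].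
  move=> /csq_modc; have : Num.min d (Num.min d1 d2) = 4 * l by rewrite /l; field.
  have : Num.min d (Num.min d1 d2) <= d by rewrite ge_min lexx.
  have : Num.min d (Num.min d1 d2) <= d1 by rewrite !ge_min lexx orbT.
  have : Num.min d (Num.min d1 d2) <= d2 by rewrite !ge_min lexx !orbT.
  by move=> h1 h2 h3 h4 h5; split; rlra.
apply: contrapT => hn.
have key z : csq z0 l z -> ln (modc (g z)) + e * modc (z - z0) ^+ 2 <=
    ln (modc (g z0)) + reC (p.[z] - p.[z0]).
  by move=> /ld[zd _ _]; rewrite leNgt; apply/negP => h; apply: hn; exists z.
pose P z : C := p.[z] - p.[z0].
have Ph z : hol P z by apply: holB; [exact: hol_poly|exact: hol_cst].
have [B B0 hB] : exists2 B, 0 < B & forall z, csq z0 l z -> modc (P z) <= B.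
  apply: (@cont_bounded R (csq z0 l) (fun z => modc (P z))).
    exact: compact_rect.
  by move=> z _; apply: cont_modc; exact: hol_cont.
have el0 : 0 < e * l ^+ 2 by rewrite mulr_gt0// exprn_gt0.
(* Replacing the exponential by an [m]-th power adds at most [B ^+ 2 / (2 * m)] to the exponent; [m]
   makes this smaller than the gain [e * l ^+ 2]. *)
have [m hm] : exists m : nat, B ^+ 2 / (e * l ^+ 2) < m%:R.
  have := archi_boundP (divr_ge0 (sqr_ge0 B) (ltW el0)); by exists (Num.bound (B ^+ 2 / (e * l ^+ 2))).
have m0 : 0 < m%:R :> R by apply: le_lt_trans hm; rewrite divr_ge0 ?sqr_ge0// ltW.
have hmB : B ^+ 2 / (2 * m%:R) < e * l ^+ 2.
  rewrite ltr_pdivrMr ?mulr_gt0//; move: hm; rewrite ltr_pdivrMr//.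
  by move=> hm; apply: (lt_trans hm); rewrite [ltLHS]mulrC ltr_pM2l// ltr_pMl// ltr1n.
pose G z := g z * (1 - toC m%:R^-1 * P z) ^+ m.
have : modc (G z0) <= modc (g z0) * expR (B ^+ 2 / (2 * m%:R) - e * l ^+ 2).
  apply: (@max_modulus_csq _ G z0 l) => //.
    move=> z /ld[_ zd _]; apply: holM; first exact: hg.
    apply: holX; apply: holB; first exact: hol_cst.
    by apply: holM; [exact: hol_cst|exact: Ph].
  move=> z hz; have zc : csq z0 l z by case: hz.
  have [zd zd1 zd2] := ld z zc.
  have gz : 0 < modc (g z) by rewrite modc_gt0 hd2.
  have gz0 : 0 < modc (g z0) by rewrite modc_gt0.
  have lz := bsq_modc (ltW l0) hz.
  have h1 : modc (g z) <= modc (g z0) * expR (reC (P z) - e * l ^+ 2).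
    rewrite -[leLHS]lnK ?posrE// -[X in X * _]lnK ?posrE// -expRD ler_expR.
    have := key z zc; rewrite -/(P z) => k1.
    have : e * l ^+ 2 <= e * modc (z - z0) ^+ 2.
      by rewrite ler_pM2l// lerXn2r// ?nnegrE ?modc_ge0// ltW.
    rlra.
  have h2 : modc ((1 - toC m%:R^-1 * P z) ^+ m) <= expR (- reC (P z) + B ^+ 2 / (2 * m%:R)).
    rewrite modcX; apply: le_trans (_ : expR (- reC (toC m%:R^-1 * P z) + modc (toC m%:R^-1 * P z) ^+ 2 / 2) ^+ m <= _).
      by apply: lerXn2r; rewrite ?nnegrE ?modc_ge0 ?expR_ge0//; exact: modc_1B_exp.
    rewrite -expRM_natl ler_expR reCM reC_toC imC_toC mul0r subr0 modcM modc_toC.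
    rewrite ger0_norm ?invr_ge0 ?ler0n// [leLHS]mulrDr mulrN [X in - X]mulrA divff ?gt_eqF// mul1r lerD2l.
    rewrite exprMn; apply: le_trans (_ : m%:R * (m%:R^-1 ^+ 2 * B ^+ 2 / 2) <= _).
      rewrite ler_pM2l// ler_pM2r ?invr_gt0// ler_pM2l ?exprn_gt0 ?invr_gt0//.
      by rewrite lerXn2r// ?nnegrE ?modc_ge0 ?(ltW B0)//; exact: hB.
    by apply: eq_le_trans' (lexx _); field; rewrite gt_eqF.
  rewrite modcM; apply: le_trans (ler_pM (modc_ge0 _) (modc_ge0 _) h1 h2) _.
  rewrite -mulrA -expRD ler_pM2l// ler_expR; rlra.
rewrite /G /P subrr mulr0 subr0 expr1n mulr1.
rewrite -[leLHS]mulr1 ler_pM2l ?modc_gt0// -[leLHS]expR0 ler_expR; rlra.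
Qed.

Lemma cont_ln (r : C -> R) z0 : 0 < r z0 -> {for z0, continuous r} ->
  {for z0, continuous (fun z => ln (r z))}.
Proof.
move=> r0 h; apply: (continuous_comp h).
exact: continuous_ln.
Qed.

Lemma csh_lnabs g z0 : g z0 != 0 ->
  (exists2 d : R, 0 < d & forall z, modc (z - z0) < d -> hol g z) ->
  csh (fun z => ln (modc (g z))) z0.
Proof.
move=> g0 [d1 d10 hg].
have [d2 d20 hd2] : exists2 d : R, 0 < d & forall z, modc (z - z0) < d -> g z != 0.
  have /hol_cont/cont_modc/contP hc : hol g z0 by apply: hg; rewrite subrr modc0.
  have [|d' d'0 hd'] := hc (modc (g z0)); first by rewrite modc_gt0.
  exists d' => // z /hd'; apply: contraTneq => ->.
  by rewrite modc0 sub0r normrN ger0_norm ?modc_ge0// ltxx.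
exists (Num.min d1 d2); first by rewrite lt_min d10.
move=> z; rewrite lt_min => /andP[z1 z2]; split.
  by apply: cont_ln; [rewrite modc_gt0 hd2|apply/cont_modc/hol_cont/hg].
apply: tst_lnabs; first exact: hd2.
exists (d1 - modc (z - z0)); first by rewrite subr_gt0.
by move=> y; rewrite ltrBrDr => yz; apply: hg; exact: le_lt_trans (ler_modc_dist _ z _) yz.
Qed.

Lemma csh_cst (c : R) z0 : csh (fun=> c) z0.
Proof.
have -> : (fun=> c) = (fun=> ln (modc (toC (expR c)))) :> (C -> R).
  by apply: funext => z; rewrite modc_toC ger0_norm ?expR_ge0// expRK.
apply: (@csh_lnabs (fun=> toC (expR c))).
  by rewrite -modc_gt0 modc_toC ger0_norm ?expR_ge0// expR_gt0.
by exists 1 => // z _; exact: hol_cst.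
Qed.

Lemma modc_sqrB (z w : C) : modc z ^+ 2 =
  modc w ^+ 2 + 2 * reC (conjc w * (z - w)) + modc (z - w) ^+ 2.
Proof.
rewrite !modc_sqr reCM reCB imCB.
have -> : reC (conjc w : C) = reC w by case: w.
have -> : imC (conjc w : C) = - imC w by case: w.
by ring.
Qed.

(** Expanding [|z - c|^2] about [z0] gives a constant, the real part of an affine polynomial and
    [|z - z0|^2]; the opposite of the affine part is the polynomial to test with. *)
Lemma tst_nomax v z0 (c : C) (e d : R) : tst v z0 -> 0 < e -> 0 < d ->
  exists2 z, modc (z - z0) < d & v z0 + e * modc (z0 - c) ^+ 2 < v z + e * modc (z - c) ^+ 2.
Proof.
move=> h e0 d0.
have [z zd hz] := h ((- toC (2 * e) * conjc (z0 - c)) *: 'X) e d e0 d0.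
exists z => //; move: hz; rewrite !hornerZ !hornerX -mulrBr.
have := modc_sqrB (z - c) (z0 - c).
have -> : z - c - (z0 - c) = z - z0 by ring.
have -> : - toC (2 * e) * (z0 - c)^*%C * (z - z0) = - (toC (2 * e) * ((z0 - c)^*%C * (z - z0))) by ring.
rewrite [reC (- _)]reCN [reC (toC _ * _)]reCM reC_toC imC_toC mul0r subr0 => ->.
set r := reC _; move=> hz.
have -> : e * (modc (z0 - c) ^+ 2 + 2 * r + modc (z - z0) ^+ 2) =
  e * modc (z0 - c) ^+ 2 + 2 * e * r + e * modc (z - z0) ^+ 2 by ring.
rlra.
Qed.

(** With [e * |z|^2] added, a function satisfying the test has no interior maximum; [e] is so small
    that the addition takes at most half of the supposed excess over [M]. *)
Lemma max_principle (K : set C) v (M : R) : compact K ->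
  (forall z, K z -> {for z, continuous v}) ->
  (forall z, K z -> v z <= M \/
     (tst v z /\ exists2 d : R, 0 < d & forall y, modc (y - z) < d -> K y)) ->
  forall z, K z -> v z <= M.
Proof.
move=> cK hv hK z1 Kz1; rewrite leNgt; apply/negP => Mv.
have [B B0 hB] : exists2 B, 0 < B & forall z, K z -> modc z ^+ 2 <= B.
  have [|B B0 hB] := @cont_bounded R K (fun z => modc (z - 0) ^+ 2) cK.
    by move=> z _; exact: cont_modc_sqr.
  by exists B => // z /hB; rewrite subr0.
pose e := (v z1 - M) / (2 * B).
have e0 : 0 < e by rewrite divr_gt0 ?subr_gt0// mulr_gt0.
have eB : e * B = (v z1 - M) / 2 by rewrite /e; field; rewrite gt_eqF.
pose w z := v z + e * modc (z - 0) ^+ 2.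
have [|z0 Kz0 hz0] := @cont_max R K w cK (ex_intro _ z1 Kz1).
  move=> z Kz; apply: cont_add; first exact: hv.
  by apply: cont_mul; [exact: cont_cst|exact: cont_modc_sqr].
have w1 := hz0 z1 Kz1.
have h1 : v z1 <= w z1 by rewrite lerDl mulr_ge0 ?sqr_ge0// ltW.
have h0 : w z0 <= v z0 + e * B by rewrite lerD2l ler_pM2l// subr0 hB.
case: (hK z0 Kz0) => [vM|[tv [d d0 hd]]]; first rlra.
have [z zd] := tst_nomax 0 tv e0 d0.
by rewrite -/(w z0) -/(w z) ltNge hz0//; exact: hd.
Qed.

End TestFunctions.

(** * Removable singularities *)

Section Removable.
Variable R : realType.
Local Notation C := (Cplx R).
Implicit Types (z : C) (f g : C -> C).

Lemma openCP (U : set C) : open U <->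
  forall z, U z -> exists2 d : R, 0 < d & forall y, modc (y - z) < d -> U y.
Proof.
split=> [oU z Uz|h]; first by apply/nearCP; exact: (open_nbhs_nbhs (conj oU Uz)).
by rewrite openE => z /h /nearCP.
Qed.

Lemma closedCP (K : set C) :
  (forall z, ~ K z -> exists2 d : R, 0 < d & forall y, modc (y - z) < d -> ~ K y) -> closed K.
Proof. by move=> h; rewrite -openC; apply/openCP. Qed.

Lemma closed_le (v : C -> R) (M : R) : (forall z, {for z, continuous v}) ->
  closed [set z | v z <= M].
Proof.
move=> hv; apply: closedCP => z /negP; rewrite -ltNge => Mv.
have /contP h := hv z; have [|d d0 hd] := h (v z - M); first by rewrite subr_gt0.
exists d => // y /hd; rewrite ltr_norml => /andP[h1 _]; apply/negP; rewrite -ltNge; rlra.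
Qed.

Lemma closed_ge (v : C -> R) (M : R) : (forall z, {for z, continuous v}) ->
  closed [set z | M <= v z].
Proof.
move=> hv; apply: closedCP => z /negP; rewrite -ltNge => Mv.
have /contP h := hv z; have [|d d0 hd] := h (M - v z); first by rewrite subr_gt0.
exists d => // y /hd; rewrite ltr_norml => /andP[_ h1]; apply/negP; rewrite -ltNge; rlra.
Qed.

(** Also used for closed discs, with [t = 0], and for circles, with [t = s]. *)
Lemma compact_annulus (b : C) (t s : R) : compact [set z | t <= modc (z - b) <= s].
Proof.
have -> : [set z | t <= modc (z - b) <= s] =
    [set z | t <= modc (z - b)] `&` [set z | modc (z - b) <= s].
  by apply/seteqP; split => z /= => [/andP[]|[-> ->]].
apply: (@bounded_closed_compactC _ _ (s + modc b)).
  by apply: closedI; [apply: closed_ge|apply: closed_le] => z; exact: cont_modcB.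
move=> z [_ /= h]; have := ler_modc_sub z b; rlra.
Qed.

(** Truncating at [M / 2] keeps the logarithm continuous at the zeros of [g], and changes nothing
    where [|g| > M], the only place where the test is needed. *)
Lemma max_modulus (K : set C) g (M : R) : 0 < M -> compact K ->
  (forall z, K z -> {for z, continuous g}) ->
  (forall z, K z -> modc (g z) <= M \/ exists2 d : R, 0 < d &
     forall y, modc (y - z) < d -> K y /\ hol g y) ->
  forall z, K z -> modc (g z) <= M.
Proof.
move=> M0 cK gc hK.
pose v z := ln (Num.max (modc (g z)) (M / 2)).
have M20 : 0 < M / 2 by rewrite divr_gt0.
have vp z : 0 < Num.max (modc (g z)) (M / 2) by rewrite lt_max M20 orbT.
have vM z : (v z <= ln M) = (modc (g z) <= M).
  rewrite /v ler_ln ?posrE// ge_max [M / 2 <= M](_ : _ = true) ?andbT//.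
  by apply/idP; rlra.
move=> z Kz; rewrite -vM; apply: (max_principle cK) => // {Kz}z Kz.
  apply: cont_ln => //; apply: cont_maxr; last exact: cont_cst.
  by apply: cont_modc; exact: gc.
have [zM|zM] := leP (modc (g z)) M; [by left; rewrite vM|right].
case: (hK z Kz) => [|[d d0 hd]]; first by rewrite leNgt zM.
split; last by exists d => // y /hd[].
have /cont_modc/contP h := gc z Kz.
have [|d1 d10 hd1] := h (modc (g z) - M / 2); first by rewrite subr_gt0; rlra.
apply: csh_tst; apply: (csh_eq d10 _ (@csh_lnabs _ g z _ _)).
- move=> y /hd1; rewrite ltr_norml => /andP[h1 _].
  by rewrite /v; congr ln; apply/esym/max_idPl; rlra.
- by rewrite -modc_gt0; rlra.
- by exists d => // y /hd[].
Qed.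

Lemma pow_bound (x c M : R) : 0 <= x -> 0 < M -> (forall n, x ^+ n <= c * M ^+ n) -> x <= M.
Proof.
move=> x0 M0 h; rewrite leNgt; apply/negP => Mx.
pose k := x / M - 1.
have k0 : 0 < k by rewrite subr_gt0 ltr_pdivlMr// mul1r.
have hn n : 1 + n%:R * k <= c.
  apply: le_trans (bernoulli n (ltW k0)) _; rewrite /k addrC subrK.
  by rewrite expr_div_n ler_pdivrMr ?exprn_gt0.
have c0 : 0 <= c by have := hn 0%N; rlra.
have [n hn'] : exists n : nat, c / k < n%:R.
  have := archi_boundP (divr_ge0 c0 (ltW k0)); by exists (Num.bound (c / k)).
have := hn n; move: hn'; rewrite ltr_pdivrMr// => h1 h2; rlra.
Qed.

(** The product of [g ^ n] with [q], which vanishes at both punctures, is continuous there because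
    [g] is bounded. On the circle [|q| <= 2 * s ^+ 2], a constant that disappears as [n] grows. *)
Lemma max_modulus_punctured (b e1 : C) (s B M : R) g : 0 < s -> 0 < M -> modc (e1 - b) < s ->
  (forall z, modc (z - b) <= s -> z != b -> z != e1 -> hol g z) ->
  (forall z, modc (z - b) <= s -> z != b -> z != e1 -> modc (g z) <= B) ->
  (forall z, modc (z - b) = s -> modc (g z) <= M) ->
  forall z, modc (z - b) <= s -> z != b -> z != e1 -> modc (g z) <= M.
Proof.
move=> s0 M0 e1s hg gB gM z zs zb ze.
pose q u : C := (u - b) * (u - e1).
have qh u : hol q u.
  by apply: holM; apply: holB; try exact: hol_id; exact: hol_cst.
have qz : 0 < modc (q z) by rewrite modc_gt0 mulf_neq0// subr_eq0.
apply: (@pow_bound _ (2 * s ^+ 2 / modc (q z))) => // [|n]; first exact: modc_ge0.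
rewrite mulrAC ler_pdivlMr// -modcX -modcM.
have s20 : 0 < s ^+ 2 by rewrite exprn_gt0.
pose G u := g u ^+ n * q u.
have Gh u : modc (u - b) <= s -> u != b -> u != e1 -> hol G u.
  by move=> h1 h2 h3; apply: holM => //; apply: holX; exact: hg.
apply: (@max_modulus [set u | modc (u - b) <= s] G) => //.
- by rewrite !mulr_gt0// exprn_gt0.
- rewrite (_ : mkset _ = [set u | 0 <= modc (u - b) <= s]); first exact: compact_annulus.
  by apply/seteqP; split => u /=; rewrite modc_ge0.
- move=> u us.
  have [uq|uq] := eqVneq (q u) 0; last first.
    apply: hol_cont; apply: Gh => //.
      by apply: contraNneq uq => ->; rewrite /q subrr mul0r.
    by apply: contraNneq uq => ->; rewrite /q subrr mulr0.
  have [us'|us'] := ltP (modc (u - b)) s; last first.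
    apply: hol_cont; apply: holM => //; apply: holX.
    have uE : modc (u - b) = s by apply/eqP; rewrite eq_le us us'.
    apply: hg => //.
      by apply: contraTneq s0 => ub; rewrite -uE ub subrr modc0 ltxx.
    by apply: contraTneq e1s => ub; rewrite -uE ub ltxx.
  apply/contCP => e e0; rewrite /G uq mulr0.
  pose B1 := (1 + `|B|) ^+ n; have B10 : 0 < B1 by rewrite exprn_gt0// ltr_pwDl.
  have /contCP hq := hol_cont (qh u).
  have [d d0 hd] := hq (e / B1) (divr_gt0 e0 B10).
  exists (Num.min d (s - modc (u - b))); first by rewrite lt_min d0 subr_gt0.
  move=> y; rewrite lt_min => /andP[yd ys]; rewrite subr0.
  have ys' : modc (y - b) <= s.
    apply: le_trans (ler_modc_dist _ u _) _; rlra.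
  have [->|yb] := eqVneq y b; first by rewrite /q subrr mul0r mulr0 modc0.
  have [->|ye] := eqVneq y e1; first by rewrite /q subrr !mulr0 modc0.
  have := hd y yd; rewrite uq subr0 ltr_pdivlMr// => hqy.
  rewrite modcM (le_lt_trans _ hqy)// mulrC ler_wpM2l ?modc_ge0//.
  rewrite modcX lerXn2r ?nnegrE ?modc_ge0 ?addr_ge0//.
  by apply: le_trans (gB y ys' yb ye) _; have := ler_norm B; rlra.
- move=> u us.
  have [uq|uq] := eqVneq (q u) 0.
    by left; rewrite /G uq mulr0 modc0 !mulr_ge0// ?exprn_ge0// ltW.
  have ub : u != b by apply: contraNneq uq => ->; rewrite /q subrr mul0r.
  have ue : u != e1 by apply: contraNneq uq => ->; rewrite /q subrr mulr0.
  have [us'|us'] := ltP (modc (u - b)) s; [right|left].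
    exists (Num.min (s - modc (u - b)) (Num.min (modc (u - b)) (modc (u - e1)))).
      by rewrite !lt_min subr_gt0 us' !modc_gt0 !subr_eq0 ub ue.
    move=> y; rewrite !lt_min => /and3P[y1 y2 y3].
    have ys : modc (y - b) <= s by apply: le_trans (ler_modc_dist _ u _) _; rlra.
    split => //; apply: Gh => //.
      by apply: contraTneq y2 => ->; rewrite modc_sym ltxx.
    by apply: contraTneq y3 => ->; rewrite modc_sym ltxx.
  have uE : modc (u - b) = s by apply/eqP; rewrite eq_le us us'.
  rewrite /G modcM modcX mulrC ler_pM ?modc_ge0 ?exprn_ge0 ?modc_ge0//.
    rewrite /q modcM uE expr2 mulrCA ler_pM2l//.
    apply: le_trans (ler_modc_dist _ b _) _; rewrite uE (modc_sym b); rlra.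
  by rewrite lerXn2r ?nnegrE ?modc_ge0 ?(ltW M0)//; exact: gM.
Qed.

Definition pball (b : C) (r : R) (z : C) := 0 < modc (z - b) < r.

(** The difference quotient of [f] at [w] is bounded with punctures [b] and [w], so it is controlled
    by its values on the circle of radius [2 * s], whose points are at distance at least [s] from
    [w]. *)
Lemma punctured_lipschitz (b : C) (r M : R) f : 0 < r ->
  (forall z, pball b r z -> hol f z) -> (forall z, pball b r z -> modc (f z) <= M) ->
  exists s L : R, [/\ 0 < s < r, 0 < L & forall z w, pball b s z -> pball b s w ->
    modc (f z - f w) <= L * modc (z - w)].
Proof.
move=> r0 hf fM.
have M0 : 0 <= M.
  apply: le_trans (modc_ge0 _) (fM (b + toC (r / 2)) _).
  rewrite /pball addrC addKr modc_toC gtr0_norm ?divr_gt0//.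
  by apply/andP; split; rlra.
pose s := r / 4; pose L := (2 * M + 1) / s.
have s0 : 0 < s by rewrite divr_gt0.
have L0 : 0 < L by rewrite divr_gt0//; rlra.
have sr : s = r / 4 by [].
exists s, L; split => //; first by apply/andP; split; rlra.
move=> z w /andP[z0 zs] /andP[w0 ws].
have [->|zw] := eqVneq z w; first by rewrite !subrr modc0 mulr0.
have wr : pball b r w by apply/andP; split=> //; rlra.
have [c hc] := hf w wr; have [d d0 hd] := hc 1 ltr01.
pose F u := (f u - f w) * (u - w)^-1.
have zw0 : 0 < modc (z - w) by rewrite modc_gt0 subr_eq0.
rewrite -ler_pdivrMr// -modcV -modcM -/(F z).
have pb u : modc (u - b) <= 2 * s -> u != b -> pball b r u.
  by rewrite -subr_eq0 -modc_gt0 => u1 u2; apply/andP; split=> //; rlra.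
apply: (@max_modulus_punctured b w (2 * s) (Num.max (modc c + 1) (2 * M / d)) L F) => //.
- by rewrite mulr_gt0.
- by rlra.
- move=> u u1 u2 u3; apply: holM.
    by apply: holB; [exact/hf/pb|exact: hol_cst].
  apply: holV; first by rewrite subr_eq0.
  by apply: holB; [exact: hol_id|exact: hol_cst].
- move=> u u1 u2 u3; rewrite le_max; have uw : 0 < modc (u - w) by rewrite modc_gt0 subr_eq0.
  have [ud|ud] := ltP (modc (u - w)) d; apply/orP; [left|right].
    rewrite /F modcM modcV ler_pdivrMr//; have := hd u ud; rewrite mul1r.
    have := ler_modc_sub (f u - f w) (c * (u - w)); rewrite modcM; rlra.
  rewrite /F modcM modcV ler_pM ?modc_ge0 ?invr_ge0 ?modc_ge0//.
    apply: le_trans (ler_modcB _ _) _; have := fM u (pb _ u1 u2); have := fM w wr; rlra.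
  by rewrite lef_pV2 ?posrE.
- move=> u u1; have ub : u != b by rewrite -subr_eq0 -modc_gt0; rlra.
  rewrite /F /L modcM modcV ler_pM ?modc_ge0 ?invr_ge0 ?modc_ge0//.
    apply: le_trans (ler_modcB _ _) _.
    have u1' : modc (u - b) <= 2 * s by rewrite u1.
    have := fM u (pb _ u1' ub); have := fM w wr; rlra.
  rewrite lef_pV2 ?posrE//.
    have := ler_modc_dist u w b; rlra.
  have := ler_modc_dist u w b; rlra.
- by rlra.
- by rewrite -subr_eq0 -modc_gt0.
Qed.

(** The value [a] is a cluster point of [f] along punctured neighbourhoods of [b], which exists as
    the values stay in a closed disc; the Lipschitz bound makes it a limit. *)
Lemma punctured_limit (b : C) (s L : R) f : 0 < s -> 0 < L ->
  (forall z w, pball b s z -> pball b s w -> modc (f z - f w) <= L * modc (z - w)) ->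
  exists a : C, forall z, pball b s z -> modc (f z - a) <= L * modc (z - b).
Proof.
move=> s0 L0 hL.
pose z1 := b + toC (s / 2).
have z1s : pball b s z1.
  rewrite /pball addrC addKr modc_toC gtr0_norm ?divr_gt0//.
  by apply/andP; split; rlra.
pose K := [set u : C | 0 <= modc (u - f z1) <= L * (2 * s)].
have cK : compact K by exact: compact_annulus.
pose F : set_system C := f @ within (pball b s) (nbhs b).
have pF : ProperFilter (within (pball b s) (nbhs b)).
  apply: Build_ProperFilter_ex => P /nearCP[d d0 hd].
  pose t := Num.min d s / 2; have t0 : 0 < t by rewrite divr_gt0// lt_min d0.
  have tm : Num.min d s = 2 * t by rewrite /t; field.
  have md : Num.min d s <= d by rewrite ge_min lexx.
  have ms : Num.min d s <= s by rewrite ge_min lexx orbT.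
  have td : t < d by rlra.
  have ts : t < s by rlra.
  exists (b + toC t); apply: hd; rewrite /pball addrC addKr modc_toC gtr0_norm//.
  by rewrite t0.
have FK : F K.
  apply/nearCP; exists s => // z zs zb; apply/andP; split; first exact: modc_ge0.
  apply: le_trans (hL _ _ zb z1s) _; rewrite ler_pM2l//.
  apply: le_trans (ler_modc_dist _ b _) _; move: zb z1s => /andP[_ ?] /andP[_ ?].
  by rewrite (modc_sym b); rlra.
have [a [Ka ca]] := cK F _ FK.
exists a => z zs; apply/ler_addgt0Pr => e e0.
pose e' := e / (L + 1); have e'0 : 0 < e' by rewrite divr_gt0//; rlra.
have [||y [[u [ub us] <-] ua]] := ca [set f u | u in [set u | modc (u - b) < e' /\ pball b s u]] [set u | modc (u - a) < e'].
- apply/nearCP; exists e' => // u ue ub; exists u => //.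
- by apply/nearCP; exists e'.
- rewrite /= in ua.
  apply: le_trans (ler_modc_dist _ (f u) _) _.
  have h1 := hL _ _ zs us.
  have h2 := ler_modc_dist z b u; rewrite (modc_sym b) in h2.
  have h3 : L * modc (z - u) <= L * (modc (z - b) + e') by rewrite ler_pM2l//; rlra.
  have h4 : L * e' + e' = e by rewrite /e'; field; rlra.
  rewrite mulrDr in h3; rlra.
Qed.

(** The Lipschitz argument is used twice: on [f], to find the value [a], and on the bounded quotient
    [k = (f - a) / (z - b)], whose limit [c] is the derivative at [b]. *)
Lemma removable (b : C) (r M : R) f : 0 < r ->
  (forall z, pball b r z -> hol f z) -> (forall z, pball b r z -> modc (f z) <= M) ->
  exists a : C, forall z, modc (z - b) < r -> hol (fun u => if u == b then a else f u) z.
Proof.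
move=> r0 hf fM.
have [s [L [/andP[s0 sr] L0 hL]]] := punctured_lipschitz r0 hf fM.
have [a ha] := punctured_limit s0 L0 hL.
pose k z := (f z - a) * (z - b)^-1.
have pn z : pball b s z -> z != b.
  by move=> /andP[]; rewrite modc_gt0 subr_eq0.
have hk z : pball b s z -> hol k z.
  move=> zs; have zb := pn z zs; move: zs => /andP[z0 zs]; apply: holM.
    by apply: holB; [apply: hf; apply/andP; split=> //; rlra|exact: hol_cst].
  apply: holV; first by rewrite subr_eq0.
  by apply: holB; [exact: hol_id|exact: hol_cst].
have kL z : pball b s z -> modc (k z) <= L.
  move=> zs; have z0 : 0 < modc (z - b) by case/andP: zs.
  by rewrite /k modcM modcV ler_pdivrMr//; exact: ha.
have [s' [L' [/andP[s'0 s's] L'0 hL']]] := punctured_lipschitz s0 hk kL.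
have [c hc] := punctured_limit s'0 L'0 hL'.
exists a => z zr; have [->|zb] := eqVneq z b.
  exists c => e e0; exists (Num.min s' (e / L')); first by rewrite lt_min s'0 divr_gt0.
  move=> u; rewrite lt_min eqxx => /andP[us ue].
  case: eqVneq => [->|ub]; first by rewrite !subrr mulr0 subrr modc0 mulr0.
  have u0 : 0 < modc (u - b) by rewrite modc_gt0 subr_eq0.
  have := hc u; rewrite /pball u0 us => /(_ isT).
  have -> : f u - a - c * (u - b) = (k u - c) * (u - b).
    by rewrite mulrBl /k divfK// subr_eq0.
  rewrite modcM => h; rewrite ler_pM2r// (le_trans h)//.
  by rewrite mulrC -ler_pdivlMr// ltW.
have z0 : 0 < modc (z - b) by rewrite modc_gt0 subr_eq0.
apply: (@hol_near _ f); last by apply: hf; apply/andP; split.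
apply/nearCP; exists (modc (z - b)) => // u uz; case: eqVneq => // ub.
by move: uz; rewrite ub modc_sym ltxx.
Qed.

(* If [f] stayed below [M] on arbitrarily small circles about [b], it would do so on the
   annuli between them, hence near [b], and the singularity would be removable. *)
Lemma circles_meet_large (b : C) (r M : R) f : 0 < r -> 0 < M ->
  (forall z, pball b r z -> hol f z) ->
  (forall s, 0 < s <= r -> ~ exists a : C, forall z, modc (z - b) < s ->
     hol (fun u => if u == b then a else f u) z) ->
  exists2 t0 : R, 0 < t0 & forall t, 0 < t < t0 -> exists2 z, modc (z - b) = t & M <= modc (f z).
Proof.
move=> r0 M0 hf nf; apply: contrapT => hn.
have small t0 : 0 < t0 -> exists2 t, 0 < t < t0 & forall z, modc (z - b) = t -> modc (f z) <= M.
  move=> t00; apply: contrapT => h; apply: hn; exists t0 => // t tt.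
  apply: contrapT => h2; apply: h; exists t => // z zt; rewrite leNgt; apply/negP => Mf.
  by apply: h2; exists z => //; exact: ltW.
have [t1 /andP[t10 t1r] ht1] := small r r0.
apply: (nf t1); first by rewrite t10 ltW.
apply: (@removable b t1 M) => //.
  by move=> z /andP[z0 zt]; apply: hf; apply/andP; split=> //; rlra.
move=> z /andP[z0 zt].
have [t2 /andP[t20 t2z] ht2] := small _ z0.
apply: (@max_modulus [set u | t2 <= modc (u - b) <= t1] f M) => //.
- exact: compact_annulus.
- by move=> u /andP[u1 u2]; apply/hol_cont/hf/andP; split; rlra.
- move=> u /andP[]; rewrite le_eqVlt => /predU1P[u1 _|u1]; first by left; apply: ht2.
  rewrite le_eqVlt => /predU1P[u2|u2]; first by left; apply: ht1.
  right; exists (Num.min (modc (u - b) - t2) (t1 - modc (u - b))).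
    by rewrite lt_min !subr_gt0 u1.
  move=> y; rewrite lt_min => /andP[y1 y2].
  have := ler_modc_dist y u b; have := ler_modc_dist u y b; rewrite (modc_sym u y) => h1 h2.
  split; first by apply/andP; split; rlra.
  by apply/hf/andP; split; rlra.
- by apply/andP; split; rlra.
Qed.

End Removable.

(** * Circle means and Fejer kernels *)

Section CircleMean.
Variable R : realType.
Local Notation C := (Cplx R).
Implicit Types (z : C) (v : C -> R) (s t x : R).

Definition eC (t : R) : C := mkC (cos t) (sin t).
Definition cpt (a : C) (r t : R) : C := a + toC r * eC t.
Definition tpi : R := 2 * pi.

Lemma tpi_gt0 : 0 < tpi. Proof. by rewrite mulr_gt0// pi_gt0. Qed.
Lemma tpi_neq0 : tpi != 0. Proof. exact: lt0r_neq0 tpi_gt0. Qed.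

Definition cmean (phi : R -> R) : R := tpi^-1 * segint phi 0 tpi.

Lemma modc_eC t : modc (eC t) = 1.
Proof.
have : modc (eC t) ^+ 2 = 1 ^+ 2 by rewrite modc_sqr expr1n cos2Dsin2.
by move/eqP; rewrite eqrXn2 ?modc_ge0// => /eqP.
Qed.

Lemma eCD s t : eC (s + t) = eC s * eC t.
Proof. by apply: Cext; rewrite ?reCM ?imCM /= ?cosD ?sinD//; ring. Qed.

Lemma eCB t s : eC (t - s) = eC t * conjc (eC s).
Proof. by rewrite eCD; congr (_ * _); apply: Cext; rewrite /= ?cosN ?sinN. Qed.

Lemma eCX t n : eC t ^+ n = mkC (cos (n%:R * t)) (sin (n%:R * t)).
Proof.
elim: n => [|n IH]; first by rewrite expr0 mul0r; apply: Cext; rewrite /= ?cos0 ?sin0.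
rewrite exprS IH -[mkC (cos (n%:R * t)) _]/(eC _) -eCD /eC.
by rewrite -[n.+1]add1n natrD mulrDl mul1r.
Qed.

Lemma modc_cpt (a : C) r t : 0 <= r -> modc (cpt a r t - a) = r.
Proof. by move=> r0; rewrite /cpt addrC addKr modcM modc_eC mulr1 modc_toC ger0_norm. Qed.

Lemma pathcont_of (F : R -> C) x : {for x, continuous (reC \o F)} ->
  {for x, continuous (imC \o F)} -> pathcont F x.
Proof.
move=> /contRP h1 /contRP h2 e e0; have e20 : 0 < e / 2 by rewrite divr_gt0.
have [d d0 hd] := h1 _ e20; have [d' d'0 hd'] := h2 _ e20.
exists (Num.min d d'); first by rewrite lt_min d0.
move=> y; rewrite lt_min => /andP[/hd k1 /hd' k2].
rewrite [F y - _]mkCE (le_lt_trans (modc_mk _ _))// reCB imCB [e]splitr.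
exact: ltrD.
Qed.

Lemma pathcont_comp2 (H : C -> C) (F : R -> C) x : {for F x, continuous H} ->
  pathcont F x -> pathcont (H \o F) x.
Proof.
move=> /contCP h hF e e0; have [d d0 hd] := h e e0; have [d' d'0 hd'] := hF d d0.
by exists d' => // y /hd' /hd.
Qed.

Lemma cont_path v (F : R -> C) x : {for F x, continuous v} -> pathcont F x ->
  {for x, continuous (v \o F)}.
Proof.
move=> /contP h hF; apply/contRP => e e0.
have [d d0 hd] := h e e0; have [d' d'0 hd'] := hF d d0.
by exists d' => // y /hd' /hd.
Qed.

Lemma pathcont_eC x : pathcont eC x.
Proof. by apply: pathcont_of; [exact: continuous_cos|exact: continuous_sin]. Qed.

Lemma pathcont_eCX n x : pathcont (fun t => eC t ^+ n) x.
Proof.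
apply: (@pathcont_comp2 (fun z => z ^+ n) eC); last exact: pathcont_eC.
by apply: hol_cont; apply: holX; exact: hol_id.
Qed.

Lemma pathcont_cpt (a : C) r x : pathcont (cpt a r) x.
Proof.
apply: (@pathcont_comp2 (fun z => a + toC r * z) eC); last exact: pathcont_eC.
exact: cont_affine.
Qed.

Lemma segint_cos n : segint (fun t => cos (n.+1%:R * t)) 0 tpi = 0.
Proof.
pose k : R := n.+1%:R; have k0 : k != 0 by rewrite pnatr_eq0.
pose F t := sin (k * t) / k.
have dF t : is_derive t 1 F (cos (k * t)).
  have h1 : is_derive t 1 (fun t => k * t) k.
    have h := @is_deriveM R R (fun=> k) id t 1 0 1 (is_derive_cst _ _ _) (is_derive_id _ _).
    by apply: is_derive_eq h _; rewrite /GRing.scale/= mulr1 mulr0 addr0.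
  have h2 := is_derive1_comp (is_derive_sin (k * t)) h1.
  have h3 := is_deriveZ k^-1 h2.
  apply: (is_derive_eq _ (_ : k^-1 *: (cos (k * t) * k) = cos (k * t))).
    suff -> : F = k^-1 \*: (sin \o (fun t => k * t)) by [].
    by apply: funext => y; rewrite /F /GRing.scale/= mulrC.
  by rewrite /GRing.scale/= mulrCA mulVf// mulr1.
have cF : continuous F.
  move=> t; apply: differentiable_continuous; apply/derivable1_diffP.
  by have [] := dF t.
rewrite /segint /Rintegral (@continuous_FTC2 R _ F)//=; first 1 last.
- exact: tpi_gt0.
- apply: continuous_subspaceT => t.
  apply: (continuous_comp (_ : {for t, continuous (fun t => k * t)})).
    by apply: cvgM; [exact: cvg_cst|exact: cvg_id].
  exact: continuous_cos.
- split.
  + by move=> t _; have [] := dF t.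
  + by apply: cvg_at_right_filter; exact: cF.
  + by apply: cvg_at_left_filter; exact: cF.
- by move=> t _; rewrite derive1E; have [_ ->] := dF t.
rewrite /F mulr0 sin0 mul0r subr0.
have -> : k * tpi = (n.+1).*2%:R * pi by rewrite /tpi -muln2 natrM; ring.
(* The end value is read off from the even power of [eC pi = -1]. *)
suff -> : sin ((n.+1).*2%:R * pi) = 0 :> R by rewrite mul0r.
have := eCX pi (n.+1).*2; rewrite /eC cospi sinpi -mul2n exprM.
have -> : mkC (-1) 0 ^+ 2 = 1 :> C by rewrite expr2; apply: Cext; rewrite ?reCM ?imCM /=; ring.
by rewrite expr1n => /(congr1 (@imC R)).
Qed.

Lemma segint_sin n : segint (fun t => sin (n.+1%:R * t)) 0 tpi = 0.
Proof.
pose k : R := n.+1%:R; have k0 : k != 0 by rewrite pnatr_eq0.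
pose F t := - (cos (k * t) / k).
have dF t : is_derive t 1 F (sin (k * t)).
  have h1 : is_derive t 1 (fun t => k * t) k.
    have h := @is_deriveM R R (fun=> k) id t 1 0 1 (is_derive_cst _ _ _) (is_derive_id _ _).
    by apply: is_derive_eq h _; rewrite /GRing.scale/= mulr1 mulr0 addr0.
  have h2 := is_derive1_comp (is_derive_cos (k * t)) h1.
  have h3 := is_deriveZ (- k^-1) h2.
  apply: (is_derive_eq _ (_ : - k^-1 *: (- sin (k * t) * k) = sin (k * t))).
    suff -> : F = (- k^-1) \*: (cos \o (fun t => k * t)) by [].
    by apply: funext => y; rewrite /F -mulrN mulrC.
  by rewrite /GRing.scale/= mulNr mulNr mulrN opprK mulrCA mulVf// mulr1.
have cF : continuous F.
  move=> t; apply: differentiable_continuous; apply/derivable1_diffP.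
  by have [] := dF t.
rewrite /segint /Rintegral (@continuous_FTC2 R _ F)//=; first 1 last.
- exact: tpi_gt0.
- apply: continuous_subspaceT => t.
  apply: (continuous_comp (_ : {for t, continuous (fun t => k * t)})).
    by apply: cvgM; [exact: cvg_cst|exact: cvg_id].
  exact: continuous_sin.
- split.
  + by move=> t _; have [] := dF t.
  + by apply: cvg_at_right_filter; exact: cF.
  + by apply: cvg_at_left_filter; exact: cF.
- by move=> t _; rewrite derive1E; have [_ ->] := dF t.
rewrite /F mulr0 cos0.
have -> : k * tpi = (n.+1).*2%:R * pi by rewrite /tpi -muln2 natrM; ring.
suff -> : cos ((n.+1).*2%:R * pi) = 1 :> R by rewrite subrr.
have := eCX pi (n.+1).*2; rewrite /eC cospi sinpi -mul2n exprM.
have -> : mkC (-1) 0 ^+ 2 = 1 :> C by rewrite expr2; apply: Cext; rewrite ?reCM ?imCM /=; ring.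
by rewrite expr1n => /(congr1 (@reC R)).
Qed.

Lemma Cint_eCX n : Cint (fun t => eC t ^+ n) 0 tpi = (n == 0)%:R * toC tpi.
Proof.
case: n => [|n].
  rewrite (@eq_Cint _ _ (fun=> 1)) => [|x _]; last by rewrite expr0.
  by rewrite Cint_cst ?(ltW tpi_gt0)// subr0 eqxx.
rewrite mul0r; apply: Cext; rewrite /Cint ?reC_mk ?imC_mk.
  by rewrite -[RHS](segint_cos n); apply: eq_Rint => t _ /=; rewrite eCX.
by rewrite -[RHS](segint_sin n); apply: eq_Rint => t _ /=; rewrite eCX.
Qed.

(** The extra power of [eC t] carries the induction: a factor ['X] of the polynomial is moved into
    it, and a positive power kills every term. *)
Lemma Cint_poly (q : {poly C}) r n :
  Cint (fun t => eC t ^+ n * q.[toC r * eC t]) 0 tpi = (n == 0)%:R * (q`_0 * toC tpi).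
Proof.
have pc (p : {poly C}) m : pctn (fun t => eC t ^+ m * p.[toC r * eC t]) 0 tpi.
  move=> x _; apply: (@pathcont_comp2 (fun z => z ^+ m * p.[toC r * z]) eC); last exact: pathcont_eC.
  apply: hol_cont; apply: holM; first by apply: holX; exact: hol_id.
  have := @hol_affine _ (fun z => p.[z]) 0 (toC r) (eC x) (hol_poly _ _).
  by under eq_fun do rewrite add0r mulrC.
elim/poly_ind: q n => [|q c IH] n.
  rewrite (@eq_Cint _ _ (fun=> 0)) => [|x _]; last by rewrite horner0 mulr0.
  by rewrite Cint_cst ?(ltW tpi_gt0)// coef0 !mul0r mulr0.
have c1 : pctn (fun t => c * eC t ^+ n) 0 tpi.
  move=> x _; apply: (@pathcont_comp2 (fun z => c * z ^+ n) eC); last exact: pathcont_eC.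
  by apply: hol_cont; apply: holM; [exact: hol_cst|apply: holX; exact: hol_id].
have c2 : pctn (fun t => toC r * (eC t ^+ n.+1 * q.[toC r * eC t])) 0 tpi.
  move=> x hx; apply: (@pathcont_comp2 (fun z => toC r * z) (fun t => eC t ^+ n.+1 * q.[toC r * eC t])); last exact: pc.
  by apply: hol_cont; apply: holM; [exact: hol_cst|exact: hol_id].
rewrite (@eq_Cint _ _ (fun t => c * eC t ^+ n + toC r * (eC t ^+ n.+1 * q.[toC r * eC t]))).
  rewrite CintD// (@CintZ _ c (fun t => eC t ^+ n)); last by move=> x _; exact: pathcont_eCX.
  rewrite (@CintZ _ (toC r) (fun t => eC t ^+ n.+1 * q.[toC r * eC t])); last exact: pc.
  rewrite IH /= mul0r mulr0 addr0 Cint_eCX.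
  by rewrite -cons_poly_def coef_cons /= mulrCA mulrA.
by move=> x _; rewrite hornerMXaddC exprSr; ring.
Qed.

Lemma cmean_poly (p : {poly C}) (a : C) r : cmean (fun t => reC p.[cpt a r t]) = reC p.[a].
Proof.
have := Cint_poly (p \Po ('X + a%:P)) r 0.
have -> : (p \Po ('X + a%:P))`_0 = p.[a] by rewrite -horner_coef0 horner_comp !hornerE.
rewrite eqxx mul1r => /(congr1 (@reC R)); rewrite /Cint reC_mk reCM reC_toC imC_toC mulr0 subr0.
move=> E; rewrite /cmean -[reC p.[a]](mulfK tpi_neq0) -E mulrC; congr (_ * _).
apply: eq_Rint => t _ /=; rewrite expr0 mul1r horner_comp !hornerE.
by rewrite /cpt addrC.
Qed.


Lemma ctn_of (phi : R -> R) a b : (forall x, {for x, continuous phi}) -> ctn phi a b.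
Proof. by move=> h x _; exact: h. Qed.

Lemma cmeanD (phi psi : R -> R) : ctn phi 0 tpi -> ctn psi 0 tpi ->
  cmean (fun t => phi t + psi t) = cmean phi + cmean psi.
Proof. by move=> h1 h2; rewrite /cmean RintD// mulrDr. Qed.

Lemma cmean_cst (c : R) : cmean (fun=> c) = c.
Proof. by rewrite /cmean Rint_cst ?(ltW tpi_gt0)// subr0 mulrC mulfK// tpi_neq0. Qed.

Lemma le_cmean (phi psi : R -> R) : ctn phi 0 tpi -> ctn psi 0 tpi ->
  (forall t, phi t <= psi t) -> cmean phi <= cmean psi.
Proof.
move=> h1 h2 h; rewrite /cmean ler_pM2l ?invr_gt0 ?tpi_gt0//.
by apply: le_Rint => // t _; exact: h.
Qed.

Lemma circle_meanE v (a : C) (r : R) : ctn (v \o cpt a r) 0 tpi ->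
  circle_mean (EFin \o v) a r = (cmean (v \o cpt a r))%:E.
Proof.
move=> h; rewrite /circle_mean /cmean EFinM; congr (_ * _)%E.
rewrite /segint /Rintegral fineK//.
by apply: integrable_fin_num => //; exact: ctn_integrable.
Qed.

Lemma cont_cpt v (a : C) (r : R) x : {for cpt a r x, continuous v} ->
  {for x, continuous (v \o cpt a r)}.
Proof. by move=> h; apply: cont_path => //; exact: pathcont_cpt. Qed.

Lemma cont_poly (p : {poly C}) z : {for z, continuous (fun z => reC p.[z])}.
Proof.
have /contCP h := hol_cont (hol_poly p z).
apply/contP => e e0; have [d d0 hd] := h e e0; exists d => // y /hd.
by apply: le_lt_trans; rewrite -reCB ler_reC.
Qed.

(** Averaging a failed test over a small circle contradicts the sub-mean inequality: the polynomial
    averages to its value at the centre, and the term [e * r ^+ 2] is left over. *)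
Lemma submean_tst v (z0 : C) (d : R) : 0 < d ->
  (forall z, modc (z - z0) < d -> {for z, continuous v}) ->
  (forall r, 0 < r < d -> v z0 <= cmean (v \o cpt z0 r)) -> tst v z0.
Proof.
move=> d0 cv sv p e d' e0 d'0; apply: contrapT => hn.
have key z : modc (z - z0) < d' -> v z + e * modc (z - z0) ^+ 2 <= v z0 + reC (p.[z] - p.[z0]).
  by move=> zd; rewrite leNgt; apply/negP => h; apply: hn; exists z.
pose m := Num.min d d'; have m0 : 0 < m by rewrite lt_min d0.
pose r := m / 2; have r0 : 0 < r by rewrite divr_gt0.
have rm : m = 2 * r by rewrite /r; field.
have md : m <= d by rewrite ge_min lexx.
have md' : m <= d' by rewrite ge_min lexx orbT.
have rd : r < d by rlra.
have rd' : r < d' by rlra.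
have vc : ctn (v \o cpt z0 r) 0 tpi.
  by move=> x _; apply: cont_cpt; apply: cv; rewrite modc_cpt ?ltW.
have pc : ctn (fun t => reC p.[cpt z0 r t]) 0 tpi.
  by move=> x _; apply: (@cont_cpt (fun z => reC p.[z])); exact: cont_poly.
have cc c : ctn (fun=> c : R) 0 tpi by move=> x _; exact: cst_continuous.
have h1 := sv r (introT andP (conj r0 rd)).
have : cmean (v \o cpt z0 r) <= cmean (fun t => reC p.[cpt z0 r t] + (v z0 - reC p.[z0] - e * r ^+ 2)).
  apply: le_cmean => //.
    by move=> x hx; apply: cvgD; [exact: pc|exact: cst_continuous].
  move=> t; have := key (cpt z0 r t); rewrite modc_cpt ?(ltW r0)// => /(_ rd').
  by rewrite /= reCB; rlra.
rewrite cmeanD// cmean_cst cmean_poly => h2.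
have : 0 < e * r ^+ 2 by rewrite mulr_gt0// exprn_gt0.
rlra.
Qed.

Definition dirk (n : nat) (x : R) : R := 1 + 2 * \sum_(1 <= m < n.+1) reC (eC x ^+ m).
(** The sum of the first [n] Dirichlet kernels, that is [n] times the usual Fejer kernel; its
    integral over a period is [n * tpi]. *)
Fixpoint fejer (n : nat) (x : R) : R := if n is m.+1 then fejer m x + dirk m x else 0.

Lemma eC_rec x n : reC (eC x ^+ n.+2) + reC (eC x ^+ n) = 2 * cos x * reC (eC x ^+ n.+1).
Proof.
have E2 : eC x ^+ 2 = toC (2 * cos x) * eC x - 1.
  apply: Cext; rewrite expr2 ?reCB ?imCB ?reCM ?imCM ?reC_toC ?imC_toC ?reC_mk ?imC_mk /=.
    have := cos2Dsin2 x; rewrite !expr2 => h.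
    have -> : sin x * sin x = 1 - cos x * cos x by rlra.
    by ring.
  by ring.
have -> : eC x ^+ n.+2 = toC (2 * cos x) * eC x ^+ n.+1 - eC x ^+ n.
  by rewrite -addn2 exprD E2 exprSr; ring.
by rewrite reCB reCM reC_toC imC_toC; ring.
Qed.

Lemma dirkE n x : (2 - 2 * cos x) * dirk n x = 2 * reC (eC x ^+ n) - 2 * reC (eC x ^+ n.+1).
Proof.
elim: n => [|n IH].
  by rewrite /dirk big_geq// expr0 expr1 /=; ring.
have -> : dirk n.+1 x = dirk n x + 2 * reC (eC x ^+ n.+1).
  by rewrite /dirk [in LHS]big_nat_recr//= mulrDr addrA.
rewrite mulrDr IH; have := eC_rec x n; rlra.
Qed.

(** The closed form as a quotient of squared sines, with the denominator cleared; positivity and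
    concentration both follow from it. *)
Lemma fejerE n x : (2 - 2 * cos x) * fejer n x = 2 - 2 * reC (eC x ^+ n).
Proof.
elim: n => [|n IH]; first by rewrite [fejer _ _]/= expr0 mulr0 /=; ring.
by rewrite [fejer _ _]/= mulrDr IH dirkE; ring.
Qed.

Lemma reC_eCX_le1 x n : reC (eC x ^+ n) <= 1.
Proof.
by rewrite (le_trans (ler_norm _))// (le_trans (ler_reC _))// modcX modc_eC expr1n.
Qed.

Lemma fejer_ge0 n x : 0 <= fejer n x.
Proof.
have : cos x <= 1 by exact: cos_le1.
rewrite le_eqVlt => /predU1P[c1|c1].
  have E1 : eC x = 1.
    have := cos2Dsin2 x; rewrite c1 => h; apply: Cext => //=.
    by apply/eqP; rewrite -sqrf_eq0; apply/eqP; rlra.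
  have d0 k : 0 <= dirk k x.
    rewrite /dirk addr_ge0// mulr_ge0// sumr_ge0// => i _.
    by rewrite E1 expr1n.
  by elim: n => //= n IH; rewrite addr_ge0.
have h := fejerE n x; have h1 := reC_eCX_le1 x n.
have : 0 <= (2 - 2 * cos x) * fejer n x by rlra.
by rewrite pmulr_rge0//; rlra.
Qed.

(** The squared chord is exactly the factor [2 - 2 * cos (t - s)] of [fejerE]. The bound does not
    depend on [n] while the mass is [n * tpi], so the normalized kernel concentrates at rate
    [1 / n]. *)
Lemma fejer_dist n s t : modc (eC s - eC t) ^+ 2 * fejer n (t - s) <= 4.
Proof.
have -> : modc (eC s - eC t) ^+ 2 = 2 - 2 * cos (t - s).
  rewrite modc_sqr reCB imCB /= cosB.
  have := cos2Dsin2 t; have := cos2Dsin2 s; rewrite !expr2; rlra.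
rewrite fejerE.
have : - 1 <= reC (eC (t - s) ^+ n).
  have := ler_reC (eC (t - s) ^+ n); rewrite modcX modc_eC expr1n ler_norml.
  by case/andP.
rlra.
Qed.

End CircleMean.

(** * The sub-mean value inequality *)

Section Submean.
Variable R : realType.
Local Notation C := (Cplx R).
Local Notation tpi := (tpi R).
Implicit Types (z : C) (v : C -> R) (s t x : R).

(** The Lebesgue number argument, for a property that persists when [d] decreases and holds near
    each point with one common [d]. *)
Lemma compact_unif (K : set C) (Q : C -> R -> Prop) : compact K ->
  (forall y d d', d' <= d -> Q y d -> Q y d') ->
  (forall x : C, K x -> exists2 d : R, 0 < d & forall y, modc (y - x) < d -> Q y d) ->
  exists2 d : R, 0 < d & forall y, K y -> Q y d.
Proof.
move=> /compact_near_coveringP cK Qm hQ.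
have h : \forall i \near (0 : R)^'+, K `<=` (fun y => Q y i).
  apply: (cK R (0 : R)^'+ (fun i y => Q y i)) => x Kx.
  have [d d0 hd] := hQ x Kx.
  exists ([set y | modc (y - x) < d], [set i | i < d]).
    split => /=; first by apply/nearCP; exists d.
    exact: nbhs_right_lt.
  by move=> [y i] [/= yd id]; apply: Qm (hd y yd); exact: ltW.
have [d /= d0 hd] := h; exists (d / 2); first by rewrite divr_gt0.
move=> y; apply: hd; last by rewrite divr_gt0.
by rewrite /= sub0r normrN gtr0_norm ?divr_gt0// ltr_pdivrMr// ltr_pMr// ltr1n.
Qed.

Lemma unif_cont (K : set C) v (e : R) : compact K -> (forall z, K z -> {for z, continuous v}) ->
  0 < e -> exists2 d : R, 0 < d & forall z w, K z -> modc (w - z) < d -> `|v w - v z| < e.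
Proof.
move=> cK hv e0.
have [|x Kx|d d0 hd] := @compact_unif K (fun y d => forall w, modc (w - y) < d -> `|v w - v y| < e) cK.
- by move=> y d d' dd h w wd; apply: h; exact: lt_le_trans wd dd.
- have /contP h := hv x Kx; have [d d0 hd] := h (e / 2) (divr_gt0 e0 (ltr0n _ 2)).
  exists (d / 2); first by rewrite divr_gt0.
  move=> y yd w wd.
  have h1 : modc (w - x) < d by apply: le_lt_trans (ler_modc_dist _ y _) _; rlra.
  have h2 : modc (y - x) < d by rlra.
  have := hd w h1; have := hd y h2; rewrite !ltr_norml => /andP[a1 a2] /andP[b1 b2].
  by apply/andP; split; rlra.
- by exists d => // z w Kz; exact: hd.
Qed.

Lemma pathcont_conj (F : R -> C) x : pathcont F x -> pathcont (fun s => conjc (F s)) x.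
Proof.
move=> h e e0; have [d d0 hd] := h e e0; exists d => // y /hd; apply: le_lt_trans.
rewrite le_eqVlt; apply/orP; left; apply/eqP.
by rewrite -(rmorphB (@conjc R)) /modc; case: (F y - F x) => a b /=; rewrite sqrrN.
Qed.

Lemma pathcont_mul (F G : R -> C) x : pathcont F x -> pathcont G x ->
  pathcont (fun s => F s * G s) x.
Proof.
move=> hF hG; apply: pathcont_of.
- have -> : reC \o (fun s => F s * G s) = (fun s => (reC \o F) s * (reC \o G) s - (imC \o F) s * (imC \o G) s).
    by apply: funext => s /=; rewrite reCM.
  by apply: cvgB; apply: cvgM; try exact: pathcont_re; exact: pathcont_im.
- have -> : imC \o (fun s => F s * G s) = (fun s => (reC \o F) s * (imC \o G) s + (imC \o F) s * (reC \o G) s).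
    by apply: funext => s /=; rewrite imCM.
  by apply: cvgD; apply: cvgM; try exact: pathcont_re; exact: pathcont_im.
Qed.

Lemma pathcont_toC (phi : R -> R) x : {for x, continuous phi} -> pathcont (fun s => toC (phi s)) x.
Proof.
move=> h; apply: pathcont_of.
  by have -> : reC \o (fun s => toC (phi s)) = phi by apply: funext.
have -> : imC \o (fun s => toC (phi s)) = (fun=> 0) by apply: funext.
exact: cst_continuous.
Qed.

Lemma cont_reEB n t x : {for x, continuous (fun s => reC (eC (t - s) ^+ n))}.
Proof.
have -> : (fun s => reC (eC (t - s) ^+ n)) = reC \o (fun s => (fun z => (eC t * z) ^+ n) (conjc (eC s))).
  by apply: funext => s /=; rewrite eCB.
apply: pathcont_re.
apply: (@pathcont_comp2 _ (fun z => (eC t * z) ^+ n) (fun s => conjc (eC s))).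
  apply: hol_cont; apply: holX; apply: holM; [exact: hol_cst|exact: hol_id].
exact/pathcont_conj/pathcont_eC.
Qed.

Lemma cont_mulR (f g : R -> R) x : {for x, continuous f} -> {for x, continuous g} ->
  {for x, continuous (fun s => f s * g s)}.
Proof. by move=> hf hg; exact: (cvgM hf hg). Qed.

Lemma dirkS n x : dirk n.+1 x = dirk n x + 2 * reC (eC x ^+ n.+1).
Proof. by rewrite /dirk [in LHS]big_nat_recr//= mulrDr addrA. Qed.

Lemma dirk0 x : dirk 0 x = 1.
Proof. by rewrite /dirk big_geq// mulr0 addr0. Qed.

Lemma cont_dirk n t x : {for x, continuous (fun s => dirk n (t - s))}.
Proof.
elim: n => [|n IH].
  have -> : (fun s => dirk 0 (t - s)) = fun=> 1 by apply: funext => s; rewrite dirk0.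
  exact: cst_continuous.
have -> : (fun s => dirk n.+1 (t - s)) = fun s => dirk n (t - s) + 2 * reC (eC (t - s) ^+ n.+1).
  by apply: funext => s; rewrite dirkS.
by apply: cvgD => //; apply: cvgM; [exact: cst_continuous|exact: cont_reEB].
Qed.

Lemma cont_fejer n t x : {for x, continuous (fun s => fejer n (t - s))}.
Proof.
elim: n => [|n IH] /=; first exact: cst_continuous.
by apply: cvgD => //; exact: cont_dirk.
Qed.

(** * Convolution with the kernels gives harmonic polynomials *)

Section Convolution.
Variable phi : R -> R.
Hypothesis cphi : forall x, {for x, continuous phi}.

(** Fourier coefficients of nonnegative index; as [phi] is real and the kernels are even, these
    determine the convolutions through real parts. *)
Definition fcoef (m : nat) : C :=
  toC tpi^-1 * Cint (fun s => toC (phi s) * conjc (eC s) ^+ m) 0 tpi.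

Lemma conv_cos m t :
  segint (fun s => phi s * reC (eC (t - s) ^+ m)) 0 tpi = tpi * reC (fcoef m * eC t ^+ m).
Proof.
have hc : pctn (fun s => toC (phi s) * conjc (eC s) ^+ m) 0 tpi.
  move=> x _; apply: pathcont_mul; first exact: pathcont_toC.
  apply: (@pathcont_comp2 _ (fun z => z ^+ m) (fun s => conjc (eC s))).
    by apply: hol_cont; apply: holX; exact: hol_id.
  exact/pathcont_conj/pathcont_eC.
transitivity (reC (Cint (fun s => eC t ^+ m * (toC (phi s) * conjc (eC s) ^+ m)) 0 tpi)).
  rewrite /Cint reC_mk; apply: eq_Rint => s _ /=.
  by rewrite eCB exprMn mulrCA [reC (toC _ * _)]reCM reC_toC imC_toC mul0r subr0.
rewrite CintZ// /fcoef -mulrA [reC (toC _ * _)]reCM reC_toC imC_toC mul0r subr0.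
by rewrite mulrA divff ?tpi_neq0// mul1r mulrC.
Qed.

Lemma fcoef0 : fcoef 0 = toC (cmean phi).
Proof.
rewrite /fcoef (@eq_Cint _ _ (fun s => toC (phi s))) => [|s _]; last by rewrite expr0 mulr1.
apply: Cext; rewrite ?reCM ?imCM !reC_toC !imC_toC mul0r ?subr0 ?addr0 /Cint ?reC_mk ?imC_mk//.
by rewrite (@eq_Rint _ _ (fun=> 0))// Rint_cst ?(ltW (tpi_gt0 R))// mul0r mulr0.
Qed.

Lemma conv_dirk n : exists2 p : {poly C}, p.[0] = fcoef 0 & forall t,
  segint (fun s => phi s * dirk n (t - s)) 0 tpi = tpi * reC p.[eC t].
Proof.
elim: n => [|n [p p0 hp]].
  exists (fcoef 0)%:P; first by rewrite hornerC.
  move=> t; rewrite hornerC -[fcoef 0]mulr1 -[X in fcoef 0 * X](expr0 (eC t)) -conv_cos.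
  by apply: eq_Rint => s _; rewrite dirk0 expr0.
exists (p + 2%:P * ((fcoef n.+1)%:P * 'X^(n.+1))).
  by rewrite hornerD p0 !hornerM hornerXn expr0n/= !mulr0 addr0.
move=> t; rewrite (@eq_Rint _ _ (fun s => phi s * dirk n (t - s) + 2 * (phi s * reC (eC (t - s) ^+ n.+1)))); last first.
  by move=> s _; rewrite dirkS; ring.
have c1 : ctn (fun s => phi s * reC (eC (t - s) ^+ n.+1)) 0 tpi.
  by move=> x _; exact: cont_mulR (@cphi x) (@cont_reEB n.+1 t x).
rewrite RintD; last 2 first.
- by move=> x _; exact: cont_mulR (@cphi x) (@cont_dirk n t x).
- by move=> x hx; apply: cvgM; [exact: cst_continuous|exact: c1].
rewrite RintZ// hp conv_cos hornerD !hornerM !hornerC hornerXn reCD.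
by rewrite -(toC_nat R 2) [reC (toC _ * _)]reCM reC_toC imC_toC; ring.
Qed.

(** The convolution is the restriction to the unit circle of the real part of a polynomial, hence
    extends harmonically to the disc; the value of the extension at 0 is [n] times the mean of
    [phi]. *)
Lemma conv_fejer n : exists2 p : {poly C}, p.[0] = n%:R * fcoef 0 & forall t,
  segint (fun s => phi s * fejer n (t - s)) 0 tpi = tpi * reC p.[eC t].
Proof.
elim: n => [|n [p p0 hp]].
  exists 0; first by rewrite horner0 mul0r.
  move=> t; rewrite horner0 /= mulr0 (@eq_Rint _ _ (fun=> 0)); last by move=> s _; rewrite mulr0.
  by rewrite Rint_cst ?(ltW (tpi_gt0 R))// mul0r.
have [q q0 hq] := conv_dirk n; exists (p + q).
  by rewrite hornerD p0 q0 -natr1 mulrDl mul1r.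
move=> t; rewrite hornerD reCD mulrDr -hp -hq -RintD.
- by apply: eq_Rint => s _ /=; rewrite mulrDr.
- by move=> x _; exact: cont_mulR (@cphi x) (@cont_fejer n t x).
- by move=> x _; exact: cont_mulR (@cphi x) (@cont_dirk n t x).
Qed.

End Convolution.

Lemma segint_cosB n t : segint (fun s => reC (eC (t - s) ^+ n.+1)) 0 tpi = 0.
Proof.
have hc : pctn (fun s => conjc (eC s) ^+ n.+1) 0 tpi.
  move=> x _; apply: (@pathcont_comp2 _ (fun z => z ^+ n.+1) (fun s => conjc (eC s))).
    by apply: hol_cont; apply: holX; exact: hol_id.
  exact/pathcont_conj/pathcont_eC.
have E0 : Cint (fun s => conjc (eC s) ^+ n.+1) 0 tpi = 0.
  have E s : conjc (eC s) ^+ n.+1 = mkC (cos (n.+1%:R * s)) (- sin (n.+1%:R * s)) :> C.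
    by rewrite -(rmorphXn (@conjc R)) [_ ^+ _](eCX s n.+1).
  apply: Cext; rewrite /Cint ?reC_mk ?imC_mk.
    by rewrite -[RHS](segint_cos _ n); apply: eq_Rint => s _ /=; rewrite E.
  have sc : ctn (fun t => sin (n.+1%:R * t)) 0 tpi.
    move=> x _; apply: (continuous_comp (_ : {for x, continuous (fun t => n.+1%:R * t)})).
      by apply: cvgM; [exact: cst_continuous|exact: cvg_id].
    exact: continuous_sin.
  rewrite [RHS](_ : _ = -1 * segint (fun t => sin (n.+1%:R * t)) 0 tpi); last first.
    by rewrite segint_sin mulr0.
  by rewrite -RintZ//; apply: eq_Rint => s _ /=; rewrite E mulN1r.
transitivity (reC (Cint (fun s => eC t ^+ n.+1 * conjc (eC s) ^+ n.+1) 0 tpi)).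
  by rewrite /Cint reC_mk; apply: eq_Rint => s _ /=; rewrite eCB exprMn.
by rewrite CintZ// E0 mulr0.
Qed.

Lemma segint_fejer n t : segint (fun s => fejer n (t - s)) 0 tpi = n%:R * tpi.
Proof.
have D m : segint (fun s => dirk m (t - s)) 0 tpi = tpi.
  elim: m => [|m IH].
    rewrite (@eq_Rint _ _ (fun=> 1)) => [|s _]; last exact: dirk0.
    by rewrite Rint_cst ?(ltW (tpi_gt0 R))// mul1r subr0.
  rewrite (@eq_Rint _ _ (fun s => dirk m (t - s) + 2 * reC (eC (t - s) ^+ m.+1))) => [|s _]; last exact: dirkS.
  have c1 : ctn (fun s => reC (eC (t - s) ^+ m.+1)) 0 tpi by move=> x _; exact: cont_reEB.
  rewrite RintD; last 2 first.
  - by move=> x _; exact: cont_dirk.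
  - by move=> x hx; apply: cvgM; [exact: cst_continuous|exact: c1].
  by rewrite IH RintZ// segint_cosB mulr0 addr0.
elim: n => [|n IH] /=; first by rewrite Rint_cst ?(ltW (tpi_gt0 R))// !mul0r.
rewrite RintD; last 2 first.
- by move=> x _; exact: cont_fejer.
- by move=> x _; exact: cont_dirk.
by rewrite IH D -natr1 mulrDl mul1r.
Qed.

Lemma tst_subpoly v z0 (q : {poly C}) : tst v z0 -> tst (fun z => v z - reC q.[z]) z0.
Proof.
move=> h p e d e0 d0; have [z zd hz] := h (p + q) e d e0 d0; exists z => //.
by move: hz; rewrite !hornerD !(reCB, reCD); rlra.
Qed.

(** On the circle [v] is bounded above by a harmonic polynomial [Re Q] whose value at the centre is
    the mean of [v] plus [2 * eta]; the maximum principle for [v - Re Q] carries the bound to the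
    centre. *)
Lemma submean v (a : C) (r : R) : 0 < r ->
  (forall z, modc (z - a) <= r -> {for z, continuous v}) ->
  (forall z, modc (z - a) < r -> tst v z) -> v a <= cmean (v \o cpt a r).
Proof.
move=> r0 cv tv.
pose K := [set z | r <= modc (z - a) <= r].
have cK : compact K by exact: compact_annulus.
have Kc t : K (cpt a r t) by rewrite /K /= modc_cpt ?lexx// ltW.
have Kv z : K z -> {for z, continuous v} by move=> /andP[_ h]; exact: cv.
pose phi := v \o cpt a r.
have cphi x : {for x, continuous phi} by apply: cont_cpt; exact/Kv/Kc.
have phiE x : phi x = v (cpt a r x) by [].
have [M M0 hM] : exists2 M, 0 < M & forall z, K z -> `|v z| <= M.
  apply: (@cont_bounded R K (fun z => `|v z|)) => // z /Kv h.
  exact: (continuous_comp h (@norm_continuous _ _ _)).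
apply/ler_addgt0Pr => e e0.
pose eta := e / 2; have eta0 : 0 < eta by rewrite divr_gt0.
have e2 : e = 2 * eta by rewrite /eta; field.
have [rho rho0 hrho] := unif_cont cK Kv eta0.
(* At distance at least [rho] on the circle the quadratic term with coefficient [B] exceeds the
   possible oscillation [2 * M]; at smaller distance uniform continuity suffices. *)
pose B := 2 * M * r ^+ 2 / rho ^+ 2.
have B0 : 0 < B by rewrite divr_gt0 ?exprn_gt0// !mulr_gt0// exprn_gt0.
have key s t : phi t - eta - B * modc (eC s - eC t) ^+ 2 <= phi s.
  have dE : modc (cpt a r s - cpt a r t) = r * modc (eC s - eC t).
    have -> : cpt a r s - cpt a r t = toC r * (eC s - eC t) by rewrite /cpt; ring.
    by rewrite modcM modc_toC gtr0_norm.
  have B1 : 0 <= B * modc (eC s - eC t) ^+ 2 by rewrite mulr_ge0 ?sqr_ge0// ltW.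
  have [h|h] := ltP (modc (cpt a r s - cpt a r t)) rho.
    have := hrho _ _ (Kc t) h; rewrite -/(phi s) -/(phi t) ltr_norml => /andP[+ _].
    rewrite !phiE; rlra.
  have h2 : 2 * M <= B * modc (eC s - eC t) ^+ 2.
    rewrite /B mulrAC ler_pdivlMr ?exprn_gt0// -!mulrA ler_pM2l// ler_pM2l//.
    rewrite mulrA -[r * r]/(r ^+ 2) -exprMn -dE lerXn2r// ?nnegrE ?modc_ge0//; exact: ltW.
  have := hM _ (Kc s); have := hM _ (Kc t); rewrite !ler_norml => /andP[a1 a2] /andP[b1 b2].
  by rewrite !phiE; rlra.
have [N hN] : exists N : nat, 4 * B / eta < N%:R.
  have := archi_boundP (divr_ge0 (mulr_ge0 (ler0n R 4) (ltW B0)) (ltW eta0)).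
  by exists (Num.bound (4 * B / eta)).
have N0 : 0 < N%:R :> R.
  by apply: lt_trans hN; rewrite divr_gt0// mulr_gt0.
have [p p0 hp] := conv_fejer cphi N.
(* The quadratic minorant [key] is integrated against the kernel: by [fejer_dist] the quadratic term
   costs at most [4 * B / N] after normalization, less than [eta]. *)
have lower t : phi t - 2 * eta <= N%:R^-1 * reC p.[eC t].
  have cf : ctn (fun s => fejer N (t - s)) 0 tpi by move=> x _; exact: cont_fejer.
  have cz : ctn (fun s => (phi t - eta) * fejer N (t - s)) 0 tpi.
    by move=> x hx; apply: cvgM; [exact: cst_continuous|exact: cf].
  have h1 : (phi t - eta) * (N%:R * tpi) + (- (4 * B)) * tpi <= tpi * reC p.[eC t].
    rewrite -hp -(segint_fejer N t) -RintZ// -[X in _ + _ * X]subr0 -Rint_cst ?(ltW (tpi_gt0 R))//.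
    rewrite -RintD//; last by move=> x _; exact: cst_continuous.
    apply: le_Rint.
    + by move=> x hx; apply: cvgD; [exact: cz|exact: cst_continuous].
    + by move=> x _; exact: cont_mulR (cphi x) (@cont_fejer N t x).
    move=> s _; have F0 := fejer_ge0 N (t - s); have F4 := fejer_dist N s t.
    have := ler_wpM2r F0 (key s t).
    have : B * (modc (eC s - eC t) ^+ 2 * fejer N (t - s)) <= B * 4 by rewrite ler_pM2l.
    rewrite !mulrBl mulrA; rlra.
  have tp := tpi_gt0 R.
  have h2 : ((phi t - eta) * N%:R - 4 * B) <= reC p.[eC t].
    rewrite -(ler_pM2l tp); apply: le_trans h1; rewrite le_eqVlt; apply/orP; left; apply/eqP; ring.
  rewrite ler_pdivlMl//.
  move: hN; rewrite ltr_pdivrMr// => hN.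
  have -> : N%:R * (phi t - 2 * eta) = (phi t - eta) * N%:R - N%:R * eta by ring.
  rlra.
(* The Fejer polynomial of the unit circle is moved to the circle about [a] and raised by [2 * eta],
   so as to dominate [v] there. *)
pose Q : {poly C} := (toC N%:R^-1)%:P * (p \Po ((toC r^-1)%:P * ('X - a%:P))) + (toC (2 * eta))%:P.
have QE z : reC Q.[z] = N%:R^-1 * reC p.[toC r^-1 * (z - a)] + 2 * eta.
  rewrite /Q hornerD !hornerC hornerM hornerC horner_comp !hornerE reCD reC_toC.
  by rewrite [reC (toC _ * _)]reCM reC_toC imC_toC mul0r subr0.
have Qa : reC Q.[a] = cmean phi + 2 * eta.
  rewrite QE subrr mulr0 p0 fcoef0 -(toC_nat R N) -toCM reC_toC mulrA mulVf ?mul1r//.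
  exact: lt0r_neq0.
have h := @max_principle R [set z | 0 <= modc (z - a) <= r] (fun z => v z - reC Q.[z]) 0
  (@compact_annulus R a 0 r).
have : v a - reC Q.[a] <= 0.
  apply: h.
  - by move=> z /andP[_ zr]; exact: (cvgB (cv z zr) (@cont_poly R Q z)).
  - move=> z /andP[_]; rewrite le_eqVlt => /predU1P[zE|zr]; [left|right].
      have [t zt] : exists t, z = cpt a r t.
        pose w := toC r^-1 * (z - a).
        have w1 : modc w = 1 by rewrite modcM modc_toC zE gtr0_norm ?invr_gt0// mulVf// gt_eqF.
        have := modc_sqr w; rewrite w1 expr1n => /esym w2.
        have c1 : -1 <= reC w <= 1.
          by rewrite -ler_norml; apply: le_trans (ler_reC _) _; rewrite w1.
        have zw : z = a + toC r * w.
          rewrite /w mulrA -toCM divff ?gt_eqF//.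
          by rewrite mul1r addrC subrK.
        have sE : sin (acos (reC w)) = Num.sqrt (imC w ^+ 2).
          rewrite sin_acos// ; congr Num.sqrt; rlra.
        have [i0|i0] := leP 0 (imC w).
          exists (acos (reC w)); rewrite {1}zw /cpt; congr (_ + _ * _); apply: Cext => /=.
            by rewrite acosK.
          by rewrite sE sqrtr_sqr ger0_norm.
        exists (- acos (reC w)); rewrite {1}zw /cpt; congr (_ + _ * _); apply: Cext => /=.
          by rewrite cosN acosK.
        by rewrite sinN sE sqrtr_sqr ltr0_norm// opprK.
      rewrite zt QE /cpt addrAC subrr add0r mulrA -toCM mulVf ?gt_eqF// mul1r.
      by have := lower t; rewrite /phi /= /cpt; rlra.
    split; first exact/tst_subpoly/tv.
    exists (r - modc (z - a)); first by rewrite subr_gt0.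
    move=> y yz /=; rewrite modc_ge0/=; apply: le_trans (ler_modc_dist _ z _) _; rlra.
  - by rewrite /= subrr modc0 lexx ltW.
rewrite Qa; rlra.
Qed.

(** Two failures of the test cannot be compared, being seen at different points, so the sum goes
    through circle means: both sub-mean inequalities add up, and [submean_tst] returns to the
    test. *)
Lemma csh_add u v z0 : csh u z0 -> csh v z0 -> csh (fun z => u z + v z) z0.
Proof.
move=> [d d0 h] [d' d'0 h']; exists (Num.min d d'); first by rewrite lt_min d0.
move=> z zm; have s0 : 0 < Num.min d d' - modc (z - z0) by rewrite subr_gt0.
have hh y : modc (y - z) < Num.min d d' - modc (z - z0) ->
    [/\ {for y, continuous u}, {for y, continuous v}, tst u y & tst v y].
  rewrite ltrBrDr => yz.
  have := le_lt_trans (ler_modc_dist _ z _) yz.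
  by rewrite lt_min => /andP[/h[? ?] /h'[? ?]]; split.
have [|cu cv tu tv] := hh z; first by rewrite subrr modc0.
split; first exact: cont_add.
apply: (submean_tst s0) => [y /hh[? ? _ _]|r /andP[r0 rs]]; first exact: cont_add.
have hr y : modc (y - z) <= r ->
    [/\ {for y, continuous u}, {for y, continuous v}, tst u y & tst v y].
  by move=> yr; apply: hh; apply: le_lt_trans yr rs.
have -> : (fun y => u y + v y) \o cpt z r = fun t => (u \o cpt z r) t + (v \o cpt z r) t by [].
rewrite cmeanD; last 2 first.
- by move=> x _; apply: cont_cpt; have [] := hr (cpt z r x); rewrite ?modc_cpt// ltW.
- by move=> x _; apply: cont_cpt; have [] := hr (cpt z r x); rewrite ?modc_cpt// ltW.
apply: lerD; apply: submean => // y yr.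
- by have [] := hr y yr.
- by have [] := hr y (ltW yr).
- by have [] := hr y yr.
- by have [] := hr y (ltW yr).
Qed.

Lemma csh_sum (I : Type) (l : seq I) (u : I -> C -> R) z0 :
  (forall i, csh (u i) z0) -> csh (fun z => \sum_(i <- l) u i z) z0.
Proof.
move=> h; elim: l => [|i l IH].
  by under eq_fun do rewrite big_nil; exact: csh_cst.
by under eq_fun do rewrite big_cons; exact: csh_add.
Qed.

End Submean.

(** * Energy of finite point sets and Blaschke factors *)

Section UscMean.
Variable R : realType.
Local Notation C := (Cplx R).
Local Notation tpi := (tpi R).

Definition uscR (H : R -> \bar R) := forall (t c : R), (H t < c%:E)%E ->
  exists2 d : R, 0 < d & forall s, `|s - t| < d -> (H s < c%:E)%E.

Lemma uscR_measurable (H : R -> \bar R) (D : set R) : uscR H -> measurable D ->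
  measurable_fun D H.
Proof.
move=> hH mD; apply: (measurable_funS measurableT) => //.
have -> : H = (fun t => - (- H t))%E by apply: funext => t; rewrite oppeK.
apply: measurableT_comp => //; apply: lower_semicontinuous_measurable => t c.
rewrite lteNr -EFinN => /hH[d d0 hd]; exists [set s | `|s - t| < d].
  by exists d => //= s; rewrite /ball_/= distrC.
by move=> s /hd; rewrite lteNr EFinN.
Qed.

Lemma cont_measurable (psi : R -> R) (D : set R) : (forall x, {for x, continuous psi}) ->
  measurable D -> measurable_fun D (EFin \o psi).
Proof.
move=> h mD; apply: uscR_measurable => // t c /=; rewrite lte_fin => tc.
have /contRP ht := h t; have [|d d0 hd] := ht (c - psi t); first by rewrite subr_gt0.
exists d => // s /hd; rewrite lte_fin ltr_norml => /andP[_]; rlra.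
Qed.

(** [H] may take the value [-oo] and need not be integrable: the inequality is obtained separately
    for the positive and the negative parts. *)
Lemma le_usc_integral (H : R -> \bar R) (psi : R -> R) (a b : R) : uscR H ->
  (forall x, {for x, continuous psi}) -> (forall t, (H t <= (psi t)%:E)%E) ->
  (\int[@lebesgue_measure R]_(t in `[a, b]) H t <=
   \int[@lebesgue_measure R]_(t in `[a, b]) (psi t)%:E)%E.
Proof.
move=> hH hpsi hle.
have mH : measurable_fun (`[a, b]%classic : set R) H by exact: uscR_measurable.
have mp : measurable_fun (`[a, b]%classic : set R) (EFin \o psi) by exact: cont_measurable.
rewrite integralE [leRHS]integralE; apply: leeB.
- apply: ge0_le_integral => //; try exact: measurable_funepos.
  by move=> t _; apply: (@funepos_le _ _ setT H (EFin \o psi)) => [x _|]; [exact: hle|exact: in_setT].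
- apply: ge0_le_integral => //; try exact: measurable_funeneg.
  by move=> t _; apply: (@funeneg_le _ _ setT H (EFin \o psi)) => [x _|]; [exact: hle|exact: in_setT].
Qed.

Lemma usc_cpt (U : set C) (u : C -> \bar R) (a : C) (r : R) : usc_on U u ->
  (forall t, U (cpt a r t)) -> uscR (fun t => u (cpt a r t)).
Proof.
move=> hu hU t c tc; have /nearCP[d d0 hd] := hu _ (hU t) c tc.
have [d' d'0 hd'] := @pathcont_cpt R a r t d d0.
by exists d' => // s /hd' /hd.
Qed.

Lemma le_circle_mean (U : set C) (u : C -> \bar R) (a : C) (r : R) (psi : C -> R) : usc_on U u ->
  (forall t, U (cpt a r t)) -> (forall t, {for cpt a r t, continuous psi}) ->
  (forall t, (u (cpt a r t) <= (psi (cpt a r t))%:E)%E) ->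
  (circle_mean u a r <= (cmean (psi \o cpt a r))%:E)%E.
Proof.
move=> hu hU hpsi hle; rewrite -circle_meanE; last by move=> x _; exact: cont_cpt.
rewrite /circle_mean lee_pmul2l//; last by rewrite lte_fin invr_gt0 (tpi_gt0 R).
apply: (@le_usc_integral (fun t => u (cpt a r t)) (fun t => psi (cpt a r t))) => //.
  exact: usc_cpt hU.
by move=> x; exact: cont_cpt.
Qed.

End UscMean.

Section Energy.
Variable R : realType.
Local Notation C := (Cplx R).

(** The logarithmic kernel is truncated at distance [m], so that potentials of finite sets are
    continuous and have finite energy. *)
Definition lnk (m : R) (w : C) : R := ln (Num.max (modc w) m).

Definition lpot (m : R) (N : nat) (zeta : 'I_N -> C) (z : C) : R :=
  N%:R^-1 * \sum_i lnk m (z - zeta i).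

Lemma lnk_sym m (z w : C) : lnk m (z - w) = lnk m (w - z).
Proof. by rewrite /lnk modc_sym. Qed.

Lemma ln2_le1 : ln 2 <= 1 :> R.
Proof.
rewrite -[leRHS](@expRK R) ler_ln ?posrE ?expR_gt0//.
by apply: le_trans (expR_ge1Dx 1); rlra.
Qed.

Lemma lnk_half m (z w : C) : 0 < m -> modc w <= 2 * modc z -> lnk m w <= lnk m z + 1.
Proof.
move=> m0 wz.
have p (x : R) : 0 < Num.max x m by rewrite lt_max m0 orbT.
apply: le_trans (_ : ln (2 * Num.max (modc z) m) <= _).
  rewrite /lnk ler_ln ?posrE ?mulr_gt0// ge_max; apply/andP; split.
    by apply: le_trans wz _; rewrite ler_pM2l// le_max lexx.
  have : m <= Num.max (modc z) m by rewrite le_max lexx orbT.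
  have := p (modc z); rlra.
rewrite lnM ?posrE// addrC lerD2l; exact: ln2_le1.
Qed.

Lemma lnk_mono m (w : C) (x : R) : 0 < m -> m <= x -> modc w <= x -> lnk m w <= ln x.
Proof.
move=> m0 mx wx; rewrite /lnk ler_ln ?posrE ?lt_max ?m0 ?orbT ?(lt_le_trans m0)//.
by rewrite ge_max wx.
Qed.

Definition energy (m : R) N (zeta : 'I_N -> C) : R := \sum_i \sum_(j | j != i) lnk m (zeta i - zeta j).
Definition upd N (zeta : 'I_N -> C) (i : 'I_N) (z : C) (j : 'I_N) : C := if j == i then z else zeta j.

Lemma energy_split m N (zeta : 'I_N -> C) i : energy m zeta =
  2 * \sum_(j | j != i) lnk m (zeta i - zeta j) +
  \sum_(a | a != i) \sum_(b | (b != a) && (b != i)) lnk m (zeta a - zeta b).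
Proof.
rewrite /energy (bigD1 i)//=.
have -> : \sum_(a | a != i) \sum_(j | j != a) lnk m (zeta a - zeta j) =
    \sum_(a | a != i) (lnk m (zeta i - zeta a) +
      \sum_(b | (b != a) && (b != i)) lnk m (zeta a - zeta b)).
  by apply: eq_bigr => a ai; rewrite (bigD1 i)/= 1?eq_sym// lnk_sym.
by rewrite big_split/= addrA mulr_natl mulr2n.
Qed.

(* Points nearly maximizing the discrete energy have nearly equal potentials, not smaller
   than anywhere else on [A]; elsewhere the potential is compared with that at the nearest of them. *)
Lemma extremal_potential (A : set C) (m D T : R) : 0 < m -> m <= 1 -> 1 <= D ->
  (forall z w, A z -> A w -> modc (z - w) <= D) ->
  (forall N (zeta : 'I_N -> C), (0 < N)%N -> (forall i, A (zeta i)) ->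
     exists2 z, A z & - T < lpot m zeta z) ->
  A !=set0 ->
  exists N (zeta : 'I_N -> C), [/\ (0 < N)%N, forall i, A (zeta i) &
    forall z, - T - 2 <= lpot m zeta z].
Proof.
move=> m0 m1 D1 AD hT [a0 Aa0].
have D0 : 0 < D by rlra.
have lD : 0 <= ln D by rewrite ln_ge0.
have lm : ln m <= 0 by rewrite ln_le0// m1.
(* [N] has to absorb three errors: the diagonal term [ln m], one term bounded by [ln D], and the
   defect 1 in the maximality of the energy. *)
pose B := ln D - ln m + 1; have B0 : 0 <= B by rewrite /B; rlra.
have [N hN] : exists N : nat, B < N%:R.
  have := archi_boundP B0; by exists (Num.bound B).
have N0 : 0 < N%:R :> R by apply: le_lt_trans hN.
have N0' : (0 < N)%N by rewrite -(ltr0n R).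
pose S := [set e : R | exists2 zeta : 'I_N -> C, (forall i, A (zeta i)) & e = energy m zeta].
have supS : has_sup S.
  split; first by exists (energy m (fun _ : 'I_N => a0)); exists (fun=> a0).
  exists (\sum_(i < N) \sum_(j < N | j != i) ln D) => _ [zeta hz ->].
  apply: ler_sum => i _; apply: ler_sum => j _.
  by apply: lnk_mono; [exact: m0|rlra|exact: AD].
have [e [zeta hz ->] hsup] := sup_adherent ltr01 supS.
(* Moving one point within [A] changes the energy by twice the change of its interaction with the
   others, and the energy is within 1 of its supremum. *)
have max1 i z : A z -> \sum_(j | j != i) lnk m (z - zeta j) <=
    \sum_(j | j != i) lnk m (zeta i - zeta j) + 1.
  move=> Az.
  have : energy m (upd zeta i z) <= sup S.
    apply: sup_upper_bound => //; exists (upd zeta i z) => // j.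
    by rewrite /upd; case: ifP.
  rewrite (energy_split m (upd zeta i z) i); move: hsup; rewrite (energy_split m zeta i) => hsup.
  have -> : \sum_(j | j != i) lnk m (upd zeta i z i - upd zeta i z j) =
      \sum_(j | j != i) lnk m (z - zeta j).
    by apply: eq_bigr => j ji; rewrite /upd eqxx (negbTE ji).
  have -> : \sum_(a | a != i) \sum_(b | (b != a) && (b != i)) lnk m (upd zeta i z a - upd zeta i z b)
      = \sum_(a | a != i) \sum_(b | (b != a) && (b != i)) lnk m (zeta a - zeta b).
    apply: eq_bigr => a ai; apply: eq_bigr => b /andP[_ bi].
    by rewrite /upd (negbTE ai) (negbTE bi).
  rlra.
exists N, zeta; split=> // z.
have [z1 Az1 hz1] := hT N zeta N0' hz.
have node i : - T - 1 <= lpot m zeta (zeta i).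
  have h1 := max1 i z1 Az1.
  have h2 : \sum_j lnk m (z1 - zeta j) <= ln D + \sum_(j | j != i) lnk m (z1 - zeta j).
    rewrite (bigD1 i)//= lerD2r; apply: lnk_mono; [exact: m0|rlra|exact: AD].
  have h3 : \sum_j lnk m (zeta i - zeta j) = ln m + \sum_(j | j != i) lnk m (zeta i - zeta j).
    by rewrite (bigD1 i)//= subrr /lnk modc0 (max_idPr (ltW m0)).
  move: hz1; rewrite /lpot ltr_pdivlMl// ler_pdivlMl// h3 => hz1.
  have : N%:R * (- T - 1) = N%:R * - T - N%:R by ring.
  rewrite /B in hN; rlra.
pose i0 := Ordinal N0'.
case: (@arg_minP _ _ _ i0 predT (fun i => modc (z - zeta i)) isT) => i _ hi.
(* [zeta i] being nearest to [z], its distance to [zeta j] is at most twice that of [z], which costs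
   [ln 2 <= 1] per point. *)
have near j : lnk m (zeta i - zeta j) <= lnk m (z - zeta j) + 1.
  apply: lnk_half => //; apply: le_trans (ler_modc_dist _ z _) _.
  by rewrite (modc_sym (zeta i)); have := hi j isT; rlra.
have := node i; rewrite /lpot !ler_pdivlMl// => h.
have : \sum_j lnk m (zeta i - zeta j) <= \sum_j (lnk m (z - zeta j) + 1) by exact: ler_sum.
rewrite big_split/= sumr_const card_ord -[X in _ + X]/(1 *+ N) => h'.
have : N%:R * (- T - 2) = N%:R * (- T - 1) - N%:R by ring.
rlra.
Qed.


Lemma cont_lnk m (zeta z : C) : 0 < m -> {for z, continuous (fun z => lnk m (z - zeta))}.
Proof.
move=> m0; apply: cont_ln; first by rewrite lt_max m0 orbT.
by apply: cont_maxr; [exact: cont_modcB|exact: cont_cst].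
Qed.

Lemma cont_sum (I : Type) (l : seq I) (u : I -> C -> R) (z : C) :
  (forall i, {for z, continuous (u i)}) -> {for z, continuous (fun z => \sum_(i <- l) u i z)}.
Proof.
move=> h; elim: l => [|i l IH].
  have -> : (fun z => \sum_(i <- [::]) u i z) = fun=> 0 by apply: funext => w; rewrite big_nil.
  exact: cont_cst.
have -> : (fun z => \sum_(j <- i :: l) u j z) = fun z => u i z + \sum_(j <- l) u j z.
  by apply: funext => w; rewrite big_cons.
exact: cont_add.
Qed.

Lemma cont_lpot m N (zeta : 'I_N -> C) (z : C) : 0 < m -> {for z, continuous (lpot m zeta)}.
Proof.
move=> m0; apply: cont_mul; first exact: cont_cst.
by apply: (@cont_sum _ _ (fun i z => lnk m (z - zeta i))) => i; exact: cont_lnk.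
Qed.

Lemma csh_lnB (zeta z : C) : z != zeta -> csh (fun z => ln (modc (z - zeta))) z.
Proof.
move=> zn; apply: (@csh_lnabs _ (fun z => z - zeta)); first by rewrite subr_eq0.
by exists 1 => // y _; apply: holB; [exact: hol_id|exact: hol_cst].
Qed.

Lemma csh_NlnB (zeta z : C) : z != zeta -> csh (fun z => - ln (modc (z - zeta))) z.
Proof.
move=> zn; have zp : 0 < modc (z - zeta) by rewrite modc_gt0 subr_eq0.
apply: (@csh_eq _ (fun z => ln (modc (z - zeta)^-1)) _ _ _ zp) => [y yz|].
  rewrite modcV lnV ?posrE// modc_gt0 subr_eq0.
  by apply: contraTneq yz => ->; rewrite modc_sym ltxx.
apply: (@csh_lnabs _ (fun z => (z - zeta)^-1)); first by rewrite invr_eq0 subr_eq0.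
exists (modc (z - zeta)) => // y yz; apply: holV.
  by rewrite subr_eq0; apply: contraTneq yz => ->; rewrite modc_sym ltxx.
by apply: holB; [exact: hol_id|exact: hol_cst].
Qed.

Lemma csh_lnk m (zeta z : C) : 0 < m -> csh (fun z => lnk m (z - zeta)) z.
Proof.
move=> m0; have [zm|mz] := ltP (modc (z - zeta)) m.
  have d0 : 0 < m - modc (z - zeta) by rewrite subr_gt0.
  apply: (csh_eq d0 _ (csh_cst (ln m) z)) => y yz.
  rewrite /lnk; congr ln; apply/esym/max_idPr/ltW.
  by apply: le_lt_trans (ler_modc_dist _ z _) _; rlra.
have zp : 0 < modc (z - zeta) by exact: lt_le_trans m0 mz.
have zn : z != zeta by rewrite -subr_eq0 -modc_gt0.
apply: (csh_eq zp _ (csh_max (csh_lnB zn) (csh_cst (ln m) z))) => y yz.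
have yp : 0 < modc (y - zeta).
  by rewrite modc_gt0 subr_eq0; apply: contraTneq yz => ->; rewrite modc_sym ltxx.
by rewrite /lnk; have [h|h] := leP (modc (y - zeta)) m; [apply/max_idPr|apply/max_idPl];
  rewrite ler_ln ?posrE// ltW.
Qed.

Lemma csh_lpot m N (zeta : 'I_N -> C) (z : C) : 0 < m -> csh (lpot m zeta) z.
Proof.
move=> m0; case: N zeta => [|N] zeta.
  have -> : lpot m zeta = fun=> 0 by apply: funext => w; rewrite /lpot big_ord0 mulr0.
  exact: csh_cst.
apply: csh_scale; first by rewrite invr_gt0 ltr0n.
by apply: (csh_sum _ (u := fun i z => lnk m (z - zeta i))) => i; exact: csh_lnk.
Qed.

(* The pseudohyperbolic distance on the disc of radius [s] is less than 1. *)
Lemma blaschke_id (s : R) (z zeta : C) :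
  modc (toC (s ^+ 2) - conjc zeta * z) ^+ 2 - s ^+ 2 * modc (z - zeta) ^+ 2 =
  (s ^+ 2 - modc z ^+ 2) * (s ^+ 2 - modc zeta ^+ 2).
Proof.
rewrite !modc_sqr !(reCB, imCB) reCM imCM reC_toC imC_toC.
have -> : reC (conjc zeta) = reC zeta by case: (zeta).
have -> : imC (conjc zeta) = - imC zeta by case: (zeta).
by ring.
Qed.

Lemma modc_conj (z : C) : modc (conjc z) = modc z.
Proof. by case: z => a b; rewrite /modc /= sqrrN. Qed.

Lemma blaschke_low (s : R) (z zeta : C) : 0 < s ->
  s ^+ 2 - modc zeta * modc z <= modc (toC (s ^+ 2) - conjc zeta * z).
Proof.
move=> s0; have := ler_modc_sub (toC (s ^+ 2)) (conjc zeta * z).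
by rewrite modc_toC ger0_norm ?sqr_ge0// modcM modc_conj.
Qed.

Lemma blaschke_up (s : R) (z zeta : C) : 0 < s ->
  modc (toC (s ^+ 2) - conjc zeta * z) <= s ^+ 2 + modc zeta * modc z.
Proof.
move=> s0; have := ler_modcB (toC (s ^+ 2)) (conjc zeta * z).
by rewrite modc_toC ger0_norm ?sqr_ge0// modcM modc_conj.
Qed.

(** At a fixed [z1] the bound is uniform for [zeta] in a smaller disc, because the right side of
    [blaschke_id] is then bounded away from 0. *)
Lemma blaschke_lt1 (s r' : R) (z1 : C) : 0 < s -> 0 <= r' < s -> modc z1 < s ->
  exists2 q : R, 0 < q < 1 & forall zeta, modc zeta <= r' ->
    s * modc (z1 - zeta) <= q * modc (toC (s ^+ 2) - conjc zeta * z1).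
Proof.
move=> s0 /andP[r'0 r's] z1s.
have s20 : 0 < s ^+ 2 by rewrite exprn_gt0.
(* The least value of the right side of [blaschke_id] divided by [4 * s ^+ 4], the square of the
   bound [2 * s ^+ 2] of the denominator. *)
pose g := (s ^+ 2 - modc z1 ^+ 2) * (s ^+ 2 - r' ^+ 2) / (4 * s ^+ 4).
have p1 : 0 < s ^+ 2 - modc z1 ^+ 2 by rewrite subr_gt0 ltrXn2r ?nnegrE ?modc_ge0 ?(ltW s0).
have p2 : 0 < s ^+ 2 - r' ^+ 2 by rewrite subr_gt0 ltrXn2r ?nnegrE ?(ltW s0).
have s40 : 0 < 4 * s ^+ 4 by rewrite mulr_gt0// exprn_gt0.
have g0 : 0 < g by rewrite divr_gt0// mulr_gt0.
have s4 : s ^+ 4 = s ^+ 2 * s ^+ 2 by rewrite -exprD.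
have g1 : g < 1.
  rewrite ltr_pdivrMr// mul1r s4.
  have h1 := sqr_ge0 (modc z1); have h2 := sqr_ge0 r'; nra.
pose q := Num.sqrt (1 - g).
have q2 : q ^+ 2 = 1 - g by rewrite sqr_sqrtr; rlra.
have q0 : 0 < q by rewrite sqrtr_gt0; rlra.
exists q.
  rewrite q0 /=; have : q ^+ 2 < 1 ^+ 2 by rewrite q2 expr1n; rlra.
  by rewrite ltr_pXn2r ?nnegrE// ltW.
move=> zeta hz.
have bu : modc (toC (s ^+ 2) - conjc zeta * z1) <= 2 * s ^+ 2.
  apply: le_trans (blaschke_up _ _ s0) _.
  have : modc zeta * modc z1 <= s * s by rewrite ler_pM ?modc_ge0//; rlra.
  rewrite expr2; rlra.
rewrite -ler_sqr ?nnegrE ?mulr_ge0 ?modc_ge0 ?(ltW s0) ?(ltW q0)//.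
rewrite !exprMn q2.
have := blaschke_id s z1 zeta.
set b := modc (toC (s ^+ 2) - _) in bu *; set dd := modc (z1 - zeta) => bid.
have h1 : modc zeta ^+ 2 <= r' ^+ 2 by rewrite lerXn2r ?nnegrE ?modc_ge0.
have h2 : (s ^+ 2 - modc z1 ^+ 2) * (s ^+ 2 - r' ^+ 2) <= (s ^+ 2 - modc z1 ^+ 2) * (s ^+ 2 - modc zeta ^+ 2).
  by rewrite ler_pM2l//; rlra.
have h3 : g * b ^+ 2 <= (s ^+ 2 - modc z1 ^+ 2) * (s ^+ 2 - r' ^+ 2).
  rewrite /g mulrAC ler_pdivrMr// ler_pM2l ?mulr_gt0//.
  have : b ^+ 2 <= (2 * s ^+ 2) ^+ 2.
    by apply: lerXn2r bu; rewrite nnegrE ?modc_ge0//; rlra.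
  by rewrite exprMn s4 expr2; rlra.
rlra.
Qed.

End Energy.

(** * Potentials very negative on a compact polar set *)

Section Capacity.
Variable R : realType.
Local Notation C := (Cplx R).

Lemma aff_lt (c k e : R) (x : \bar R) : 0 < c ->
  (c%:E * x + k%:E < e%:E)%E = (x < ((e - k) / c)%:E)%E.
Proof.
move=> c0; case: x => [x| |].
- by rewrite -EFinM -EFinD !lte_fin ltr_pdivlMr// ltrBrDr mulrC.
- by rewrite gt0_muley ?lte_fin//= addye// !ltNge !leey.
- by rewrite gt0_muleNy ?lte_fin//= addNye !ltNyr.
Qed.

Lemma aff_le (c k e : R) (x : \bar R) : 0 < c ->
  (c%:E * x + k%:E <= e%:E)%E = (x <= ((e - k) / c)%:E)%E.
Proof.
move=> c0; case: x => [x| |].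
- by rewrite -EFinM -EFinD !lee_fin ler_pdivlMr// lerBrDr mulrC.
- by rewrite gt0_muley ?lte_fin//= addye// !leNgt !ltry.
- by rewrite gt0_muleNy ?lte_fin//= addNye !leNye.
Qed.

Lemma lte_dense (x : \bar R) (e : R) : (x < e%:E)%E -> exists2 e' : R, e' < e & (x < e'%:E)%E.
Proof.
case: x => [x| |]//; last by exists (e - 1); [rlra|exact: ltNyr].
by rewrite lte_fin => xe; exists ((x + e) / 2); rewrite ?lte_fin; rlra.
Qed.

Lemma usc_affine (U : set C) (h : C -> \bar R) (k : C -> R) (c : R) (x : C) (e : \bar R) : 0 < c ->
  open U -> U x -> (forall z, U z -> (h z < +oo)%E) -> usc_on U h -> {for x, continuous k} ->
  (c%:E * h x + (k x)%:E < e)%E -> \forall y \near x, (c%:E * h y + (k y)%:E < e)%E.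
Proof.
move=> c0 oU Ux hoo hu kx; case: e => [e| |]//.
- rewrite aff_lt// => /lte_dense[e' ee' he'].
  have /contP/(_ (e - k x - c * e'))[|d d0 hd] := kx.
    by move: ee'; rewrite ltr_pdivlMr//; rlra.
  have [d' d'0 hd'] := (nearCP x (fun y => h y < e'%:E)%E).1 (hu _ Ux _ he').
  apply/nearCP; exists (Num.min d d'); first by rewrite lt_min d0.
  move=> y; rewrite lt_min => /andP[/hd yd /hd' yd']; rewrite aff_lt//; apply: lt_le_trans yd' _.
  by rewrite lee_fin ler_pdivlMr//; move: yd; rewrite ltr_norml => /andP[_]; rlra.
- move=> _; have [d d0 hd] := (openCP U).1 oU _ Ux.
  apply/nearCP; exists d => // y /hd /hoo; case: (h y) => [t| |]// _.
    by rewrite -EFinM -EFinD ltry.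
  by rewrite gt0_muleNy ?lte_fin//= addNye.
- by rewrite ltNge leNye.
Qed.

Lemma cmeanZ (c : R) (phi : R -> R) : ctn phi 0 (tpi R) ->
  cmean (fun t => c * phi t) = c * cmean phi.
Proof. by move=> h; rewrite /cmean RintZ// mulrCA. Qed.

Lemma cmean_modc_sqr (a z0 : C) (t : R) : 0 <= t ->
  cmean (fun s => modc (cpt z0 t s - a) ^+ 2) = modc (z0 - a) ^+ 2 + t ^+ 2.
Proof.
move=> t0; pose p : {poly C} := toC 2 *: ((conjc (z0 - a))%:P * ('X - z0%:P)).
have pE z : reC p.[z] = 2 * reC (conjc (z0 - a) * (z - z0)).
  by rewrite /p hornerZ hornerM hornerC hornerXsubC reCM reC_toC imC_toC mul0r subr0.
have -> : (fun s => modc (cpt z0 t s - a) ^+ 2) =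
    (fun s => (modc (z0 - a) ^+ 2 + t ^+ 2) + reC p.[cpt z0 t s]).
  apply: funext => s; rewrite (modc_sqrB _ (z0 - a)) pE.
  have -> : cpt z0 t s - a - (z0 - a) = cpt z0 t s - z0 by rewrite opprB addrA subrK.
  by rewrite modc_cpt//; rlra.
rewrite cmeanD.
- by rewrite cmean_cst cmean_poly pE subrr mulr0 /= mulr0 addr0.
- by apply: ctn_of => x; exact: cvg_cst.
- by apply: ctn_of => x; exact: (@cont_cpt _ (fun z => reC p.[z]) z0 t x (@cont_poly _ p _)).
Qed.

(* A strictly submean continuous perturbation excludes an interior maximum of [c h + k]. *)
Lemma no_interior_max (U : set C) (h : C -> \bar R) (X : C -> R) (a z0 : C) (c e d w0 : R) :
  0 < c -> 0 < e -> 0 < d -> subharmonic_on U h ->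
  (forall z, modc (z - z0) < d -> U z) ->
  (forall z, modc (z - z0) < d -> csh X z) ->
  (forall z, modc (z - z0) < d ->
    (c%:E * h z + (X z + e * modc (z - a) ^+ 2)%:E <= w0%:E)%E) ->
  (c%:E * h z0 + (X z0 + e * modc (z0 - a) ^+ 2)%:E)%E = w0%:E -> False.
Proof.
move=> c0 e0 d0 [hoo hu hsub] dU Xc hle w0E.
pose t := d / 2; have t0 : 0 < t by rewrite /t; rlra.
have td : t < d by rewrite /t; rlra.
have onc s : modc (cpt z0 t s - z0) < d by rewrite modc_cpt// ltW.
have h0 : (h z0 <= circle_mean h z0 t)%E.
  apply: hsub => //; first by apply: dU; rewrite subrr modc0.
  by move=> z; rewrite (closed_ballCE _ _ t0) => zt; apply: dU; exact: le_lt_trans td.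
have Xs : X z0 <= cmean (X \o cpt z0 t).
  apply: submean => // z zt; first by apply: csh_cont; apply: Xc; exact: le_lt_trans td.
  by apply: csh_tst; apply: Xc; exact: lt_trans td.
pose k (z : C) := X z + e * modc (z - a) ^+ 2.
have ck s : {for cpt z0 t s, continuous k}.
  apply: cont_add; first exact: csh_cont (Xc _ (onc s)).
  by apply: cont_mul; [exact: cont_cst|exact: cont_modc_sqr].
(* Maximality of [w0] bounds the possibly irregular [h] on the circle by this continuous function,
   whose mean can be computed. *)
pose psi z := c^-1 * (w0 - k z).
have cpsi s : {for cpt z0 t s, continuous psi}.
  apply: cont_mul; first exact: cont_cst.
  apply: cont_add; first exact: cont_cst.
  have -> : (fun z => - k z) = (fun z => -1 * k z) by apply: funext => z; rewrite mulN1r.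
  by apply: cont_mul; [exact: cont_cst|exact: ck].
have hpsi s : (h (cpt z0 t s) <= (psi (cpt z0 t s))%:E)%E.
  by have := hle _ (onc s); rewrite aff_le// /psi mulrC.
have h1 := le_trans h0 (le_circle_mean hu (fun s => dU _ (onc s)) cpsi hpsi).
have : (h z0 <= (c^-1 * (w0 - cmean (k \o cpt z0 t)))%:E)%E.
  apply: le_trans h1 _; rewrite lee_fin.
  have -> : psi \o cpt z0 t = fun s => c^-1 * w0 + - c^-1 * (k \o cpt z0 t) s.
    by apply: funext => s; rewrite /psi /= mulrBr mulNr.
  have ck' : ctn (k \o cpt z0 t) 0 (tpi R) by apply: ctn_of => x; exact: cont_cpt.
  rewrite cmeanD ?cmean_cst ?cmeanZ//; first by rewrite mulrBr mulNr.
    by apply: ctn_of => x; exact: cvg_cst.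
  apply: ctn_of => x; apply: cont_mulR; first exact: cvg_cst.
  exact: cont_cpt.
have cX : ctn (X \o cpt z0 t) 0 (tpi R).
  by apply: ctn_of => x; apply: cont_cpt; exact: csh_cont (Xc _ (onc x)).
have cq : ctn (fun s => modc (cpt z0 t s - a) ^+ 2) 0 (tpi R).
  by apply: ctn_of => x; exact: (@cont_cpt _ (fun z => modc (z - a) ^+ 2) z0 t x (@cont_modc_sqr _ a _)).
(* Here is the strict gain: the mean of [|z - a|^2] over a circle of radius [t] exceeds the value at
   its centre by [t ^+ 2]. *)
have km : k z0 + e * t ^+ 2 <= cmean (k \o cpt z0 t).
  have -> : k \o cpt z0 t = fun s => (X \o cpt z0 t) s + e * modc (cpt z0 t s - a) ^+ 2 by [].
  rewrite cmeanD// ?cmeanZ// ?cmean_modc_sqr ?(ltW t0)// ?/k; first rlra.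
  apply: ctn_of => x; apply: cont_mulR; first exact: cvg_cst.
  exact: (@cont_cpt _ (fun z => modc (z - a) ^+ 2) z0 t x (@cont_modc_sqr _ a _)).
have et : 0 < e * t ^+ 2 by rewrite mulr_gt0// exprn_gt0.
move=> h2.
have : (c%:E * h z0 + (k z0 + e * t ^+ 2)%:E <= w0%:E)%E.
  rewrite aff_le//; apply: le_trans h2 _; rewrite lee_fin mulrC ler_pM2r ?invr_gt0//; rlra.
rewrite EFinD addeA; have -> : (c%:E * h z0 + (k z0)%:E)%E = w0%:E by exact: w0E.
by rewrite -EFinD lee_fin; rlra.
Qed.

Lemma modc_conjE (s : R) (u v : C) : 0 < s -> modc u = s ->
  modc (toC (s ^+ 2) - conjc v * u) = s * modc (u - v).
Proof.
move=> s0 us; have := blaschke_id s u v; rewrite us subrr mul0r => /eqP.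
rewrite subr_eq0 -exprMn eqrXn2 ?modc_ge0 ?mulr_ge0 ?modc_ge0 ?(ltW s0)//.
by move=> /eqP.
Qed.

Lemma sum_avg (N : nat) (u : 'I_N -> R) (c : R) : (0 < N)%N -> (forall i, c <= u i) ->
  c <= N%:R^-1 * \sum_i u i.
Proof.
move=> N0 h; rewrite ler_pdivlMl ?ltr0n//.
have : \sum_(i < N) c <= \sum_i u i by exact: ler_sum.
by rewrite sumr_const card_ord -[X in X <= _]mulr_natl.
Qed.

Lemma avg_sum (N : nat) (u : 'I_N -> R) (c : R) : (0 < N)%N -> (forall i, u i <= c) ->
  N%:R^-1 * \sum_i u i <= c.
Proof.
move=> N0 h; rewrite ler_pdivrMl ?ltr0n//.
have : \sum_i u i <= \sum_(i < N) c by exact: ler_sum.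
by rewrite sumr_const card_ord -[X in _ <= X]mulr_natl.
Qed.

(* Maximum principle for [c h + X] with [h] subharmonic: at an interior maximum of its strictly
   submean perturbation by [e |z - a|^2] the mean value inequalities of [h] and [X] would conflict. *)
Lemma max_principle_mixed (U : set C) (h : C -> \bar R) (X : C -> R) (a : C) (s c M : R) :
  0 < s -> 0 < c -> open U -> subharmonic_on U h -> (forall z, modc (z - a) <= s -> U z) ->
  (forall z, modc (z - a) <= s -> {for z, continuous X}) ->
  (forall z, modc (z - a) <= s ->
    (c%:E * h z + (X z)%:E <= M%:E)%E \/ modc (z - a) < s /\ csh X z) ->
  forall z, modc (z - a) <= s -> (c%:E * h z + (X z)%:E <= M%:E)%E.
Proof.
move=> s0 c0 oU hsh sU cX hX z1 z1s; have [hoo hu _] := hsh.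
have s20 : 0 < s ^+ 2 by rewrite exprn_gt0.
suff claim e : 0 < e -> (c%:E * h z1 + (X z1)%:E <= (M + e * s ^+ 2)%:E)%E.
  case: (h z1) (hoo _ (sU _ z1s)) claim => [y| |]//; last by rewrite gt0_muleNy ?lte_fin// addNye leNye.
  rewrite -EFinM -EFinD lee_fin leNgt => _ claim; apply/negP => hy.
  have e0 : 0 < (c * y + X z1 - M) / (2 * s ^+ 2) by rewrite divr_gt0 ?mulr_gt0//; rlra.
  have := claim _ e0; rewrite lee_fin.
  have -> : (c * y + X z1 - M) / (2 * s ^+ 2) * s ^+ 2 = (c * y + X z1 - M) / 2.
    by field; rewrite gt_eqF.
  rlra.
move=> e0; pose k z := X z + e * modc (z - a) ^+ 2.
pose K := [set z : C | 0 <= modc (z - a) <= s].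
have KE z : modc (z - a) <= s -> K z by move=> zs; rewrite /K/= modc_ge0.
have [z0 Kz0 hz0] : exists2 x0, K x0 & forall x, K x ->
    (c%:E * h x + (k x)%:E <= c%:E * h x0 + (k x0)%:E)%E.
  apply: (usc_max (v := fun x => (c%:E * h x + (k x)%:E)%E)); first exact: compact_annulus.
    by exists z1; exact: KE.
  move=> x /andP[_ xs] t; apply: (usc_affine c0 oU) => //; first exact: sU.
  exact: (cont_add (cX x xs) (cont_mul (@cont_cst _ e x) (@cont_modc_sqr _ a x))).
have z0s : modc (z0 - a) <= s by case/andP: Kz0.
have sq z : modc (z - a) <= s -> 0 <= e * modc (z - a) ^+ 2 <= e * s ^+ 2.
  move=> zs; rewrite mulr_ge0 ?sqr_ge0 ?(ltW e0)//= ler_pM2l// lerXn2r ?nnegrE ?modc_ge0//.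
  exact: ltW.
have up z : (c%:E * h z + (k z)%:E = c%:E * h z + (X z)%:E + (e * modc (z - a) ^+ 2)%:E)%E.
  by rewrite /k EFinD addeA.
suff w0le : (c%:E * h z0 + (k z0)%:E <= (M + e * s ^+ 2)%:E)%E.
  apply: le_trans (le_trans (hz0 _ (KE _ z1s)) w0le); rewrite up leeDl// lee_fin.
  by case/andP: (sq _ z1s).
have [h1|[z0lt Xc]] := hX _ z0s.
  by rewrite up [X in (_ <= X)%E]EFinD; apply: leeD => //; rewrite lee_fin; case/andP: (sq _ z0s).
case y0E : (h z0) (hoo _ (sU _ z0s)) => [y0| |]// _; last first.
  by rewrite gt0_muleNy ?lte_fin// addNye leNye.
exfalso; have [d1 d10 hd1] := csh_near Xc.
pose d2 := Num.min d1 (s - modc (z0 - a)).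
have d20 : 0 < d2 by rewrite lt_min d10 subr_gt0.
have ind2 y : modc (y - z0) < d2 -> modc (y - a) <= s.
  by rewrite lt_min => /andP[_ ys]; have := ler_modc_dist y z0 a; rlra.
apply: (@no_interior_max U h X a z0 c e d2 (c * y0 + k z0)) => //.
- by move=> y /ind2 /sU.
- by move=> y; rewrite lt_min => /andP[/hd1].
- by move=> y /ind2 /KE Ky; have := hz0 _ Ky; rewrite y0E.
- by rewrite y0E.
Qed.

Lemma subharmonic_bounded (U : set C) (h : C -> \bar R) (K : set C) : open U -> subharmonic_on U h ->
  compact K -> K `<=` U -> exists2 H : R, 0 <= H & forall z, K z -> (h z <= H%:E)%E.
Proof.
move=> oU [hoo hu _] cK KU; have [->|/set0P K0] := eqVneq K set0; first by exists 0.
have [x1 Kx1 hx1] : exists2 x0, K x0 & forall x, K x -> (h x <= h x0)%E.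
  apply: usc_max => // x Kx e hxe.
  have := @usc_affine U h (fun=> 0) 1 x e ltr01 oU (KU _ Kx) hoo hu (@cont_cst _ 0 x).
  rewrite mul1e adde0 => /(_ hxe); apply: filterS => y; by rewrite mul1e adde0.
case: (h x1) (hoo _ (KU _ Kx1)) hx1 => [y| |] // _ hx.
  exists (Num.max y 0); first by rewrite le_max lexx orbT.
  by move=> z /hx hz; apply: le_trans hz _; rewrite lee_fin le_max lexx.
by exists 0 => // z /hx hz; apply: le_trans hz _; exact: leNye.
Qed.

(** * Harmonic majorants from Blaschke denominators *)

Section Blaschke.
Variables (s r' : R) (a : C) (N : nat) (zeta : 'I_N -> C).
Hypotheses (s0 : 0 < s) (r's : r' < s) (N0 : (0 < N)%N) (zr : forall i, modc (zeta i - a) <= r').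

Definition bfac i z : C := toC (s ^+ 2) - conjc (zeta i - a) * (z - a).
(** The factor [bfac i / s] has the modulus of [z - zeta i] on the circle of radius [s] but no zero
    in the disc, so [bpot] is the harmonic extension of the boundary values of the potential. *)
Definition bpot z : R := N%:R^-1 * \sum_i ln (modc (bfac i z)) + - ln s.

Lemma bfac_ge i z : modc (z - a) <= s -> s ^+ 2 - s * r' <= modc (bfac i z).
Proof.
move=> zs; apply: le_trans (blaschke_low (z - a) (zeta i - a) s0).
by rewrite lerD2l lerN2 mulrC ler_pM ?modc_ge0.
Qed.

Lemma bfac_low_gt0 : 0 < s ^+ 2 - s * r'.
Proof. by rewrite subr_gt0 expr2 ltr_pM2l. Qed.

Lemma bfac_gt0 i z : modc (z - a) <= s -> 0 < modc (bfac i z).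
Proof. by move=> zs; apply: lt_le_trans (bfac_ge i zs); exact: bfac_low_gt0. Qed.

Lemma bpot_le z : modc (z - a) <= s -> bpot z <= ln (2 * s ^+ 2) - ln s.
Proof.
move=> zs; rewrite lerD2r; apply: avg_sum => // i.
rewrite ler_ln ?posrE ?mulr_gt0 ?exprn_gt0 ?bfac_gt0//; apply: le_trans (blaschke_up _ _ s0) _.
have : modc (zeta i - a) * modc (z - a) <= s * s.
  by rewrite ler_pM ?modc_ge0//; apply: le_trans (zr i) _; exact: ltW.
by rewrite expr2; rlra.
Qed.

Lemma bpot_circle m z : m < s - r' -> modc (z - a) = s -> bpot z = lpot m zeta z.
Proof.
move=> ms zs; have rs := r's; have sp := s0; rewrite /bpot.
have -> : \sum_i ln (modc (bfac i z)) = \sum_(i < N) (ln s + lnk m (z - zeta i)).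
  apply: eq_bigr => i _; have zi : s - r' <= modc (z - zeta i).
    by have := ler_modc_dist z (zeta i) a; have := zr i; rlra.
  rewrite /bfac modc_conjE// opprB addrA subrK lnM ?posrE//; last rlra.
  by rewrite /lnk (max_idPl _)//; rlra.
rewrite big_split/= sumr_const card_ord mulrDr -/(lpot m zeta z) -[ln s *+ N]mulr_natl mulKf.
  by ring.
by rewrite pnatr_eq0 -lt0n.
Qed.

(** The difference is the Green potential of the points, up to truncation: each Blaschke factor is
    at most [q] at [z], and the condition on [m] makes this survive the truncation. *)
Lemma bpot_point m q z : 0 < m -> 0 < q -> modc (z - a) <= s -> m * s <= q * (s ^+ 2 - s * r') ->
  (forall i, s * modc (z - zeta i) <= q * modc (bfac i z)) ->
  - ln q <= bpot z - lpot m zeta z.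
Proof.
move=> m0 q0 zs mq hq.
have : N%:R^-1 * \sum_i (lnk m (z - zeta i) - ln (modc (bfac i z))) <= ln q - ln s.
  apply: avg_sum => // i; rewrite lerBlDr -lnV ?posrE// -lnM ?posrE ?invr_gt0//.
  rewrite -lnM ?posrE ?divr_gt0 ?bfac_gt0//; apply: lnk_mono => //.
  - rewrite mulrAC ler_pdivlMr//; apply: le_trans mq _.
    by rewrite ler_pM2l//; exact: bfac_ge.
  - by rewrite mulrAC ler_pdivlMr// mulrC.
by rewrite big_split/= sumrN mulrBr -/(lpot m zeta z) /bpot; rlra.
Qed.

Lemma cont_bpot z : modc (z - a) <= s -> {for z, continuous bpot}.
Proof.
move=> zs; apply: cont_add; last exact: cont_cst.
apply: cont_mul; first exact: cont_cst.
apply: (cont_sum _ (u := fun i z => ln (modc (bfac i z)))) => i.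
apply: cont_ln; first exact: bfac_gt0.
apply: cont_modc; apply: hol_cont; apply: holB; first exact: hol_cst.
by apply: holM; [exact: hol_cst|apply: holB; [exact: hol_id|exact: hol_cst]].
Qed.

Lemma csh_bpot z : modc (z - a) <= s -> csh bpot z.
Proof.
move=> zs; apply: csh_addc; apply: csh_scale; first by rewrite invr_gt0 ltr0n.
apply: (csh_sum _ (u := fun i z => ln (modc (bfac i z)))) => i.
apply: csh_lnabs; first by rewrite -modc_gt0 bfac_gt0.
exists 1 => // y _; apply: holB; first exact: hol_cst.
by apply: holM; [exact: hol_cst|apply: holB; [exact: hol_id|exact: hol_cst]].
Qed.

(** Farther than [m] from all points the truncation is inactive and the potential is harmonic, so
    its opposite is subharmonic too. *)
Lemma csh_Nlpot m d z : m < d -> (forall i, d <= modc (z - zeta i)) -> 0 < m ->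
  csh (fun z => -1 * lpot m zeta z) z.
Proof.
move=> md hz m0; have e0 : 0 < d - m by rlra.
have hc : csh (fun z => N%:R^-1 * \sum_i - ln (modc (z - zeta i))) z.
  apply: csh_scale; first by rewrite invr_gt0 ltr0n.
  apply: (csh_sum _ (u := fun i z => - ln (modc (z - zeta i)))) => i.
  by apply: csh_NlnB; rewrite -subr_eq0 -modc_gt0; have := hz i; rlra.
apply: (csh_eq e0 _ hc) => y yz; rewrite /lpot sumrN mulrN mulN1r; congr (- (_ * _)).
apply: eq_bigr => i _; rewrite /lnk (max_idPl _)//.
by have := ler_modc_dist z y (zeta i); have := hz i; rewrite (modc_sym z y); rlra.
Qed.

End Blaschke.

Lemma minus_infty_near (U : set C) (h : C -> \bar R) (S : set C) (c : R) : usc_on U h -> compact S ->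
  S `<=` U -> (forall z, S z -> h z = -oo%E) ->
  exists2 d : R, 0 < d & forall z, S z -> forall y, modc (y - z) < d -> (h y < c%:E)%E.
Proof.
move=> hu cS SU hS.
apply: (@compact_unif _ S (fun z d => forall y, modc (y - z) < d -> (h y < c%:E)%E)) => //.
  by move=> y d d' dd' hy z zd'; apply: hy; exact: lt_le_trans dd'.
move=> x Sx; have /nearCP[d dp hd] := hu _ (SU _ Sx) c (eq_ind_r (fun e => (e < _)%E) (ltNyr _) (hS _ Sx)).
exists (d / 2); first rlra.
by move=> y yx z zy; apply: hd; have := ler_modc_dist z y x; rlra.
Qed.

(* Comparison of [h] with the potential of near-extremal points: if the latter stayed above [- T],
   then [c h] plus the difference of the two potentials would violate the maximum principle. *)
Lemma potential_bound (a z1 : C) (r r' s q T H h1 : R) (h : C -> \bar R) (S : set C) :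
  0 < s -> r' < s -> s < r -> subharmonic_on (ball a (toC r)) h -> modc (z1 - a) < s ->
  0 < q < 1 -> (forall zeta, modc zeta <= r' ->
    s * modc (z1 - a - zeta) <= q * modc (toC (s ^+ 2) - conjc zeta * (z1 - a))) ->
  0 <= H -> (forall z, modc (z - a) <= s -> (h z <= H%:E)%E) -> h z1 = h1%:E ->
  compact S -> (forall z, S z -> modc (z - a) <= r' /\ h z = -oo%E) ->
  exists2 m : R, 0 < m < 1 & forall N (zeta : 'I_N -> C), (0 < N)%N -> (forall i, S (zeta i)) ->
    exists z, modc (z - a) <= s /\ lpot m zeta z < - T.
Proof.
move=> s0 r's sr hsh z1s /andP[q0 q1] hq H0 hH h1E cS hS.
have [_ hu _] := hsh.
have oB : open (ball a (toC r)).
  by apply/openCP => z /ballCE zr; exists (r - modc (z - a)); [rlra|] => y yz; apply/ballCE;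
    have := ler_modc_dist y z a; rlra.
have KU z : modc (z - a) <= s -> ball a (toC r) z by move=> zs; rewrite ballCE; rlra.
have h1H : h1 <= H by have := hH _ (ltW z1s); rewrite h1E lee_fin.
have lq : ln q < 0 by rewrite ln_lt0// q0.
(* [c] is so small that [c * (H - h1)] stays below the gain [- ln q] at [z1]; this is the violation
   of the maximum principle. *)
have [c [c0 hc]] : exists c : R, 0 < c /\ c * (H - h1) < - ln q.
  exists (- ln q / (H - h1 + 1)); split; first by rewrite divr_gt0; rlra.
  by rewrite mulrAC ltr_pdivrMr; [rewrite ltr_pM2l; rlra|rlra].
have [T' [T'0 T'1]] : exists T' : R, 0 <= T' /\ T + ln (2 * s ^+ 2) - ln s <= T'.
  by exists (Num.max (T + ln (2 * s ^+ 2) - ln s) 0); rewrite !le_max !lexx orbT.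
(* Within [d0] of [S], [h < - Sl], hence [c * h < - (T' + 1)], which beats the upper bound [T'] of
   [X]. *)
have [Sl cSl] : exists Sl, c * Sl = T' + 1.
  by exists ((T' + 1) / c); rewrite mulrC divfK// gt_eqF.
have [d0 d00 hd0] : exists2 d : R, 0 < d & forall z, S z -> forall y, modc (y - z) < d -> (h y < (- Sl)%:E)%E.
  apply: (minus_infty_near _ hu cS) => z Sz; last by case: (hS _ Sz).
  by apply: KU; have [? _] := hS _ Sz; rlra.
have t30 : 0 < q * (s ^+ 2 - s * r') / s by rewrite divr_gt0// mulr_gt0// bfac_low_gt0.
(* In turn: no truncation at distance [d0] from the points, none on the circle of radius [s], and
   the condition of [bpot_point]. *)
have [m [m0 md ms mt m1]] : exists m : R, [/\ 0 < m, m < d0, m < s - r', m < q * (s ^+ 2 - s * r') / s & m < 1].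
  pose m := Num.min (Num.min d0 (s - r')) (Num.min (q * (s ^+ 2 - s * r') / s) 1).
  have m0 : 0 < m by rewrite !lt_min d00 t30 ltr01 subr_gt0 r's.
  have : m / 2 < m by rlra.
  by rewrite {2}/m !lt_min => /andP[/andP[? ?] /andP[? ?]]; exists (m / 2); split=> //; rlra.
exists m; first by rewrite m0.
move=> N zeta N0 zS; apply: contrapT => hno.
have lo z : modc (z - a) <= s -> - T <= lpot m zeta z.
  by move=> zs; rewrite leNgt; apply/negP => lz; apply: hno; exists z.
have zr i : modc (zeta i - a) <= r' by case: (hS _ (zS i)).
pose X z := -1 * lpot m zeta z + bpot s a zeta z.
have cX z : modc (z - a) <= s -> {for z, continuous X}.
  move=> zs; apply: cont_add; last exact: (cont_bpot s0 r's zr).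
  by apply: cont_mul; [exact: cont_cst|exact: cont_lpot].
have cH : 0 <= c * H by rewrite mulr_ge0// ltW.
have := @max_principle_mixed _ h X a s c (c * H) s0 c0 oB hsh KU cX _ z1 (ltW z1s).
rewrite h1E -EFinM -EFinD lee_fin => hz1; have {hz1} : c * h1 + X z1 <= c * H; last first.
  have : - ln q <= bpot s a zeta z1 - lpot m zeta z1.
    apply: (bpot_point s0 r's N0 zr m0 q0 (ltW z1s)).
      by apply: ltW; rewrite -ltr_pdivlMr.
    by move=> i; have := hq _ (zr i); rewrite opprB addrA subrK.
  by rewrite /X; rewrite mulrBr in hc; rlra.
apply: hz1 => z zs; have [z0lt|sz] := ltP (modc (z - a)) s; last first.
  have zs' : modc (z - a) = s by apply/eqP; rewrite eq_le zs.
  left; have -> : X z = 0 by rewrite /X (bpot_circle s0 r's N0 zr ms zs') mulN1r addNr.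
  by rewrite adde0 EFinM lee_pmul2l ?lte_fin//; exact: hH.
(* Near a point of the configuration [h] is negative enough; elsewhere [- lpot] is harmonic, so [X]
   is subharmonic. *)
have [[i zi]|far] := pselect (exists i, modc (z - zeta i) < d0).
  left; rewrite aff_le//; apply: le_trans (ltW (hd0 _ (zS i) _ zi)) _.
  rewrite lee_fin ler_pdivlMr// mulNr [Sl * c]mulrC cSl /X.
  by have := bpot_le s0 r's N0 zr zs; have := lo z zs; rlra.
right; split=> //; apply: csh_add; last exact: (csh_bpot s0 r's N0 zr).
apply: (csh_Nlpot N0 md) => // i; rewrite leNgt; apply/negP => zi; apply: far; by exists i.
Qed.

(** Otherwise every configuration in [S] has potential above [- T] somewhere on [S], and
    [extremal_potential] yields one staying above [- T - 2] everywhere; [potential_bound], applied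
    with [T + 3], forbids it. *)
Lemma capacity (a : C) (r r' T : R) (h : C -> \bar R) (S : set C) (z1 : C) :
  r' < r -> subharmonic_on (ball a (toC r)) h -> modc (z1 - a) < r -> h z1 != -oo%E ->
  compact S -> S !=set0 -> (forall z, S z -> modc (z - a) <= r' /\ h z = -oo%E) ->
  exists m N (zeta : 'I_N -> C), [/\ 0 < m < 1, (0 < N)%N, forall i, S (zeta i) &
    forall z, S z -> lpot m zeta z <= - T].
Proof.
move=> rr' hsh z1r hz1 cS S0 hS; apply: contrapT => hno.
have [hoo _ _] := hsh; have [x0 Sx0] := S0.
have r'0 : 0 <= r' by apply: le_trans (modc_ge0 (x0 - a)) _; case: (hS _ Sx0).
have [s [r's z1s sr]] : exists s : R, [/\ r' < s, modc (z1 - a) < s & s < r].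
  exists ((Num.max r' (modc (z1 - a)) + r) / 2).
  have : Num.max r' (modc (z1 - a)) < r by rewrite gt_max rr'.
  have : r' <= Num.max r' (modc (z1 - a)) by rewrite le_max lexx.
  have : modc (z1 - a) <= Num.max r' (modc (z1 - a)) by rewrite le_max lexx orbT.
  by split; rlra.
have s0 : 0 < s by rlra.
have [q q01 hq] := @blaschke_lt1 R s r' (z1 - a) s0 (introT andP (conj r'0 r's)) z1s.
have oB : open (ball a (toC r)).
  by apply/openCP => z /ballCE zr; exists (r - modc (z - a)); [rlra|] => y yz; apply/ballCE;
    have := ler_modc_dist y z a; rlra.
have [H H0 hH] : exists2 H : R, 0 <= H & forall z, modc (z - a) <= s -> (h z <= H%:E)%E.
  have [|H H0 hH] := @subharmonic_bounded _ h _ oB hsh (@compact_annulus R a 0 s).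
    by move=> z /andP[_ zs]; rewrite ballCE; rlra.
  by exists H => // z zs; apply: hH; rewrite /= modc_ge0.
have [h1 h1E] : exists h1 : R, h z1 = h1%:E.
  by case: (h z1) hz1 (hoo z1 ((ballCE a r z1).2 z1r)) => [y| |]// _ _; exists y.
have [m m01 hm] := @potential_bound a z1 r r' s q (T + 3) H h1 h S s0 r's sr hsh z1s q01 hq H0 hH h1E cS hS.
have [m0 m1] := andP m01.
have [|z w Sz Sw|N zeta N0 hz|N [zeta [N0 zS hpot]]] :=
  @extremal_potential _ S m (2 * r' + 1) T m0 (ltW m1) _ _ _ S0.
- rlra.
- have := ler_modc_dist z a w; rewrite (modc_sym a w).
  by have [? _] := hS _ Sz; have [? _] := hS _ Sw; rlra.
- apply: contrapT => hn; apply: hno; exists m, N, zeta; split=> // z Sz.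
  by rewrite leNgt; apply/negP => lz; apply: hn; exists z.
have [z [_ hz]] := hm N zeta N0 zS.
by have := hpot z; rlra.
Qed.

End Capacity.

(** * Thin sets, from local to global *)

Section Thin.
Variable R : realType.
Local Notation C := (Cplx R).

(** [S0] is where the poles may lie and [S] the part where [g] must be very negative. They are kept
    apart so that the pieces of a finite cover of [S0] can be treated one at a time. *)
Definition thin (S0 S : set C) := forall M delta eta Lam : R, 0 < delta -> 0 < eta ->
  exists g : C -> R, [/\ forall z, csh g z,
    forall z, S z -> modc z <= Lam -> g z <= - M,
    forall z, (forall s, S0 s -> eta <= modc (z - s)) -> - delta <= g z &
    forall z, modc z <= Lam -> g z <= delta].

Lemma thin0 S0 : thin S0 set0.
Proof.
move=> M delta eta Lam d0 e0; exists (fun=> 0); split=> //; first by move=> z; exact: csh_cst.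
- by move=> z _; rewrite lerNl oppr0 ltW.
- by move=> z _; exact: ltW.
Qed.

Lemma thinU S0 S1 S2 : thin S0 S1 -> thin S0 S2 -> thin S0 (S1 `|` S2).
Proof.
move=> h1 h2 M delta eta Lam d0 e0.
have d20 : 0 < delta / 2 by rlra.
have [g1 [c1 l1 b1 u1]] := h1 (M + delta) (delta / 2) eta Lam d20 e0.
have [g2 [c2 l2 b2 u2]] := h2 (M + delta) (delta / 2) eta Lam d20 e0.
exists (fun z => g1 z + g2 z); split.
- by move=> z; exact: csh_add.
- by move=> z [/l1 h|/l2 h] zL; [have := u2 _ zL|have := u1 _ zL]; have := h zL; rlra.
- by move=> z hz; have := b1 _ hz; have := b2 _ hz; rlra.
- by move=> z hz; have := u1 _ hz; have := u2 _ hz; rlra.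
Qed.

Lemma thin_sub S0 S S' : S' `<=` S -> thin S0 S -> thin S0 S'.
Proof.
move=> sS h M delta eta Lam d0 e0; have [g [c l b u]] := h M delta eta Lam d0 e0.
by exists g; split=> // z /sS; exact: l.
Qed.

(** The sets whose removal leaves a thin part of [S0] form a filter. If it were proper it would have
    a cluster point in [S0], while the local hypothesis puts the complement of a disc about that
    point in the filter. *)
Lemma compact_thin S0 : compact S0 ->
  (forall a, S0 a -> exists2 r : R, 0 < r & thin S0 [set z | S0 z /\ modc (z - a) <= r]) ->
  thin S0 S0.
Proof.
move=> cS hloc; pose F : set (set C) := [set X | thin S0 (S0 `\` X)].
have FF : Filter F.
  split.
  - by rewrite /F/= setDT; exact: thin0.
  - by move=> P Q hP hQ; rewrite /F/= setDIr; exact: thinU.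
  - by move=> P Q PQ; apply: thin_sub => z [? nQ]; split=> // /PQ.
apply: contrapT => hn.
have PF : ProperFilter F.
  by split=> //; rewrite /F/= setD0.
have [|a [S0a cl]] := cS F PF; first by rewrite /F/= setDv; exact: thin0.
have [r r0 hr] := hloc _ S0a.
have Fc : F [set z | r < modc (z - a)].
  apply: thin_sub hr => z [Sz nz]; split=> //.
  by rewrite leNgt; apply/negP.
have Na : nbhs a [set z : C | modc (z - a) < r].
  by apply/nearCP; exists r.
have [z [/= h1 h2]] := cl _ _ Fc Na.
by have := lt_trans h1 h2; rewrite ltxx.
Qed.

Lemma capacity_thin (S0 S : set C) (a : C) (r r' : R) (h : C -> \bar R) (z1 : C) :
  r' < r -> subharmonic_on (ball a (toC r)) h -> modc (z1 - a) < r -> h z1 != -oo%E ->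
  compact S -> S `<=` S0 -> (forall z, S z -> modc (z - a) <= r' /\ h z = -oo%E) ->
  thin S0 S.
Proof.
move=> rr' hsh z1r hz1 cS SS0 hS M0 delta eta Lam d0 e0.
have [->|/set0P S0'] := eqVneq S set0.
  by have [g [? l ? ?]] := @thin0 S0 M0 delta eta Lam d0 e0; exists g.
pose M := Num.max M0 1; have M1 : 0 < M by rewrite lt_max ltr01 orbT.
have MM0 : M0 <= M by rewrite le_max lexx.
clearbody M.
have [B B0 hB] := @cont_bounded _ S (fun z => modc z) cS (fun z _ => cont_modc (@hol_cont _ id z (hol_id z))).
(* [L] bounds the potential from below at distance [eta] from [S0] and from above on the disc of
   radius [Lam]. With [T = M * L / delta] and the scale [c = M / T], both [c * T = M] and
   [c * L = delta]. *)
pose L := `|ln eta| + `|ln (`|Lam| + B + 1)| + 1.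
have L0 : 0 < L by rewrite /L; have := normr_ge0 (ln eta); have := normr_ge0 (ln (`|Lam| + B + 1)); rlra.
pose T := M * L / delta.
have T0 : 0 < T by rewrite divr_gt0// mulr_gt0.
have [m [N [zeta [/andP[m0 m1] N0 hz hp]]]] := capacity T rr' hsh z1r hz1 cS S0' hS.
pose c := M / T; have c0 : 0 < c by rewrite divr_gt0.
have cT : c * T = M by rewrite /c divfK// gt_eqF.
have cL : c * L = delta by rewrite /c /T; field; rewrite !gt_eqF.
have cl x : x <= L -> c * x <= delta by move=> xL; rewrite -cL ler_pM2l.
clearbody c T.
exists (fun z => c * lpot m zeta z); split.
- by move=> z; apply: csh_scale => //; exact: csh_lpot.
- move=> z Sz _; have : c * lpot m zeta z <= c * - T by rewrite ler_pM2l//; exact: hp.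
  by rewrite mulrN cT; rlra.
- move=> z hz'; rewrite lerNl -mulrN; apply: cl.
  have : ln eta <= lpot m zeta z.
    apply: sum_avg => // i; rewrite ler_ln ?posrE ?lt_max ?m0 ?orbT//.
    by rewrite le_max hz'//; exact: SS0.
  by rewrite /L; have := normr_ge0 (ln (`|Lam| + B + 1)); have := ler_norm (- ln eta); rewrite normrN; rlra.
- move=> z zL; apply: cl.
  have : lpot m zeta z <= ln (`|Lam| + B + 1).
    apply: avg_sum => // i; have := normr_ge0 Lam; have := ler_norm Lam => h1 h2.
    apply: lnk_mono => //; first rlra.
    by apply: le_trans (ler_modcB _ _) _; have := hB _ (hz i); rlra.
  by rewrite /L; have := normr_ge0 (ln eta); have := ler_norm (ln (`|Lam| + B + 1)); rlra.
Qed.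

Lemma polar_thin (A S : set C) : polar A -> compact S -> S `<=` A -> thin S S.
Proof.
move=> pA cS SA; apply: compact_thin => // a Sa.
have [r [r0 [u [usub [z1 z1r uz1] uA]]]] := pA a.
exists (r / 2); first rlra.
apply: (@capacity_thin _ _ a r (r / 2) u z1) => //; [rlra|exact/ballCE| | |].
- have -> : [set z | S z /\ modc (z - a) <= r / 2] = S `&` [set z | modc (z - a) <= r / 2] by [].
  have cl := @closed_le R (fun z => modc (z - a)) (r / 2) (fun z => @cont_modcB R a z).
  exact: (compact_closedI cS cl).
- by move=> z [].
- move=> z [Sz zr]; split=> //; apply: uA; split; first exact: SA.
  by apply/ballCE; rlra.
Qed.

End Thin.

(** * Barrier at an essential singularity or pole *)

Section LogSums.
Variable R : realType.

Lemma sum_nonpos_le (F : nat -> R) (a b : nat) : (a <= b)%N ->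
  (forall k, (k < b)%N -> F k <= 0) -> \sum_(0 <= k < b) F k <= \sum_(0 <= k < a) F k.
Proof.
move=> ab hF; rewrite (@big_cat_nat _ _ _ a 0 b)//= gerDl big_nat.
by apply: sumr_le0 => k /andP[_ kb]; exact: hF.
Qed.

(** A weak form of Stirling's bound; the term [k = 0] counts as 0 because [ln 0 = 0]. *)
Lemma ln_fact_ge (N : nat) : N%:R * ln (N%:R : R) - N%:R <= \sum_(0 <= k < N.+1) ln (k%:R : R).
Proof.
elim: N => [|N IH]; first by rewrite big_nat1 mul0r subr0 ln0.
rewrite big_nat_recr//= {1 2 3}(_ : N.+1%:R = N%:R + 1 :> R) ?natr1//.
suff : N%:R * (ln (N.+1%:R : R) - ln (N%:R : R)) <= 1 by rewrite -natr1; rlra.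
case: N {IH} => [|N]; first by rewrite mul0r ler01.
have N0 : 0 < N.+1%:R :> R by rewrite ltr0n.
rewrite -ler_pdivlMl// mulr1.
have -> : ln (N.+2%:R : R) = ln ((1 + N.+1%:R^-1) * N.+1%:R).
  by congr ln; rewrite mulrDl mul1r mulVf ?gt_eqF// natr1.
rewrite lnM ?posrE ?addr_gt0 ?invr_gt0// addrK; apply: le_ln1Dx.
by apply: lt_trans (_ : 0 < _); [rlra|rewrite invr_gt0].
Qed.

(** A discrete lower bound for the integral of [ln |x - y|] over the unit interval: each side of [j]
    is bounded by a Stirling sum costing [N], and [i = j] contributes [ln 0 = 0]. *)
Lemma ln_dist_sum (N j : nat) : (j < N)%N ->
  - (2 * N%:R) <= \sum_(0 <= i < N) ln (`|i%:R - j%:R| / N%:R : R).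
Proof.
move=> jN; have N0 : 0 < N%:R :> R by rewrite ltr0n; exact: leq_ltn_trans jN.
pose F k := ln (k%:R / N%:R : R).
have F0 k : (k < N.+1)%N -> F k <= 0.
  by move=> kN; apply: ln_le0; rewrite ler_pdivrMr// mul1r ler_nat.
have S : - N%:R <= \sum_(0 <= k < N.+1) F k.
  have -> : \sum_(0 <= k < N.+1) F k = \sum_(0 <= k < N.+1) ln (k%:R : R) - N%:R * ln (N%:R : R).
    have e k : F k.+1 = ln (k.+1%:R : R) - ln (N%:R : R) by rewrite /F ln_div ?posrE ?ltr0Sn.
    rewrite !big_nat_recl//= (eq_bigr _ (fun k _ => e k)) sumrB sumr_const_nat subn0 mulr_natl.
    have F00 : F 0%N = 0 by rewrite /F mul0r ln0.
    by rewrite F00 (@ln0 _ 0)// !add0r.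
  by have := ln_fact_ge N; rlra.
rewrite (@big_cat_nat _ _ _ j 0 N)//=; last exact: ltnW.
have h1 : \sum_(0 <= k < N.+1) F k <= \sum_(0 <= i < j) ln (`|i%:R - j%:R| / N%:R : R).
  rewrite [leRHS]big_nat_rev/= (_ : \sum_(0 <= i < j) _ = \sum_(0 <= i < j) F i.+1).
    apply: le_trans (_ : \sum_(0 <= i < j.+1) F i <= _).
      by apply: sum_nonpos_le => //; exact: leqW.
    by rewrite big_nat_recl// /F mul0r ln0// add0r.
  rewrite !big_nat; apply: eq_bigr => i /andP[_ ij]; rewrite /F add0n distrC -natrB ?leq_subr//.
  by rewrite subKn// ger0_norm.
have h2 : \sum_(0 <= k < N.+1) F k <= \sum_(j <= i < N) ln (`|i%:R - j%:R| / N%:R : R).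
  rewrite -{1}[j]add0n big_addn (_ : \sum_(0 <= i < N - j) _ = \sum_(0 <= i < N - j) F i).
    by apply: sum_nonpos_le => //; apply: leqW; exact: leq_subr.
  by apply: eq_bigr => i _; rewrite /F natrD addrK ger0_norm.
rlra.
Qed.

End LogSums.

Section Barrier.
Variable R : realType.
Local Notation C := (Cplx R).

(* One point in each of [N] equally spaced circles of radius in [[s, 2s]]: away from the points
   their potential is as large as that of the equidistributed radii. *)
Lemma ring_potential_ge (b z : C) (s d : R) (N : nat) (zeta : 'I_N -> C) :
  0 < s -> s <= 1 -> 0 < d -> (0 < N)%N -> - ln d <= N%:R ->
  (forall i : 'I_N, modc (zeta i - b) = s + s * i%:R / N%:R) ->
  (forall i, d <= modc (z - zeta i)) ->
  ln s - 4 <= N%:R^-1 * \sum_i ln (modc (z - zeta i)).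
Proof.
move=> s0 s1 d0 N0 dN hr hd.
have NR : 0 < N%:R :> R by rewrite ltr0n.
rewrite ler_pdivlMl//.
pose rad (i : 'I_N) : R := s + s * i%:R / N%:R.
case: (@arg_minP _ _ _ (Ordinal N0) predT (fun i => `|modc (z - b) - rad i|) isT) => j _ hj.
(* As [rad j] is the radius closest to [|z - b|], the gap between [rad i] and [rad j] is at most
   twice the distance from [z] to [zeta i]. *)
have far (i : 'I_N) : s * `|i%:R - j%:R| / (2 * N%:R) <= modc (z - zeta i).
  have h1 : `|modc (z - b) - rad i| <= modc (z - zeta i).
    rewrite ler_norml /rad -hr; apply/andP; split.
      by have := ler_modc_dist (zeta i) z b; rewrite (modc_sym (zeta i) z); rlra.
    by have := ler_modc_dist z (zeta i) b; rlra.
  have h2 := hj i isT.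
  have h3 : `|rad i - rad j| <= `|modc (z - b) - rad i| + `|modc (z - b) - rad j|.
    have -> : rad i - rad j = (modc (z - b) - rad j) - (modc (z - b) - rad i) by ring.
    by apply: le_trans (ler_normB _ _) _; rewrite addrC.
  have h4 : rad i - rad j = s / N%:R * (i%:R - j%:R) by rewrite /rad; field; rewrite gt_eqF.
  move: h3; rewrite h4 normrM ger0_norm ?divr_ge0 ?(ltW s0)// => h3.
  have -> : s * `|i%:R - j%:R| / (2 * N%:R) = s / N%:R * `|i%:R - j%:R| / 2 by field; rewrite gt_eqF.
  rlra.
have s20 : 0 < s / 2 by rlra.
have ls : ln (s / 2) <= 0 by apply: ln_le0; rlra.
(* The nearest radius has no bound of this kind; its term is bounded by [ln d >= - N]. The 4 of the
   statement is 1 for this term, 2 for [ln_dist_sum] and 1 for [ln 2]. *)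
have term (i : 'I_N) : ln (s / 2) + ln (`|i%:R - j%:R| / N%:R) + (if i == j then - N%:R else 0) <= ln (modc (z - zeta i)).
  have zp : 0 < modc (z - zeta i) by exact: lt_le_trans d0 (hd i).
  case: eqVneq => [->|ij].
    have -> : ln (`|j%:R - j%:R| / N%:R) = 0 :> R by rewrite subrr normr0 mul0r ln0.
    have : ln d <= ln (modc (z - zeta j)) by rewrite ler_ln ?posrE//; exact: lt_le_trans (hd j).
    rlra.
  have ip : 0 < `|i%:R - j%:R| / N%:R :> R.
    by rewrite divr_gt0// normr_gt0 subr_eq0 eqr_nat.
  rewrite addr0 -lnM ?posrE// ler_ln ?posrE ?(mulr_gt0 s20 ip)//.
  apply: le_trans (far i); rewrite le_eqVlt; apply/orP; left; apply/eqP.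
  by field; rewrite gt_eqF.
have : \sum_(i < N) (ln (s / 2) + ln (`|i%:R - j%:R| / N%:R) + (if i == j then - N%:R else 0)) <=
   \sum_i ln (modc (z - zeta i)) by apply: ler_sum => i _; exact: term.
rewrite big_split/= -big_mkcond/= big_pred1_eq big_split/= sumr_const card_ord.
rewrite -[ln (s / 2) *+ N]mulr_natl.
have := @ln_dist_sum R N j (ltn_ord j); rewrite big_mkord.
have -> : ln (s / 2) = ln s - ln 2 by rewrite ln_div ?posrE.
have l2 : N%:R * ln 2 <= N%:R :> R by have := ler_pM2l NR (ln 2) 1; rewrite (@ln2_le1 R) mulr1.
rewrite !mulrBr; rlra.
Qed.

(** The distance [d] to the set where [|f| <= M] comes from uniform continuity of [|f|] on the
    annulus, so it does not depend on the points; [N] can be chosen after it, large enough for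
    [- ln d <= N]. *)
Lemma ring_points (f : C -> C) (b : C) (r M s t0 : R) : 0 < s -> 3 * s <= r -> 3 * s <= t0 ->
  (forall z, pball b r z -> hol f z) ->
  (forall t, 0 < t < t0 -> exists2 z, modc (z - b) = t & M + 1 <= modc (f z)) ->
  exists (N : nat) (zeta : 'I_N -> C) (d : R), [/\ (0 < N)%N, 0 < d & - ln d <= N%:R] /\
    [/\ forall i : 'I_N, modc (zeta i - b) = s + s * i%:R / N%:R,
      forall i, s <= modc (zeta i - b) < 2 * s &
      forall z, (modc (z - b) < r -> modc (f z) <= M) -> forall i, d <= modc (z - zeta i)].
Proof.
move=> s0 sr st hf ht.
have [d1 d10 hd1] := @unif_cont R _ (fun z => modc (f z)) 1 (@compact_annulus R b s (2 * s))
  (fun z (hz : s <= modc (z - b) <= 2 * s) => cont_modc (hol_cont (hf z (ltac:(by rewrite /pball; rlra))))) ltr01.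
have [d [d0 dd1 ds2]] : exists d : R, [/\ 0 < d, d <= d1 & d <= s / 2].
  exists (Num.min d1 (s / 2)); rewrite lt_min d10 ge_min lexx ge_min lexx orbT.
  by split=> //=; rlra.
have [N N0 dN] : exists2 N : nat, (0 < N)%N & - ln d <= N%:R.
  exists (Num.bound `|ln d|).+1 => //.
  have := archi_boundP (normr_ge0 (ln d)); have := ler_norm (- ln d); rewrite normrN -natr1; rlra.
have NR : 0 < N%:R :> R by rewrite ltr0n.
have rad (i : 'I_N) : 0 <= s * i%:R / N%:R < s.
  by rewrite divr_ge0 ?mulr_ge0 ?(ltW s0)//= ltr_pdivrMr// ltr_pM2l// ltr_nat.
have hz (i : 'I_N) : exists z, modc (z - b) = s + s * i%:R / N%:R /\ M + 1 <= modc (f z).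
  by have := rad i => h; have [|z ? ?] := ht (s + s * i%:R / N%:R); [rlra|exists z].
have [zeta hzeta] := choice hz.
have rz i : s <= modc (zeta i - b) < 2 * s by rewrite (hzeta i).1; have := rad i; rlra.
exists N, zeta, d; split=> //; split=> //; first by move=> i; rewrite (hzeta i).1.
move=> z hz' i; rewrite leNgt; apply/negP => hlt; have := rz i => /andP[rz1 rz2].
have /hz' fz : modc (z - b) < r by have := ler_modc_dist z (zeta i) b; rlra.
have := hd1 (zeta i) z (introT andP (conj rz1 (ltW rz2))) (lt_le_trans hlt dd1).
by have := (hzeta i).2; rewrite ltr_norml => h /andP[h' _]; rlra.
Qed.

Lemma csh_opp_potential (N : nat) (zeta : 'I_N -> C) (Q : R) (z : C) : (0 < N)%N -> 0 < Q ->
  (forall i, z != zeta i) ->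
  csh (fun z => - (1 + N%:R^-1 * \sum_i ln (modc (z - zeta i)) / Q)) z.
Proof.
move=> N0 Q0 hn.
have h : csh (fun z => Q^-1 * (N%:R^-1 * \sum_i - ln (modc (z - zeta i))) + -1) z.
  apply: csh_addc; apply: csh_scale; first by rewrite invr_gt0.
  apply: csh_scale; first by rewrite invr_gt0 ltr0n.
  by apply: (csh_sum _ (u := fun i z => - ln (modc (z - zeta i)))) => i; exact: csh_NlnB.
by apply: (csh_eq ltr01 _ h) => y _; rewrite -mulr_suml sumrN; ring.
Qed.

(* [1 + p / Q] for the potential [p] of points of [{|f| >= M + 1}] near [b] and [Q = 4 - ln s]. *)
Lemma barrier (f : C -> C) (b : C) (r M delta sigma : R) : 0 < r -> 0 < delta -> 0 < sigma ->
  (forall z, pball b r z -> hol f z) ->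
  (exists2 t0 : R, 0 < t0 & forall t, 0 < t < t0 -> exists2 z, modc (z - b) = t & M + 1 <= modc (f z)) ->
  exists (rho : R) (beta : C -> R), [/\ 0 < rho < sigma,
    forall z, (modc (z - b) < r -> modc (f z) <= M) -> csh (fun z => - beta z) z /\ 0 <= beta z,
    forall z, modc (z - b) <= rho -> beta z <= delta &
    forall z, sigma <= modc (z - b) -> 1 - delta <= beta z].
Proof.
move=> r0 de0 si0 hf [t0 t00 ht].
(* Taking [s <= expR (- X)] makes [Q = 4 - ln s] at least [X]. Near [b] the potential is at most
   [ln (3 * s)], so [beta <= 6 / Q <= delta]; beyond [sigma] it is at least [ln (sigma / 2)], so
   [beta >= 1 - delta]. *)
pose X := 6 / delta + `|ln (sigma / 2)| / delta.
have X6 : 6 / delta <= X by rewrite lerDl divr_ge0// ltW.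
have Xs : `|ln (sigma / 2)| / delta <= X by rewrite lerDr divr_ge0// ltW.
have X0 : 0 < X by apply: lt_le_trans X6; rewrite divr_gt0.
have [s [s0 sr st ssi sX]] : exists s : R, [/\ 0 < s, 3 * s <= r, 3 * s <= t0, 4 * s <= sigma & s <= expR (- X)].
  pose s := Num.min (Num.min (r / 3) (t0 / 3)) (Num.min (sigma / 4) (expR (- X))).
  have : 0 < s by rewrite !lt_min expR_gt0 !andbT; apply/andP; split; [apply/andP; split|]; rlra.
  have := lexx s; rewrite {2}/s !le_min => /andP[/andP[? ?] /andP[? ?]].
  by move=> ?; exists s; split=> //; rlra.
have lsX : X <= - ln s.
  have : ln s <= - X by rewrite -[leRHS](@expRK R) ler_ln ?posrE ?expR_gt0.
  rlra.
have s1 : s <= 1 by apply: le_trans sX _; rewrite -expR0 ler_expR; rlra.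
clearbody X.
have [N [zeta [d [[N0 d0 dN] [hr rz far]]]]] := ring_points s0 sr st hf ht.
pose p z := N%:R^-1 * \sum_i ln (modc (z - zeta i)).
have [Q QE] : exists Q, Q = 4 - ln s by exists (4 - ln s).
have Q0 : 0 < Q by rlra.
pose beta z := 1 + N%:R^-1 * \sum_i ln (modc (z - zeta i)) / Q.
have betaE z : beta z = (Q + p z) / Q.
  by rewrite /beta /p -mulr_suml mulrA mulrDl divff// gt_eqF.
have XQ : X <= Q by rlra.
exists (s / 2), beta; split.
- rlra.
- move=> z hz; have hf' := far z hz; split.
    apply: csh_opp_potential => // i.
    by rewrite -subr_eq0 -modc_gt0; exact: lt_le_trans d0 (hf' i).
  rewrite betaE divr_ge0 ?(ltW Q0)//.
  have : ln s - 4 <= p z by exact: (ring_potential_ge (b := b) s0 s1 d0 N0 dN hr hf').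
  rlra.
- move=> z hz; rewrite betaE.
  have : p z <= ln (3 * s).
    apply: avg_sum => // i; have := rz i => /andP[rz1 rz2].
    have h1 := ler_modc_dist (zeta i) z b; rewrite (modc_sym (zeta i) z) in h1.
    have h2 := ler_modc_dist z b (zeta i); rewrite (modc_sym b (zeta i)) in h2.
    by rewrite ler_ln ?posrE; rlra.
  rewrite lnM ?posrE// ler_pdivrMr//.
  have : ln 3 <= 2 :> R.
    have : ln 3 <= ln (2 * 2) :> R by rewrite ler_ln ?posrE; rlra.
    by rewrite lnM ?posrE//; have := @ln2_le1 R; rlra.
  have : 6 <= delta * Q by rewrite (mulrC delta) -ler_pdivrMr//; rlra.
  rlra.
- move=> z hz; rewrite betaE ler_pdivlMr// mulrBl mul1r.
  have : ln (sigma / 2) <= p z.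
    apply: sum_avg => // i; have := rz i => /andP[rz1 rz2].
    by have h1 := ler_modc_dist z (zeta i) b; rewrite ler_ln ?posrE; rlra.
  have : `|ln (sigma / 2)| <= delta * Q by rewrite (mulrC delta) -ler_pdivrMr//; rlra.
  by have := ler_norm (- ln (sigma / 2)); rewrite normrN; rlra.
Qed.

End Barrier.

(** * Plurisubharmonicity of continuous functions of two variables *)

Section TwoVariables.
Variable R : realType.
Local Notation C := (Cplx R).

(** Test polynomials are transported by the inverse affine map, with [e] divided by [|b|^2]; [b = 0]
    gives a constant function. *)
Lemma csh_affine (v : C -> R) (a b t0 : C) : csh v (a + t0 * b) -> csh (fun t => v (a + t * b)) t0.
Proof.
have [->|b0] := eqVneq b 0.
  move=> _; apply: (csh_eq ltr01 _ (csh_cst (v a) t0)) => t _; by rewrite mulr0 addr0.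
have mb : 0 < modc b by rewrite modc_gt0.
move=> [d d0 hd]; exists (d / modc b); first by rewrite divr_gt0.
move=> t ht.
have [|vc vt] := hd (a + t * b).
  by rewrite opprD addrACA subrr add0r -mulrBl modcM -ltr_pdivlMr.
split.
  apply/contP => e e0; have /contP/(_ e e0)[d1 d10 hd1] := vc.
  exists (d1 / modc b) => [|z hz]; first by rewrite divr_gt0.
  by apply: hd1; rewrite opprD addrACA subrr add0r -mulrBl modcM -ltr_pdivlMr.
move=> p e d' e0 d'0.
have pE y : (p \Po (b^-1 *: ('X - a%:P))).[y] = p.[b^-1 * (y - a)].
  by rewrite horner_comp hornerZ hornerXsubC.
have [|y hy hv] := vt (p \Po (b^-1 *: ('X - a%:P))) (e / modc b ^+ 2) (d' * modc b) _ (mulr_gt0 d'0 mb).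
  by rewrite divr_gt0// exprn_gt0.
have yE : a + (b^-1 * (y - a)) * b = y by rewrite mulrAC mulVf// mul1r addrC subrK.
have tE : b^-1 * (a + t * b - a) = t by rewrite addrAC subrr add0r mulrCA mulVf// mulr1.
have dE : modc (y - (a + t * b)) = modc (b^-1 * (y - a) - t) * modc b.
  by rewrite -modcM mulrBl mulrAC mulVf// mul1r opprD addrA.
exists (b^-1 * (y - a)); first by move: hy; rewrite dE ltr_pM2r.
move: hv; rewrite yE !pE tE dE exprMn [_ ^+ 2 * _]mulrC mulrA divfK//.
by rewrite expf_neq0// gt_eqF.
Qed.

Lemma csh_lnhol (m : R) (g : C -> C) (z0 : C) : 0 < m ->
  (exists2 d : R, 0 < d & forall z, modc (z - z0) < d -> hol g z) ->
  csh (fun z => lnk m (g z)) z0.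
Proof.
move=> m0 [d d0 hd].
have g0 : hol g z0 by apply: hd; rewrite subrr modc0.
have /contP gc := cont_modc (hol_cont g0).
have [gm|mg] := ltP (modc (g z0)) m.
  have [|d1 d10 hd1] := gc (m - modc (g z0)); first by rewrite subr_gt0.
  apply: (csh_eq d10 _ (csh_cst (ln m) z0)) => y /hd1; rewrite ltr_norml => /andP[_ h].
  by rewrite /lnk; congr ln; apply/esym/max_idPr; rlra.
have g0n : g z0 != 0 by rewrite -modc_gt0; exact: lt_le_trans mg.
have [|d1 d10 hd1] := gc (modc (g z0)); first by rewrite modc_gt0.
have hl : csh (fun z => ln (modc (g z))) z0 by apply: csh_lnabs => //; exists d.
apply: (csh_eq d10 _ (csh_max hl (csh_cst (ln m) z0))) => y /hd1; rewrite ltr_norml => /andP[h _].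
have yp : 0 < modc (g y) by rlra.
by rewrite /lnk; have [h'|h'] := leP (modc (g y)) m; [apply/max_idPr|apply/max_idPl];
  rewrite ler_ln ?posrE// ltW.
Qed.

Definition cont2 (V : C * C -> R) (q : C * C) := forall e : R, 0 < e -> exists2 d : R, 0 < d &
  forall p, modc (p.1 - q.1) < d -> modc (p.2 - q.2) < d -> `|V p - V q| < e.

(** Lines through [q] are tested at the parameter 0 only; [csh2_line] gives the other parameters by
    moving the base point. *)
Definition csh2 (V : C * C -> R) (q : C * C) := cont2 V q /\
  forall b, csh (fun t => V (cline q b t)) 0.

Lemma cline_close (q b : C * C) (d : R) : 0 < d -> exists2 d' : R, 0 < d' & forall t, modc (t - 0) < d' ->
  modc ((cline q b t).1 - q.1) < d /\ modc ((cline q b t).2 - q.2) < d.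
Proof.
move=> d0; pose k := modc b.1 + modc b.2 + 1.
have k0 : 0 < k by rewrite /k; have := modc_ge0 b.1; have := modc_ge0 b.2; rlra.
exists (d / k); first by rewrite divr_gt0.
move=> t; rewrite subr0 ltr_pdivlMr// => ht; rewrite /cline /= ![_ + _ * _ - _]addrAC !subrr !add0r !modcM.
have t0 := modc_ge0 t; have b1 := modc_ge0 b.1; have b2 := modc_ge0 b.2.
have h1 := mulr_ge0 t0 b1; have h2 := mulr_ge0 t0 b2.
have e : modc t * k = modc t * modc b.1 + modc t * modc b.2 + modc t by rewrite /k; ring.
by rewrite e in ht; rlra.
Qed.

Lemma csh2_eq (U V : C * C -> R) (q : C * C) (d : R) : 0 < d ->
  (forall p, modc (p.1 - q.1) < d -> modc (p.2 - q.2) < d -> U p = V p) -> csh2 U q -> csh2 V q.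
Proof.
move=> d0 hd [Uc Us]; split.
  move=> e e0; have [d1 d10 hd1] := Uc e e0.
  exists (Num.min d d1); first by rewrite lt_min d0.
  move=> p; rewrite !lt_min => /andP[p1 p1'] /andP[p2 p2'].
  by rewrite -!hd ?subrr ?modc0//; exact: hd1.
move=> b; have [d' d'0 hd'] := @cline_close q b d d0.
by apply: (csh_eq d'0 _ (Us b)) => t /hd'[h1 h2]; exact: hd.
Qed.

Lemma cont2_max U V q : cont2 U q -> cont2 V q -> cont2 (fun p => Num.max (U p) (V p)) q.
Proof.
move=> hU hV e e0; have [d d0 hd] := hU e e0; have [d' d'0 hd'] := hV e e0.
exists (Num.min d d'); first by rewrite lt_min d0.
move=> p; rewrite !lt_min => /andP[p1 p1'] /andP[p2 p2'].
have := hd p p1 p2; have := hd' p p1' p2'; rewrite !ltr_norml => /andP[? ?] /andP[? ?].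
by case: (leP (U p) (V p)) => ?; case: (leP (U q) (V q)) => ?; apply/andP; split; rlra.
Qed.

Lemma cont2_add U V q : cont2 U q -> cont2 V q -> cont2 (fun p => U p + V p) q.
Proof.
move=> hU hV e e0; have e2 : 0 < e / 2 by rlra.
have [d d0 hd] := hU _ e2; have [d' d'0 hd'] := hV _ e2.
exists (Num.min d d'); first by rewrite lt_min d0.
move=> p; rewrite !lt_min => /andP[p1 p1'] /andP[p2 p2'].
have := hd p p1 p2; have := hd' p p1' p2'; rewrite !ltr_norml => /andP[? ?] /andP[? ?].
by apply/andP; split; rlra.
Qed.

Lemma cont2_scale (c : R) V q : 0 < c -> cont2 V q -> cont2 (fun p => c * V p) q.
Proof.
move=> c0 hV e e0; have [|d d0 hd] := hV (e / c); first by rewrite divr_gt0.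
exists d => // p p1 p2; rewrite -mulrBr normrM (gtr0_norm c0) mulrC -ltr_pdivlMr//; exact: hd.
Qed.

Lemma cont2_comp (v : C -> R) (G : C * C -> C) q : {for G q, continuous v} ->
  (forall e : R, 0 < e -> exists2 d : R, 0 < d &
     forall p, modc (p.1 - q.1) < d -> modc (p.2 - q.2) < d -> modc (G p - G q) < e) ->
  cont2 (fun p => v (G p)) q.
Proof.
move=> /contP hv hG e e0; have [d d0 hd] := hv e e0; have [d' d'0 hd'] := hG d d0.
by exists d' => // p p1 p2; apply: hd; exact: hd'.
Qed.

Lemma csh2_max U V q : csh2 U q -> csh2 V q -> csh2 (fun p => Num.max (U p) (V p)) q.
Proof.
move=> [Uc Us] [Vc Vs]; split; first exact: cont2_max.
by move=> b; exact: (csh_max (Us b) (Vs b)).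
Qed.

Lemma csh2_add U V q : csh2 U q -> csh2 V q -> csh2 (fun p => U p + V p) q.
Proof.
move=> [Uc Us] [Vc Vs]; split; first exact: cont2_add.
by move=> b; exact: (csh_add (Us b) (Vs b)).
Qed.

Lemma csh2_scale (c : R) V q : 0 < c -> csh2 V q -> csh2 (fun p => c * V p) q.
Proof.
move=> c0 [Vc Vs]; split; first exact: cont2_scale.
by move=> b; exact: (csh_scale c0 (Vs b)).
Qed.

Lemma csh2_fst (v : C -> R) q : csh v q.1 -> csh2 (fun p => v p.1) q.
Proof.
move=> hv; split; first by apply: cont2_comp (csh_cont hv) _ => e e0; exists e.
by move=> b; apply: (@csh_affine v q.1 b.1 0); rewrite mul0r addr0.
Qed.

Lemma csh2_snd (v : C -> R) q : csh v q.2 -> csh2 (fun p => v p.2) q.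
Proof.
move=> hv; split; first by apply: cont2_comp (csh_cont hv) _ => e e0; exists e.
by move=> b; apply: (@csh_affine v q.2 b.2 0); rewrite mul0r addr0.
Qed.

Lemma csh2_cst (c : R) q : csh2 (fun=> c) q.
Proof. exact: (@csh2_fst (fun=> c) q (csh_cst c _)). Qed.

Lemma csh2_graph (m : R) (f : C -> C) q : 0 < m ->
  (exists2 d : R, 0 < d & forall z, modc (z - q.1) < d -> hol f z) ->
  csh2 (fun p => lnk m (p.2 - f p.1)) q.
Proof.
move=> m0 [d d0 hd]; split.
  have fc : {for q.1, continuous f} by apply: hol_cont; apply: hd; rewrite subrr modc0.
  apply: (@cont2_comp (lnk m) (fun p => p.2 - f p.1)).
    have := @cont_lnk R m 0 (q.2 - f q.1) m0.
    by rewrite (_ : (fun z => lnk m (z - 0)) = lnk m)//; apply: funext => z; rewrite subr0.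
  move=> e e0; have e2 : 0 < e / 2 by rlra.
  have /contCP/(_ _ e2)[d1 d10 hd1] := fc.
  exists (Num.min d1 (e / 2)); first by rewrite lt_min d10.
  move=> p; rewrite !lt_min => /andP[/hd1 p1 _] /andP[_ p2].
  have -> : p.2 - f p.1 - (q.2 - f q.1) = (p.2 - q.2) - (f p.1 - f q.1) by ring.
  by apply: le_lt_trans (ler_modcB _ _) _; rlra.
move=> b; have [d' d'0 hd'] := @cline_close q b d d0.
apply: (@csh_lnhol m (fun t => q.2 + t * b.2 - f (q.1 + t * b.1))) => //.
exists d' => // t ht; apply: holB.
  by apply: holD; [exact: hol_cst|apply: holM; [exact: hol_id|exact: hol_cst]].
by apply: hol_affine; apply: hd; have [] := hd' t ht.
Qed.

Lemma csh2_line (V : C * C -> R) (a b : C * C) (t0 : C) : csh2 V (cline a b t0) ->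
  csh (fun t => V (cline a b t)) t0.
Proof.
move=> [_ /(_ b) h].
have h' : csh (fun t => V (cline (cline a b t0) b t)) (- t0 + t0 * 1) by rewrite mulr1 addNr.
apply: (csh_eq ltr01 _ (csh_affine h')) => t _; rewrite /cline /=; congr (V (_, _));
  by rewrite mulr1 -addrA -mulrDl addrA subrr add0r.
Qed.

End TwoVariables.

(** * Local models near the graph *)

Section Inner.
Variable R : realType.
Local Notation C := (Cplx R).
Variable f : C -> C.

Definition holn (z : C) := exists2 d : R, 0 < d & forall y, modc (y - z) < d -> hol f y.

Lemma holn_cont z : holn z -> {for z, continuous f}.
Proof. by move=> [d d0 hd]; apply: hol_cont; apply: hd; rewrite subrr modc0. Qed.

(* [e ln(|w - f z| / K)] truncated below at the level -1. *)
Definition loggraph (e K : R) (p : C * C) : R :=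
  e * (lnk (K * expR (- e^-1)) (p.2 - f p.1) + - ln K).

Lemma csh2_loggraph e K q : 0 < e -> 0 < K -> holn q.1 -> csh2 (loggraph e K) q.
Proof.
move=> e0 K0 hq; apply: csh2_scale => //; apply: csh2_add; last exact: csh2_cst.
by apply: csh2_graph => //; rewrite mulr_gt0 ?expR_gt0.
Qed.

Lemma loggraph_le0 e K p : 0 < e -> 0 < K -> modc (p.2 - f p.1) <= K -> loggraph e K p <= 0.
Proof.
move=> e0 K0 h; rewrite /loggraph pmulr_rle0// subr_le0; apply: lnk_mono => //.
  by rewrite mulr_gt0 ?expR_gt0.
by rewrite ger_pMr// -expR0 ler_expR lerNl oppr0 invr_ge0 ltW.
Qed.

Lemma loggraph_ge e K p (eta : R) : 0 < e -> 0 < K -> 0 < eta -> eta <= modc (p.2 - f p.1) ->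
  e * (ln eta - ln K) <= loggraph e K p.
Proof.
move=> e0 K0 eta0 h; rewrite /loggraph ler_pM2l// lerD2r /lnk ler_ln ?posrE ?lt_max.
- by rewrite le_max h.
- by [].
- by rewrite (lt_le_trans eta0 h).
Qed.

Lemma loggraph_graph e K p : 0 < e -> 0 < K -> p.2 = f p.1 -> loggraph e K p = -1.
Proof.
move=> e0 K0 h; rewrite /loggraph h subrr /lnk modc0 (max_idPr _) ?mulr_ge0 ?expR_ge0 ?(ltW K0)//.
by rewrite lnM ?posrE ?expR_gt0// expRK addrAC subrr add0r mulrN mulfV// gt_eqF.
Qed.

(** [B] exceeds every [|w - f z|] in play, which gives the sign; the factor [tau / Y] is small
    enough for the loss at distance [eta] from the graph to be at most [tau]. *)
Lemma log_graph (M W tau eta : R) : 0 < M -> 0 < W -> 0 < tau -> 0 < eta ->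
  exists L : C * C -> R, [/\ forall q, holn q.1 -> csh2 L q,
    forall p, modc (f p.1) <= M -> modc p.2 < W -> L p <= 0,
    forall p, p.2 = f p.1 -> L p = -1 &
    forall p, eta <= modc (p.2 - f p.1) -> - tau <= L p].
Proof.
move=> M0 W0 tau0 eta0; pose B := M + W + 1.
have B0 : 0 < B by rewrite /B; rlra.
have lB : 0 <= ln B by apply: ln_ge0; rewrite /B; rlra.
pose Y := `|ln eta| + ln B + 1; have Y0 : 0 < Y by rewrite /Y; have := normr_ge0 (ln eta); rlra.
have e0 : 0 < tau / Y by rewrite divr_gt0.
exists (loggraph (tau / Y) B); split.
- by move=> q; exact: csh2_loggraph.
- move=> p fM pW; apply: loggraph_le0 => //; apply: le_trans (ler_modcB _ _) _.
  by rewrite /B; rlra.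
- by move=> p h; rewrite loggraph_graph.
- move=> p h; apply: le_trans (loggraph_ge e0 B0 eta0 h).
  rewrite mulrAC lerNl -mulNr ler_pdivrMr// -mulrN ler_pM2l// /Y.
  by have := ler_norm (- ln eta); rewrite normrN; rlra.
Qed.

Lemma inner_none (K : set C) (W delta eta : R) : compact K -> (forall z, K z -> holn z) ->
  0 < W -> 0 < delta -> 0 < eta ->
  exists Psi : C * C -> R, [/\ forall q, K q.1 -> csh2 Psi q,
    forall q, K q.1 -> modc q.2 < W -> Psi q <= 0,
    forall q, K q.1 -> q.2 = f q.1 -> Psi q <= -1 &
    forall q, K q.1 -> eta <= modc (q.2 - f q.1) -> - delta <= Psi q].
Proof.
move=> cK hK W0 d0 eta0.
have [M M0 hM] := @cont_bounded _ K (fun z => modc (f z)) cK (fun z hz => cont_modc (holn_cont (hK z hz))).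
have [L [cL L0 Lg Le]] := log_graph M0 W0 d0 eta0.
exists L; split=> q Kq.
- exact: cL (hK _ Kq).
- by apply: L0; exact: hM.
- by move=> h; rewrite Lg.
- exact: Le.
Qed.

(** The changes of formula are invisible: for [rho1 / 2 < |z - b| <= rho1] the weight [l] is below
    [- c], so the constant wins, and for [rho / 2 <= |z - b| < rho] the sum [Psi1 + l] is above
    [- c], so the maximum does nothing. *)
Definition gluept (Psi1 : C * C -> R) (l : C -> R) (b : C) (c rho rho1 : R) (p : C * C) : R :=
  if modc (p.1 - b) <= rho1 / 2 then - c else
  if modc (p.1 - b) < rho then Num.max (Psi1 p + l p.1) (- c) else Psi1 p + l p.1.

Lemma csh2_gluept (Psi1 : C * C -> R) (l : C -> R) (b : C) (K : set C) (W tau rho rho1 : R) :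
  0 < tau -> 0 < rho1 -> rho1 < rho / 2 ->
  (forall q, K q.1 -> q.1 != b -> modc q.2 < W -> csh2 Psi1 q) ->
  (forall z, z != b -> csh l z) ->
  (forall p, rho1 / 2 <= modc (p.1 - b) <= rho1 -> modc p.2 < W -> Psi1 p <= 0) ->
  (forall z, 0 < modc (z - b) <= rho1 -> l z <= - (3 * tau)) ->
  (forall p, modc (p.1 - b) <= rho -> modc p.2 < W -> - (2 * tau) <= Psi1 p) ->
  (forall z, rho / 2 <= modc (z - b) -> - tau <= l z) ->
  forall q, K q.1 -> modc q.2 < W -> csh2 (gluept Psi1 l b (3 * tau) rho rho1) q.
Proof.
move=> tau0 rho10 rho1s cPsi1 cl Psi1_le0 l_small Psi1_ge l_ge q Kq qW.
have qW' : 0 < W - modc q.2 by rewrite subr_gt0.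
have nearb z d y : modc (y - z) < d -> modc (z - b) - d < modc (y - b) < modc (z - b) + d.
  move=> h; have h1 := ler_modc_dist z y b; have h2 := ler_modc_dist y z b.
  by rewrite (modc_sym z y) in h1; rlra.
have nearW (p : C * C) : modc (p.2 - q.2) < W - modc q.2 -> modc p.2 < W.
  by have := ler_modc_sub p.2 q.2; rlra.
have [q1|q1] := ltP (modc (q.1 - b)) rho1.
  have dm : 0 < Num.min (rho1 - modc (q.1 - b)) (W - modc q.2) by rewrite lt_min qW' subr_gt0 q1.
  apply: (csh2_eq dm _ (csh2_cst (- (3 * tau)) q)) => p; rewrite !lt_min => /andP[p1 _] /andP[_ /nearW pW].
  have pr : modc (p.1 - b) < rho1 by have := nearb _ _ _ p1; rlra.
  rewrite /gluept; have [p1'|p1'] := leP (modc (p.1 - b)) (rho1 / 2); first by [].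
  have -> : modc (p.1 - b) < rho by rlra.
  apply/esym/max_idPr; have h1 := Psi1_le0 p ltac:(rlra) pW.
  by have := l_small p.1 ltac:(rlra); rlra.
have qb : q.1 != b by rewrite -subr_eq0 -modc_gt0; exact: lt_le_trans q1.
have cq : csh2 (fun p => Psi1 p + l p.1) q.
  apply: csh2_add; first exact: cPsi1.
  exact: csh2_fst (cl _ qb).
have [q2|q2] := ltP (modc (q.1 - b)) rho.
  have dm : 0 < Num.min (rho1 / 2) (rho - modc (q.1 - b)) by rewrite lt_min subr_gt0 q2 divr_gt0.
  apply: (csh2_eq dm _ (csh2_max cq (csh2_cst (- (3 * tau)) q))) => p; rewrite !lt_min => /andP[/nearb p1 /nearb p2] _.
  rewrite /gluept; have [p1'|p1'] := leP (modc (p.1 - b)) (rho1 / 2); first rlra.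
  by have -> : modc (p.1 - b) < rho by rlra.
have dm : 0 < Num.min (rho / 2) (W - modc q.2) by rewrite lt_min qW' andbT; rlra.
apply: (csh2_eq dm _ cq) => p; rewrite !lt_min => /andP[/nearb p1 _] /andP[_ /nearW pW].
rewrite /gluept; have [p1'|p1'] := leP (modc (p.1 - b)) (rho1 / 2); first rlra.
case: ltP => // p2; apply/esym/max_idPl.
by have := Psi1_ge p (ltW p2) pW; have := l_ge p.1 ltac:(rlra); rlra.
Qed.

(** [alpha] bounds the model from below where [|f|] is moderate. Where [|f|] is close to [M], a
    point with [w] in the box is far from the graph, so [L] already dominates [alpha] and dropping
    the maximum is invisible. *)
Definition maxlow (L : C * C -> R) (alpha : C -> R) (M : R) (p : C * C) : R :=
  if modc (f p.1) < M then Num.max (L p) (alpha p.1) else L p.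

Lemma csh2_maxlow (L : C * C -> R) (alpha : C -> R) (W tau : R) q : holn q.1 -> modc q.2 < W ->
  csh2 L q -> (forall z, modc (f z) <= W + 2 -> csh alpha z /\ alpha z <= - tau) ->
  (forall p, W + 1 <= modc (f p.1) -> modc p.2 < W -> - tau <= L p) ->
  csh2 (maxlow L alpha (W + 2)) q.
Proof.
move=> hq qW cL ha hL; have /contP fc := cont_modc (holn_cont hq).
have [fR|Rf] := ltP (modc (f q.1)) (W + 2).
  have [|d d0 hd] := fc (W + 2 - modc (f q.1)); first by rewrite subr_gt0.
  have [ca _] := ha q.1 (ltW fR).
  apply: (csh2_eq d0 _ (csh2_max cL (csh2_fst ca))) => p /hd + _.
  by rewrite /maxlow ltr_norml => /andP[_ h]; rewrite ifT//; rlra.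
have [d d0 hd] := fc 1 ltr01.
have dm : 0 < Num.min d (W - modc q.2) by rewrite lt_min d0 subr_gt0.
apply: (csh2_eq dm _ cL) => p; rewrite !lt_min => /andP[/hd p1 _] /andP[_ p2].
rewrite /maxlow; case: (ltP (modc (f p.1)) (W + 2)) => [pR|//].
have pW : modc p.2 < W by have := ler_modc_sub p.2 q.2; rlra.
have [_ a1] := ha p.1 (ltW pR).
apply/esym/max_idPl; apply: le_trans a1 _; apply: hL => //.
by move: p1; rewrite ltr_norml => /andP[h _]; rlra.
Qed.

(* A weight with a logarithmic pole at [b], negligible off the disc of radius [rho / 2]. *)
Lemma log_weight (b : C) (rho tau Dm : R) : 0 < rho -> 0 < tau -> rho < Dm ->
  exists (l : C -> R) (rho1 : R), [/\ 0 < rho1 < rho / 2, forall z, z != b -> csh l z,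
    forall z, 0 < modc (z - b) <= Dm -> l z <= 0,
    forall z, rho / 2 <= modc (z - b) -> - tau <= l z &
    forall z, 0 < modc (z - b) <= rho1 -> l z <= - (3 * tau)].
Proof.
move=> rho0 tau0 Dm0; have Dp : 0 < Dm by rlra.
have r20 : 0 < rho / 2 by rlra.
(* [l] is [kappa] times the logarithm of [|z - b| / Dm], with [kappa * Y = tau]: the drop is [tau]
   at radius [rho / 2] and [3 * tau] at radius [rho1 = Dm * expR (- (3 * Y))]. *)
pose Y := ln Dm - ln (rho / 2).
have Y0 : 0 < Y by rewrite subr_gt0 ltr_ln ?posrE; rlra.
pose kappa := tau / Y; have k0 : 0 < kappa by rewrite divr_gt0.
have kY : kappa * Y = tau by rewrite /kappa divfK// gt_eqF.
pose l z := kappa * (ln (modc (z - b)) + - ln Dm).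
pose rho1 := Dm * expR (- (3 * Y)).
have rho10 : 0 < rho1 by rewrite mulr_gt0// expR_gt0.
have rho1E : ln rho1 = ln Dm - 3 * Y by rewrite lnM ?posrE ?expR_gt0// expRK.
exists l, rho1; split.
- rewrite rho10 /= -ltr_ln ?posrE// rho1E.
  by rewrite /Y in Y0 *; rlra.
- by move=> z zb; apply: csh_scale => //; apply: csh_addc; exact: csh_lnB.
- by move=> z /andP[z0 zD]; rewrite /l pmulr_rle0// subr_le0 ler_ln ?posrE.
- move=> z h; rewrite -kY -mulrN /l ler_pM2l//.
  have : ln (rho / 2) <= ln (modc (z - b)) by rewrite ler_ln ?posrE//; exact: lt_le_trans h.
  by rewrite /Y; rlra.
- move=> z /andP[z0 zr]; have : ln (modc (z - b)) <= ln Dm - 3 * Y by rewrite -rho1E ler_ln ?posrE.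
  move=> h; have : l z <= kappa * - (3 * Y) by rewrite /l ler_pM2l//; rlra.
  by rewrite mulrN mulrCA kY.
Qed.

(** [alpha] stands for [- beta - tau] with [beta] the barrier. Close to [b] the model is at least
    [- 2 * tau], from [alpha] where [|f| < W + 2] and from [L] elsewhere, and the weight then lets
    the constant [- 3 * tau] take over across the fibre. *)
Lemma inner_point_glue (b : C) (K : set C) (W tau rho rho1 Dm sigma : R) (L : C * C -> R)
    (alpha l : C -> R) : 0 < W -> 0 < tau -> 0 < rho -> 0 < rho1 < rho / 2 -> rho < sigma ->
  (forall q, K q.1 -> q.1 != b -> csh2 L q) -> (forall z, K z -> z != b -> holn z) ->
  (forall z, K z -> modc (z - b) <= Dm) ->
  (forall z, modc (f z) <= W + 2 -> csh alpha z /\ alpha z <= - tau) ->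
  (forall z, modc (z - b) <= rho -> - (2 * tau) <= alpha z) ->
  (forall z, sigma <= modc (z - b) -> alpha z <= -1) ->
  (forall p, (K p.1 /\ rho1 / 2 <= modc (p.1 - b)) \/ rho1 / 2 <= modc (p.1 - b) <= rho1 ->
    modc p.2 < W -> L p <= 0) ->
  (forall p, p.2 = f p.1 -> L p = -1) ->
  (forall p, W + 1 <= modc (f p.1) -> modc p.2 < W -> - tau <= L p) ->
  (forall z, z != b -> csh l z) ->
  (forall z, 0 < modc (z - b) <= Dm -> l z <= 0) ->
  (forall z, rho / 2 <= modc (z - b) -> - tau <= l z) ->
  (forall z, 0 < modc (z - b) <= rho1 -> l z <= - (3 * tau)) ->
  let Psi := gluept (maxlow L alpha (W + 2)) l b (3 * tau) rho rho1 in
  [/\ forall q, K q.1 -> modc q.2 < W -> csh2 Psi q,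
    forall q, K q.1 -> modc q.2 < W -> Psi q <= 0,
    forall q, K q.1 -> sigma <= modc (q.1 - b) -> modc (f q.1) < W -> q.2 = f q.1 -> Psi q <= -1 &
    forall q, q.1 = b -> - (4 * tau) <= Psi q].
Proof.
move=> W0 tau0 rho0 /andP[rho10 rho1s] rs cL hK DmK ha a_near a_far L0 Lg Lge cl l0 lge lsmall Psi.
have P0 p : (K p.1 /\ rho1 / 2 <= modc (p.1 - b)) \/ rho1 / 2 <= modc (p.1 - b) <= rho1 ->
    modc p.2 < W -> maxlow L alpha (W + 2) p <= 0.
  move=> h pW; have h0 := L0 p h pW; rewrite /maxlow.
  case: (ltP (modc (f p.1)) (W + 2)) => [pR|//].
  by have [_ a1] := ha p.1 (ltW pR); rewrite ge_max h0; rlra.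
have Pge p : modc (p.1 - b) <= rho -> modc p.2 < W -> - (2 * tau) <= maxlow L alpha (W + 2) p.
  move=> h pW; rewrite /maxlow; case: (ltP (modc (f p.1)) (W + 2)) => pR.
    by rewrite le_max (a_near _ h) orbT.
  by apply: le_trans (Lge p _ pW); rlra.
have l_le0 z : K z -> rho1 / 2 < modc (z - b) -> l z <= 0.
  by move=> Kz h; apply: l0; rewrite (DmK _ Kz) andbT; rlra.
split.
- move=> q Kq qW; apply: (csh2_gluept tau0 rho10 rho1s _ cl _ lsmall Pge lge Kq qW).
    move=> p Kp pb pW; apply: (csh2_maxlow _ pW _ ha Lge); [exact: hK|exact: cL].
  by move=> p pr; apply: P0; right.
- move=> q Kq qW; rewrite /Psi /gluept.
  have [q1|q1] := leP (modc (q.1 - b)) (rho1 / 2); first rlra.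
  have h1 := P0 q (or_introl (conj Kq (ltW q1))) qW.
  have h2 := l_le0 _ Kq q1.
  have h3 : maxlow L alpha (W + 2) q + l q.1 <= 0 by rlra.
  by case: (ltP (modc (q.1 - b)) rho) => [_|//]; rewrite ge_max h3; rlra.
- move=> q Kq qs fW q2.
  have h2 : l q.1 <= 0 by apply: l_le0 => //; rlra.
  have h1 : maxlow L alpha (W + 2) q <= -1.
    rewrite /maxlow ifT; last rlra.
    by rewrite ge_max Lg// lexx/=; exact: a_far.
  rewrite /Psi /gluept ifF; last by apply/negbTE; rewrite -ltNge; rlra.
  by rewrite ifF; [rlra|apply/negbTE; rewrite -leNgt; rlra].
- by move=> q qb; rewrite /Psi /gluept qb subrr modc0 ifT; rlra.
Qed.

Lemma pball_holn (b : C) (r : R) z : (forall z, pball b r z -> hol f z) -> pball b r z -> holn z.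
Proof.
move=> hf /andP[z0 zr]; exists (Num.min (modc (z - b)) (r - modc (z - b))).
  by rewrite lt_min z0 subr_gt0.
move=> y; rewrite lt_min => /andP[y1 y2]; apply: hf; rewrite /pball.
have h1 := ler_modc_dist z y b; have h2 := ler_modc_dist y z b.
by rewrite (modc_sym z y) in h1; rlra.
Qed.

(** The levels of [|f|] are spaced by 1: at [W + 1] the graph is far from the box, at [W + 2] the
    maximum with the barrier is dropped, and at [W + 3] lie the poles of the barrier. *)
Lemma inner_point (b : C) (r : R) (K : set C) (W delta sigma : R) : 0 < r ->
  (forall z, pball b r z -> hol f z) ->
  (exists2 t0 : R, 0 < t0 & forall t, 0 < t < t0 -> exists2 z, modc (z - b) = t & W + 3 <= modc (f z)) ->
  compact K -> (forall z, K z -> z != b -> holn z) ->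
  0 < W -> 0 < delta -> 0 < sigma ->
  exists Psi : C * C -> R, [/\ forall q, K q.1 -> modc q.2 < W -> csh2 Psi q,
    forall q, K q.1 -> modc q.2 < W -> Psi q <= 0,
    forall q, K q.1 -> sigma <= modc (q.1 - b) -> modc (f q.1) < W -> q.2 = f q.1 -> Psi q <= -1 &
    forall q, q.1 = b -> - delta <= Psi q].
Proof.
move=> r0 hf ht cK hK W0 d0 si0.
have [tau [tau0 tau4]] : exists tau : R, 0 < tau /\ 4 * tau = delta.
  by exists (delta / 4); split; rlra.
have [sg [sg0 sgs sgr]] : exists sg : R, [/\ 0 < sg, sg <= sigma & sg <= r / 2].
  exists (Num.min sigma (r / 2)); rewrite ge_min lexx ge_min lexx orbT; split=> //.
  by rewrite lt_min si0; rlra.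
have ht' : exists2 t0 : R, 0 < t0 & forall t, 0 < t < t0 -> exists2 z, modc (z - b) = t & W + 2 + 1 <= modc (f z).
  by rewrite -addrA (_ : 2 + 1 = 3 :> R); last rlra.
have [rho [beta [/andP[rho0 rhos] bf bl bg]]] := @barrier R f b r (W + 2) tau sg r0 tau0 sg0 hf ht'.
have [D0 D00 hD0] := @cont_bounded _ K (fun z => modc (z - b)) cK (fun z _ => @cont_modcB R b z).
have [|l [rho1 [rho1s cl l0 lge lsmall]]] := @log_weight b rho tau (D0 + sg) rho0 tau0; first rlra.
have [rho10 rho12] := andP rho1s.
(* [f] is unbounded near [b], so [L] is made nonpositive only off the disc of radius [rho1 / 2]. The
   annulus is treated apart, since points near one of [K] may leave [K]. *)
have cK1 : compact (K `&` [set z | rho1 / 2 <= modc (z - b)]).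
  apply: compact_closedI => //.
  exact: (@closed_ge R (fun z => modc (z - b)) (rho1 / 2) (fun z => @cont_modcB R b z)).
have [|M1 M10 hM1] := @cont_bounded _ _ (fun z => modc (f z)) cK1.
  move=> z [/= Kz zr]; apply: cont_modc; apply: holn_cont; apply: hK => //.
  by rewrite -subr_eq0 -modc_gt0; rlra.
have [|M2 M20 hM2] := @cont_bounded _ _ (fun z => modc (f z)) (@compact_annulus R b (rho1 / 2) rho1).
  by move=> z /= /andP[z1 z2]; apply: cont_modc; apply: holn_cont; apply: (pball_holn hf); rewrite /pball; rlra.
have M0 : 0 < M1 + M2 by rlra.
have [L [cL L0 Lg Le]] := log_graph M0 W0 tau0 ltr01.
exists (gluept (maxlow L (fun z => - beta z + - tau) (W + 2)) l b (3 * tau) rho rho1).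
have := @inner_point_glue b K W tau rho rho1 (D0 + sg) sg L (fun z => - beta z + - tau) l W0 tau0 rho0 rho1s rhos.
move=> /(_ _ _ _ _ _ _ _ Lg _ cl l0 lge lsmall)/wrap[].
- by move=> q Kq qb; apply: cL; exact: hK.
- exact: hK.
- by move=> z /hD0; rlra.
- move=> z /(fun h => bf z (fun _ => h))[h1 h2]; split; last rlra.
  exact: csh_addc.
- by move=> z /bl; rlra.
- by move=> z /bg; rlra.
- move=> p h pW; apply: L0 => //.
  by case: h => [[Kp pr]|pr]; [have := hM1 _ (conj Kp pr)|have := hM2 _ pr]; rlra.
- move=> p h pW; apply: Le.
  by have := ler_modc_sub (f p.1) p.2; rewrite (modc_sym (f p.1)); rlra.
move=> /= [h1 h2 h3 h4]; split=> //; last by move=> q qb; rewrite -tau4; exact: h4.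
by move=> q Kq qs; apply: h3 => //; exact: le_trans qs.
Qed.

End Inner.

(** * Exhaustion of the domain and gluing *)

Section Outer.
Variable R : realType.
Local Notation C := (Cplx R).

Lemma nearest (F : set C) : closed F -> F !=set0 ->
  forall z, exists zeta, F zeta /\ forall zeta', F zeta' -> modc (z - zeta) <= modc (z - zeta').
Proof.
move=> cF [x Fx] z.
have cK : compact (F `&` [set y | modc (y - z) <= modc (x - z)]).
  apply: (@bounded_closed_compactC R _ (modc (x - z) + modc z)).
    apply: closedI => //.
    exact: (@closed_le R (fun y => modc (y - z)) (modc (x - z)) (fun y => @cont_modcB R z y)).
  by move=> y [_ /= h]; have := ler_modcD (y - z) z; rewrite subrK; rlra.
have c y : {for y, continuous (fun y => -1 * modc (y - z))}.
  by apply: cont_mul; [exact: cont_cst|exact: cont_modcB].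
have [|y [Fy /= yx] hy] := cont_max cK _ (fun y _ => c y); first by exists x; split => //=.
exists y; split=> // y' Fy'; rewrite !(modc_sym z).
have [h|h] := leP (modc (y' - z)) (modc (x - z)); last rlra.
by have := hy y' (conj Fy' h); rlra.
Qed.

Definition inner_set (D : set C) (n : R) (z : C) :=
  modc z <= n /\ forall zeta, ~ D zeta -> n^-1 <= modc (z - zeta).

(** The maximum of the positive part of [ln (|z| / n)] and, if [D] is not the plane, of
    [- ln (n * dist)], where [dist] is the distance to the complement of [D]. *)
Lemma exhaustion (D : set C) (n : R) : open D -> 0 < n ->
  exists ex : C -> R, [/\ forall z, D z -> csh ex z, forall z, 0 <= ex z,
    forall z, inner_set D n z -> ex z = 0 &
    forall e, compact [set z | D z /\ ex z <= e]].
Proof.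
move=> oD n0; pose v1 (z : C) := lnk n (z - 0) + - ln n.
have c1 z : csh v1 z by apply: csh_addc; exact: csh_lnk.
have v1_ge0 z : 0 <= v1 z.
  by rewrite /v1 subr_ge0 /lnk ler_ln ?posrE ?lt_max ?n0 ?orbT// le_max lexx orbT.
have v1_0 z : modc z <= n -> v1 z = 0.
  by move=> zn; rewrite /v1 /lnk subr0 (max_idPr zn) subrr.
have v1_bd z e : v1 z <= e -> modc z <= n * expR e.
  rewrite /v1 /lnk subr0 lerBlDr => h.
  have : ln (Num.max (modc z) n) <= ln (n * expR e) by rewrite lnM ?posrE ?expR_gt0// expRK addrC.
  rewrite ler_ln ?posrE ?lt_max ?n0 ?orbT ?mulr_gt0 ?expR_gt0// ge_max => /andP[]//.
have [hD|/existsNP[x0 Dx0]] := pselect (forall z, D z).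
  exists v1; split=> //; first by move=> z [/v1_0].
  move=> e; apply: (@bounded_closed_compactC R _ (n * expR e)); last by move=> z [_ /v1_bd].
  have -> : [set z | D z /\ v1 z <= e] = [set z | v1 z <= e].
    by apply/seteqP; split=> z /=; [case|move=> h; split].
  exact: (@closed_le R v1 e (fun z => csh_cont (c1 z))).
have cF : closed (~` D) by apply: open_closedC.
have [nr hnr] := choice (nearest cF (ex_intro _ x0 Dx0)).
pose dD z := modc (z - nr z).
have dD_le z zeta : ~ D zeta -> dD z <= modc (z - zeta) by move=> h; exact: (hnr z).2.
have dD_gt0 z : D z -> 0 < dD z.
  move=> Dz; rewrite modc_gt0 subr_eq0; apply/eqP => zE.
  by have := (hnr z).1; rewrite -zE; apply.
have dD_lip y z : `|dD y - dD z| <= modc (y - z).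
  have h1 := dD_le y _ (hnr z).1; have h2 := dD_le z _ (hnr y).1.
  have h3 := ler_modc_dist y z (nr z); have h4 := ler_modc_dist z y (nr y).
  rewrite (modc_sym z y) in h4; rewrite ler_norml /dD in h1 h2 *; apply/andP; split; rlra.
have dD_cont z : {for z, continuous dD}.
  by apply/contP => e e0; exists e => // y; exact: le_lt_trans.
pose v2 z := -1 * ln (dD z) + - ln n.
have c2 z : D z -> csh v2 z.
  move=> Dz; apply: csh_addc; have [d d0 hd] := (openCP D).1 oD _ Dz.
  exists d => // y /hd Dy; split.
    by apply: cont_mul; [exact: cont_cst|apply: cont_ln; [exact: dD_gt0|exact: dD_cont]].
  have yn : y != nr y by rewrite -subr_eq0 -modc_gt0; exact: dD_gt0.
  (* Minus the logarithm of the distance is touched from below at [y] by the harmonic function given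
     by the nearest complement point [nr y]. *)
  apply: (tst_ge (dD_gt0 _ Dy) _ _ (csh_tst (csh_NlnB yn))); last by rewrite mulN1r.
  move=> x xy; rewrite mulN1r lerN2; have xp : 0 < modc (x - nr y).
    by have := ler_modc_dist y x (nr y); rewrite (modc_sym y x) -/(dD y); rlra.
  have Dx : D x.
    by apply: contrapT => Dx; have := dD_le y x Dx; rewrite (modc_sym y) leNgt xy.
  by rewrite ler_ln ?posrE ?dD_gt0//; apply: dD_le; exact: (hnr y).1.
exists (fun z => Num.max (v1 z) (v2 z)); split.
- by move=> z Dz; apply: csh_max; [exact: c1|exact: c2].
- by move=> z; rewrite le_max v1_ge0.
- move=> z [z1 z2]; rewrite v1_0//; apply/max_idPl; rewrite /v2 mulN1r.
  have : n^-1 <= dD z by exact: z2 (hnr z).1.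
  move=> h; have : ln n^-1 <= ln (dD z).
    by rewrite ler_ln ?posrE ?invr_gt0//; apply: lt_le_trans h; rewrite invr_gt0.
  by rewrite lnV ?posrE//; rlra.
- move=> e; apply: (@bounded_closed_compactC R _ (n * expR e)); last first.
    by move=> z [_]; rewrite ge_max => /andP[/v1_bd].
  apply: closedCP => z nz; have [Dz|Dz] := pselect (D z).
    have ez : e < Num.max (v1 z) (v2 z) by rewrite ltNge; apply/negP => h; apply: nz.
    have /contP/(_ (Num.max (v1 z) (v2 z) - e)) := csh_cont (csh_max (c1 z) (c2 z Dz)).
    case; first by rewrite subr_gt0.
    move=> d d0 hd; exists d => // y /hd; rewrite ltr_norml => /andP[h _] [_ h']; rlra.
  exists (expR (- (e + ln n))); first exact: expR_gt0.
  move=> y yz [Dy]; rewrite ge_max => /andP[_]; rewrite /v2 mulN1r => h.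
  have h1 := dD_le y z Dz; have h2 := dD_gt0 y Dy.
  have : ln (dD y) < - (e + ln n) by rewrite -[ltRHS]expRK ltr_ln ?posrE ?expR_gt0//; exact: le_lt_trans h1 yz.
  rlra.
Qed.

Lemma csh_open (v : C -> R) z : csh v z -> forall c, v z < c ->
  exists2 d : R, 0 < d & forall y, modc (y - z) < d -> v y < c.
Proof.
move=> /csh_cont /contP hv c vc; have [|d d0 hd] := hv (c - v z); first by rewrite subr_gt0.
by exists d => // y /hd; rewrite ltr_norml => /andP[_]; rlra.
Qed.

Lemma csh_open' (v : C -> R) z : csh v z -> forall c, c < v z ->
  exists2 d : R, 0 < d & forall y, modc (y - z) < d -> c < v y.
Proof.
move=> /csh_cont /contP hv c vc; have [|d d0 hd] := hv (v z - c); first by rewrite subr_gt0.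
by exists d => // y /hd; rewrite ltr_norml => /andP[+ _]; rlra.
Qed.

Definition outer_dom (D : set C) (ex g : C -> R) (W : R) (p : C * C) :=
  [/\ D p.1, ex p.1 < 1, modc p.2 < W & -3 < g p.1].

(** It equals -1 on the box and, for the [k] chosen later, exceeds 1 near [ex = 1] and near
    [|w| = n + 1], where [Psi + g <= 1]. Where [g < -2] its lower bound -1 already suffices. *)
Definition outer_floor (ex : C -> R) (n k : R) (p : C * C) : R :=
  -1 + (4 * ex p.1 + k * (lnk n (p.2 - 0) + - ln n)).

Lemma outer_floor_csh2 (ex : C -> R) (n k : R) q : 0 < n -> 0 < k -> csh ex q.1 ->
  csh2 (outer_floor ex n k) q.
Proof.
move=> n0 k0 ce; apply: csh2_add; first exact: csh2_cst.
apply: csh2_add; first by apply: csh2_scale => //; exact: csh2_fst.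
apply: csh2_scale => //; apply: (@csh2_snd _ (fun w => lnk n (w - 0) + - ln n)).
by apply: csh_addc; exact: csh_lnk.
Qed.

Lemma outer_dom_open (D : set C) (ex g : C -> R) (W : R) q : open D ->
  (forall z, D z -> csh ex z) -> (forall z, csh g z) -> outer_dom D ex g W q ->
  exists2 d : R, 0 < d & forall p, modc (p.1 - q.1) < d -> modc (p.2 - q.2) < d -> outer_dom D ex g W p.
Proof.
move=> oD ce cg [Dq eq Wq gq].
have [d1 d10 hd1] := (openCP D).1 oD _ Dq.
have [d2 d20 hd2] := csh_open (ce _ Dq) eq.
have [d3 d30 hd3] := csh_open' (cg q.1) gq.
exists (Num.min (Num.min d1 d2) (Num.min d3 (W - modc q.2))).
  by rewrite !lt_min d10 d20 d30 subr_gt0.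
move=> p; rewrite !lt_min => /andP[/andP[/hd1 p1 /hd2 p2] /andP[/hd3 p3 _]] /andP[_ /andP[_ pW]].
by split=> //; have := ler_modc_sub p.2 q.2; rlra.
Qed.

(* Off its domain the glued function is locally equal to the floor, which dominates there. *)
Lemma outer_floor_ge (D : set C) (ex g : C -> R) (n : R) (Psi : C * C -> R) q : 0 < n ->
  (forall z, D z -> csh ex z) -> (forall z, 0 <= ex z) -> (forall z, csh g z) ->
  (forall z, D z -> ex z <= 1 -> g z <= 1) ->
  (forall p, outer_dom D ex g (n + 1) p -> Psi p <= 0) ->
  D q.1 -> ~ outer_dom D ex g (n + 1) q ->
  exists2 d : R, 0 < d & forall p, modc (p.1 - q.1) < d -> modc (p.2 - q.2) < d ->
    outer_dom D ex g (n + 1) p -> Psi p + g p.1 <= outer_floor ex n (4 / (ln (n + 1) - ln n)) p.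
Proof.
move=> n0 ce ex0 cg g1 hPsi Dq nq.
have ln0 : 0 < ln (n + 1) - ln n by rewrite subr_gt0 ltr_ln ?posrE; rlra.
set k := 4 / _; have k0 : 0 < k by rewrite divr_gt0.
have kE : k * (ln (n + 1) - ln n) = 4 by rewrite /k divfK// gt_eqF.
clearbody k.
have w0 w : 0 <= k * (lnk n (w - 0) + - ln n).
  by rewrite mulr_ge0 ?(ltW k0)// subr_ge0 /lnk ler_ln ?posrE ?lt_max ?n0 ?orbT// le_max lexx orbT.
have [eq|eq] := ltP (ex q.1) 1; last first.
  have e2 : 2^-1 < ex q.1 by rlra.
  have [d d0 hd] := csh_open' (ce _ Dq) e2.
  exists d => // p /hd pe _ dp; have := hPsi p dp; have := g1 p.1; case: dp => Dp ep _ _ /(_ Dp (ltW ep)).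
  by move: (w0 p.2) pe; rewrite /outer_floor; clear; move: (k * _) => x; rlra.
have [qW|qW] := ltP (modc q.2) (n + 1); last first.
  have cw : csh (fun w => k * (lnk n (w - 0) + - ln n)) q.2.
    by apply: csh_scale => //; apply: csh_addc; exact: csh_lnk.
  have w2 : 2 < k * (lnk n (q.2 - 0) + - ln n).
    apply: lt_le_trans (_ : k * (ln (n + 1) - ln n) <= _); first by rewrite kE; rlra.
    rewrite ler_pM2l// lerD2r /lnk subr0 ler_ln ?posrE ?lt_max ?n0 ?orbT//; last rlra.
    by rewrite le_max qW.
  have [d d0 hd] := csh_open' cw w2.
  exists d => // p _ /hd pe dp; have := hPsi p dp; have := g1 p.1; case: dp => Dp ep _ _ /(_ Dp (ltW ep)).
  by move: (ex0 p.1) pe; rewrite /outer_floor; clear; move: (k * _) => x; rlra.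
have gq : g q.1 < -2 by rewrite ltNge; apply/negP => h; apply: nq; split => //; rlra.
have [d d0 hd] := csh_open (cg q.1) gq.
exists d => // p /hd pe _ dp; have := hPsi p dp.
by move: (ex0 p.1) (w0 p.2) pe; rewrite /outer_floor; clear; move: (k * _) => x; rlra.
Qed.

Lemma outer (D : set C) (ex g : C -> R) (n : R) (Psi : C * C -> R) : 0 < n -> open D ->
  (forall z, D z -> csh ex z) -> (forall z, 0 <= ex z) -> (forall z, csh g z) ->
  (forall z, D z -> ex z <= 1 -> g z <= 1) ->
  (forall p, outer_dom D ex g (n + 1) p -> csh2 Psi p /\ Psi p <= 0) ->
  exists psi : C * C -> R, [/\ forall q, D q.1 -> csh2 psi q, forall q, -1 <= psi q &
    forall q, D q.1 -> ex q.1 = 0 -> modc q.2 <= n ->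
      psi q = if -3 < g q.1 then Num.max (Psi q + g q.1) (-1) else -1].
Proof.
move=> n0 oD ce ex0 cg g1 hPsi.
have ln0 : 0 < ln (n + 1) - ln n by rewrite subr_gt0 ltr_ln ?posrE; rlra.
have := outer_floor_ge n0 ce ex0 cg g1 (fun p dp => (hPsi p dp).2).
set k := 4 / _; have k0 : 0 < k by rewrite divr_gt0.
clearbody k => hfl.
have fl1 p : -1 <= outer_floor ex n k p.
  rewrite /outer_floor lerDl addr_ge0 ?mulr_ge0 ?(ltW k0)// subr_ge0 /lnk.
  by rewrite ler_ln ?posrE ?lt_max ?n0 ?orbT// le_max lexx orbT.
pose psi p := if pselect (outer_dom D ex g (n + 1) p) then Num.max (Psi p + g p.1) (outer_floor ex n k p)
  else outer_floor ex n k p.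
exists psi; split.
- move=> q Dq; have cf : csh2 (outer_floor ex n k) q by apply: outer_floor_csh2 => //; exact: ce.
  have [dq|dq] := pselect (outer_dom D ex g (n + 1) q).
    have [d d0 hd] := outer_dom_open oD ce cg dq.
    have cP : csh2 (fun p => Psi p + g p.1) q.
      by apply: csh2_add; [exact: (hPsi q dq).1|exact: csh2_fst].
    apply: (csh2_eq d0 _ (csh2_max cP cf)) => p p1 p2.
    by rewrite /psi; case: pselect => [//|np]; case: (np (hd p p1 p2)).
  have [d d0 hd] := hfl q Dq dq.
  apply: (csh2_eq d0 _ cf) => p p1 p2; rewrite /psi; case: pselect => // dp.
  by apply/esym/max_idPr; exact: hd.
- by move=> p; rewrite /psi; case: pselect => [dp|dp] /=; rewrite ?le_max ?fl1 ?orbT.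
- move=> q Dq eq qn.
  have fq : outer_floor ex n k q = -1.
    by rewrite /outer_floor eq /lnk subr0 (max_idPr qn) subrr !mulr0 addr0 addr0.
  rewrite /psi fq; case: ltP => gq; case: pselect => // dq.
    by exfalso; apply: dq; split=> //; [rewrite eq ltr01|rlra].
  by exfalso; case: dq => _ _ _; rewrite ltNge gq.
Qed.

Definition box (D : set C) (n : R) (q : C * C) := inner_set D n q.1 /\ modc q.2 <= n.

Lemma inner_setD (D : set C) (n : R) z : 0 < n -> inner_set D n z -> D z.
Proof.
move=> n0 [_ h]; apply: contrapT => /h; rewrite subrr modc0 leNgt.
by rewrite invr_gt0 n0.
Qed.

Lemma compact_relclosed (D A' : set C) (ex : C -> R) :
  (forall e, compact [set z | D z /\ ex z <= e]) ->
  (forall z, D z -> ~ A' z -> exists2 d : R, 0 < d & forall y, modc (y - z) < d -> ~ A' y) ->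
  compact [set z | [/\ D z, ex z <= 1 & A' z]].
Proof.
move=> cex nA; have [B _ hB] := cont_bounded (cex 1) (fun z _ => cont_modc (@hol_cont R id z (hol_id z))).
apply: (@bounded_closed_compactC R _ B); last by move=> z [Dz ez _]; exact: hB.
have cl : closed [set z : C | D z /\ ex z <= 1] by apply: compact_closed => //; exact: norm_hausdorff.
apply: closedCP => z hz; have [Kz|Kz] := pselect (D z /\ ex z <= 1).
  have nz : ~ A' z by move=> Az; apply: hz; case: Kz.
  have [d d0 hd] := nA z Kz.1 nz.
  by exists d => // y /hd nAy [].
have oz : open (~` [set z : C | D z /\ ex z <= 1]) by rewrite openC.
have [d d0 hd] := (openCP _).1 oz z Kz.
by exists d => // y /hd nK [? ? _]; apply: nK.
Qed.

(** [K] depends on the potential [g], so the inner model is asked for on every compact set avoiding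
    [A']; [Q] carries the properties special to each model. [A'] will be [A], or [A] without one
    point of [B]. *)
Lemma step_gen (D A' : set C) (n delta eta : R) (Q : set C -> (C * C -> R) -> Prop) :
  0 < n -> 0 < delta <= 1 -> 0 < eta -> open D ->
  (forall S, compact S -> S `<=` D `&` A' -> thin S S) ->
  (forall z, D z -> ~ A' z -> exists2 d : R, 0 < d & forall y, modc (y - z) < d -> ~ A' y) ->
  (forall K, compact K -> K `<=` D -> (forall z, K z -> ~ A' z) ->
    exists Psi, [/\ forall q, K q.1 -> modc q.2 < n + 1 -> csh2 Psi q,
      forall q, K q.1 -> modc q.2 < n + 1 -> Psi q <= 0 & Q K Psi]) ->
  exists (psi : C * C -> R) (K : set C) (Psi : C * C -> R),
    [/\ forall q, D q.1 -> csh2 psi q, forall q, -1 <= psi q & Q K Psi] /\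
    [/\ forall q, box D n q -> psi q <= delta,
      forall q, box D n q -> A' q.1 -> psi q <= -1,
      forall q, box D n q -> (K q.1 -> Psi q <= -1) -> psi q <= -1 + delta &
      forall q, box D n q -> (forall a, A' a -> eta <= modc (q.1 - a)) -> K q.1 /\ Psi q - delta <= psi q].
Proof.
move=> n0 /andP[d0 d1] eta0 oD thinA nA hPsi.
have [ex [cex ex0 exin excpt]] := exhaustion oD n0.
pose S := [set z | [/\ D z, ex z <= 1 & A' z]].
have cS : compact S by exact: compact_relclosed.
have [B _ hB] := cont_bounded (excpt 1) (fun z _ => cont_modc (@hol_cont R id z (hol_id z))).
(* The depth 4 puts the singular part strictly below the cut at -3, so that [K] avoids [A']. *)
have [|g [cg gS gfar gup]] := thinA S cS _ 4 delta eta B d0 eta0; first by move=> z [].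
have gup' z : D z -> ex z <= 1 -> g z <= delta by move=> Dz ez; apply: gup; exact: hB.
pose K := [set z | D z /\ ex z <= 1] `&` [set z | -3 <= g z].
have cK : compact K.
  apply: compact_closedI => //.
  exact: (@closed_ge R g (-3) (fun z => csh_cont (cg z))).
have KA z : K z -> ~ A' z.
  move=> [[Dz ez] /= gz] Az; have : g z <= - 4 by apply: gS; [split|exact: hB].
  by rlra.
have [Psi [cPsi Psi0 QK]] := hPsi K cK (fun z hz => hz.1.1) KA.
have domK p : outer_dom D ex g (n + 1) p -> K p.1 /\ modc p.2 < n + 1.
  by move=> [Dp ep Wp gp]; split=> //; split; [split=> //; exact: ltW|exact: ltW].
have [||psi [cpsi psi1 psiE]] := @outer D ex g n Psi n0 oD cex ex0 cg.
- by move=> z Dz ez; apply: le_trans (gup' z Dz ez) d1.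
- by move=> p /domK[Kp Wp]; split; [exact: cPsi|exact: Psi0].
exists psi, K, Psi; split=> //.
have boxE q : box D n q -> [/\ D q.1, ex q.1 = 0, g q.1 <= delta, modc q.2 < n + 1 &
    psi q = if -3 < g q.1 then Num.max (Psi q + g q.1) (-1) else -1].
  move=> [hq qn]; have Dq := inner_setD n0 hq; have eq := exin _ hq; split=> //; last exact: psiE.
    by apply: gup' => //; rewrite eq ler01.
  by rlra.
have boxK q : box D n q -> -3 < g q.1 -> K q.1.
  by move=> /boxE[Dq eq _ _ _] gq; split; [split; rewrite ?eq ?ler01|exact: ltW].
have dm : -1 <= delta by rlra.
split.
- move=> q bq; have [Dq eq gq Wq ->] := boxE q bq; have [g3|g3] := ltP (-3) (g q.1) => //.
  have := Psi0 q (boxK q bq g3) Wq; rewrite ge_max dm andbT; rlra.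
- move=> q bq Aq; have [Dq eq gq Wq ->] := boxE q bq; have [g3|//] := ltP (-3) (g q.1).
  by case: (KA _ (boxK q bq g3) Aq).
- move=> q bq hq; have [Dq eq gq Wq ->] := boxE q bq; have [g3|g3] := ltP (-3) (g q.1); last rlra.
  by rewrite ge_max; have := hq (boxK q bq g3) => h; apply/andP; split; rlra.
- move=> q bq hq; have [Dq eq gq Wq ->] := boxE q bq.
  have gd : - delta <= g q.1 by apply: gfar => s [_ _ As]; exact: hq.
  have g3 : -3 < g q.1 by rlra.
  by split; [exact: boxK|rewrite g3 le_max; apply/orP; left; rlra].
Qed.

End Outer.

(** * The summands *)

Section Steps.
Variable R : realType.
Local Notation C := (Cplx R).
Variables (D A : set C) (f : C -> C).

Definition step_for (n delta : R) (E : C * C -> Prop) (psi : C * C -> R) :=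
  [/\ forall q, D q.1 -> csh2 psi q, forall q, -1 <= psi q,
    forall q, box D n q -> psi q <= delta &
    forall q, box D n q -> E q -> psi q <= -1 + delta].

Lemma step_for_max n delta E psi1 psi2 : step_for n delta E psi1 -> step_for n delta E psi2 ->
  step_for n delta E (fun q => Num.max (psi1 q) (psi2 q)).
Proof.
move=> [c1 l1 u1 e1] [c2 l2 u2 e2]; split.
- by move=> q Dq; apply: csh2_max; [exact: c1|exact: c2].
- by move=> q; rewrite le_max l1.
- by move=> q bq; rewrite ge_max u1// u2.
- by move=> q bq Eq; rewrite ge_max e1// e2.
Qed.

Lemma step_none (n delta eta : R) : 0 < n -> 0 < delta <= 1 -> 0 < eta -> open D -> polar A ->
  (forall z, D z -> ~ A z -> exists2 d : R, 0 < d & forall y, modc (y - z) < d -> ~ A y) ->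
  (forall z, D z -> ~ A z -> holn f z) ->
  exists psi, step_for n delta (fun q => A q.1 \/ q.2 = f q.1) psi /\
    forall q, box D n q -> (forall a, A a -> eta <= modc (q.1 - a)) -> eta <= modc (q.2 - f q.1) ->
      - (2 * delta) <= psi q.
Proof.
move=> n0 d01 eta0 oD pA nA hf; have d0 : 0 < delta by case/andP: d01.
have n10 : 0 < n + 1 by rlra.
have [|K cK KD KA|psi [K [Psi [[cpsi lpsi [gPsi fPsi]] [upsi apsi epsi lopsi]]]]] :=
  @step_gen R D A n delta eta (fun K Psi =>
  (forall q, K q.1 -> q.2 = f q.1 -> Psi q <= -1) /\
  (forall q, K q.1 -> eta <= modc (q.2 - f q.1) -> - delta <= Psi q)) n0 d01 eta0 oD _ nA.
- by move=> S cS SA; apply: (@polar_thin _ A) => // z /SA[].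
- have [Psi [cPsi uPsi gPsi fPsi]] := @inner_none R f K (n + 1) delta eta cK (fun z hz => hf z (KD z hz) (KA z hz)) n10 d0 eta0.
  by exists Psi; split=> // q /cPsi.
exists psi; split; first split=> //.
- move=> q bq [Aq|qf]; first by have := apsi q bq Aq; rlra.
  by apply: epsi => // Kq; exact: gPsi.
- move=> q bq qa qe; have [Kq h] := lopsi q bq qa.
  by have := fPsi q Kq qe; rlra.
Qed.

(** [b] is left out of the singular set, so that [K] may contain it and [inner_point] applies. The
    radius [r] serves as [eta], since no other point of [A] is within [r] of [b]. *)
Lemma step_point (b : C) (r n delta sigma : R) : 0 < n -> 0 < delta <= 1 -> 0 < sigma -> open D -> polar A ->
  (forall z, D z -> ~ A z -> exists2 d : R, 0 < d & forall y, modc (y - z) < d -> ~ A y) ->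
  (forall z, D z -> ~ A z -> holn f z) ->
  D b -> 0 < r -> (forall z, pball b r z -> hol f z) -> (forall z, pball b r z -> ~ A z) ->
  (forall M, 0 < M -> exists2 t0 : R, 0 < t0 & forall t, 0 < t < t0 -> exists2 z, modc (z - b) = t & M <= modc (f z)) ->
  exists psi, step_for n delta (fun q => (A q.1 /\ q.1 <> b) \/ (q.2 = f q.1 /\ sigma <= modc (q.1 - b))) psi /\
    forall w, box D n (b, w) -> - (2 * delta) <= psi (b, w).
Proof.
move=> n0 d01 si0 oD pA nA hf Db r0 fb Ab large; have d0 : 0 < delta by case/andP: d01.
have n10 : 0 < n + 1 by rlra.
pose Ab' := [set z | A z /\ z <> b].
have [|z Dz|K cK KD KA|psi [K [Psi [[cpsi lpsi [gPsi fPsi]] [upsi apsi epsi lopsi]]]]] :=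
  @step_gen R D Ab' n delta r (fun K Psi =>
  (forall q, K q.1 -> sigma <= modc (q.1 - b) -> modc (f q.1) < n + 1 -> q.2 = f q.1 -> Psi q <= -1) /\
  (forall q, q.1 = b -> - delta <= Psi q)) n0 d01 r0 oD.
- by move=> S cS SA; apply: (@polar_thin _ A) => // z /SA[_ []].
- move=> nAz; have [zb|/eqP zb] := eqVneq z b.
    exists r => // y yz [Ay yb]; apply: (Ab y) => //.
    by rewrite /pball -{2}zb yz andbT modc_gt0 subr_eq0; apply/eqP.
  have [|d dp hd] := nA z Dz; first by move=> Az; apply: nAz.
  by exists d => // y /hd h [].
- have n3 : 0 < n + 1 + 3 by rlra.
  have [|Psi [cPsi uPsi gPsi fPsi]] := @inner_point R f b r K (n + 1) delta sigma r0 fb (large _ n3) cK _ n10 d0 si0.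
    move=> z Kz zb; apply: hf; first exact: KD.
    by move=> Az; apply: (KA z Kz); split=> //; exact/eqP.
  by exists Psi.
exists psi; split; first split=> //.
- move=> q bq [Aq|[qf qs]]; first by have := apsi q bq Aq; rlra.
  apply: epsi => // Kq; apply: gPsi => //.
  by rewrite -qf; case: bq => _; rlra.
- move=> w bw; have [|Kq h] := lopsi (b, w) bw.
    move=> a [Aa ab]; rewrite leNgt; apply/negP => h; apply: (Ab a) => //.
    by rewrite /pball (modc_sym a) h andbT modc_gt0 subr_eq0; apply/eqP => e; exact: ab.
  by have := fPsi (b, w) erefl; rlra.
Qed.

Section Family.
Variable B : set C.
Hypotheses (oD : open D) (pA : polar A).
Hypothesis nA : forall z, D z -> ~ A z -> exists2 d : R, 0 < d & forall y, modc (y - z) < d -> ~ A y.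
Hypothesis hf : forall z, D z -> ~ A z -> holn f z.
Hypothesis hB : forall b, B b -> [/\ A b, D b & exists r : R, [/\ 0 < r,
  forall z, pball b r z -> hol f z, forall z, pball b r z -> ~ A z &
  forall M, 0 < M -> exists2 t0 : R, 0 < t0 & forall t, 0 < t < t0 ->
    exists2 z, modc (z - b) = t & M <= modc (f z)]].

Definition target (q : C * C) := ((D `\` A) q.1 /\ q.2 = f q.1) \/ (A `\` B) q.1.

Definition far (eta : R) (q : C * C) := forall a, A a -> eta <= modc (q.1 - a).

(** The maximum of one model without special point and one for each [b] in the list: it keeps the
    common upper bounds and the lower bound of each, hence a finite list at each stage. *)
Lemma step (n delta eta : R) (l : seq C) : 0 < n -> 0 < delta <= 1 -> 0 < eta ->
  (forall b, b \in l -> B b) ->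
  exists psi, [/\ step_for n delta (fun q => target q /\ (A q.1 \/ far eta q)) psi,
    forall q, box D n q -> far eta q -> eta <= modc (q.2 - f q.1) -> - (2 * delta) <= psi q &
    forall b w, b \in l -> box D n (b, w) -> - (2 * delta) <= psi (b, w)].
Proof.
move=> n0 d01 eta0; elim: l => [|b l IH] lB.
  have [psi [[c1 l1 u1 e1] h]] := step_none n0 d01 eta0 oD pA nA hf.
  exists psi; split=> //; split=> // q bq [[[_ qf]|[Aq _]] _]; apply: e1 => //; [by right|by left].
have [|psi [s1 h1 h1']] := IH; first by move=> c cl; apply: lB; rewrite in_cons cl orbT.
have Bb : B b by apply: lB; rewrite in_cons eqxx.
have [Ab Db [r [r0 fb Ar large]]] := hB Bb.
have [psi2 [[c2 l2 u2 e2] h2]] := step_point n0 d01 eta0 oD pA nA hf Db r0 fb Ar large.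
exists (fun q => Num.max (psi q) (psi2 q)); split.
- apply: step_for_max => //; split=> // q bq [[[[_ nAq] qf]|[Aq nBq]] hq]; apply: e2 => //.
    by right; split=> //; case: hq => // /(_ b Ab).
  by left; split=> // qb; apply: nBq; rewrite qb.
- by move=> q bq qa qe; rewrite le_max h1.
- move=> c w; rewrite in_cons => /orP[/eqP ->|cl] bw; rewrite le_max.
    by rewrite h2 ?orbT.
  by rewrite h1'.
Qed.

End Family.
End Steps.

(** * Sub-mean value inequality for decreasing limits *)

Section MeanLimit.
Variable R : realType.
Local Notation C := (Cplx R).
Local Notation mu := (@lebesgue_measure R).
Local Notation tpi := (tpi R).

Lemma integral_segint (phi : R -> R) (a b : R) : ctn phi a b ->
  (\int[mu]_(t in `[a, b]) (phi t)%:E)%E = (segint phi a b)%:E.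
Proof.
move=> h; rewrite /segint /Rintegral fineK//.
by apply: integrable_fin_num => //; exact: ctn_integrable.
Qed.

(* The case of an infinite integral of [M - w] is excluded by its bound [M - y]. *)
Lemma integral_ge_limit (h : nat -> R -> R) (w : R -> \bar R) (M y a b : R) : a <= b ->
  (forall N x, {for x, continuous (h N)}) ->
  (forall N x, a <= x <= b -> h N.+1 x <= h N x) ->
  (forall N x, a <= x <= b -> h N x <= M) ->
  (forall x, a <= x <= b -> (h N x)%:E @[N --> \oo] --> w x) ->
  (forall N, y <= segint (h N) a b) ->
  (y%:E <= \int[mu]_(t in `[a, b]) w t)%E.
Proof.
move=> ab hc hd hM hw hy.
have mI : measurable (`[a, b]%classic : set R) by exact: measurable_itv.
have inI x : `[a, b]%classic x -> a <= x <= b by rewrite /= in_itv.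
(* Subtracting from the common bound [M] turns the decreasing sequence into an increasing
   nonnegative one, for monotone convergence. *)
pose g N x : \bar R := (M - h N x)%:E.
have gc N x : {for x, continuous (fun x => M - h N x)}.
  by apply: (cvgB (cvg_cst _) (hc N x)).
have mg N : measurable_fun (`[a, b]%classic : set R) (g N) by exact: (@cont_measurable R (fun x => M - h N x)).
have g0 N x : `[a, b]%classic x -> (0 <= g N x)%E.
  by move=> /inI /(hM N); rewrite lee_fin subr_ge0.
have gd x : `[a, b]%classic x -> {homo g^~ x : n m / (n <= m)%N >-> (n <= m)%E}.
  move=> /inI xI; apply/nondecreasing_seqP => n; rewrite lee_fin lerD2l lerN2; exact: hd.
have gw x : `[a, b]%classic x -> g^~ x @ \oo --> (M%:E - w x)%E.
  move=> /inI xI.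
  apply: (@cvgeB _ \oo _ R (fun=> M%:E) (fun N => (h N x)%:E) M%:E (w x) _ _ (hw x xI)).
    by rewrite fin_num_adde_defr.
  exact: cvg_cst.
have mX : measurable_fun (`[a, b]%classic : set R) (fun x => (M%:E - w x)%E).
  by apply: emeasurable_fun_cvg mg gw.
have X0 x : `[a, b]%classic x -> (0 <= M%:E - w x)%E.
  move=> xI; apply: (cvge_ge _ (gw x xI)); near=> N; exact: g0.
have intg N : (\int[mu]_(x in `[a, b]) g N x)%E = (M * (b - a) - segint (h N) a b)%:E.
  rewrite (@integral_segint (fun x => M - h N x)); last by move=> x _.
  congr EFin; have -> : (fun x => M - h N x) = (fun x => (fun=> M) x + -1 * h N x).
    by apply: funext => x; rewrite mulN1r.
  rewrite RintD ?RintZ ?Rint_cst ?mulN1r// => x _; try exact: cvg_cst; try exact: (@hc N x).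
  by apply: cont_mulR; [exact: cvg_cst|exact: (@hc N x)].
have iX : (\int[mu]_(x in `[a, b]) (M%:E - w x) <= (M * (b - a) - y)%:E)%E.
  have -> : (\int[mu]_(x in `[a, b]) (M%:E - w x))%E = (\int[mu]_(x in `[a, b]) limn (g^~ x))%E.
    by apply: eq_integral => x /set_mem xI; apply/esym/cvg_lim => //; exact: gw.
  have cv := cvg_monotone_convergence mI mg g0 gd (mu := mu).
  apply: (cvge_le _ cv); near=> N.
  by rewrite intg lee_fin lerD2l lerN2.
have intX : mu.-integrable `[a, b] (fun x => (M%:E - w x)%E).
  apply/integrableP; split=> //.
  have -> : (\int[mu]_(x in `[a, b]) `|M%:E - w x|)%E = (\int[mu]_(x in `[a, b]) (M%:E - w x))%E.
    by apply: eq_integral => x /set_mem xI; rewrite gee0_abs//; exact: X0.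
  by apply: le_lt_trans iX _; rewrite ltry.
have intM : mu.-integrable `[a, b] (EFin \o (fun=> M)).
  by apply: ctn_integrable => x _; exact: cvg_cst.
have -> : (\int[mu]_(t in `[a, b]) w t = \int[mu]_(t in `[a, b]) (M%:E - (M%:E - w t)))%E.
  by apply: eq_integral => x _; rewrite oppeB ?fin_num_adde_defr// addeA subee// add0e.
rewrite (_ : (\int[mu]_(t in `[a, b]) (M%:E - (M%:E - w t)) =
  \int[mu]_(t in `[a, b]) M%:E - \int[mu]_(t in `[a, b]) (M%:E - w t))%E); last exact: integralB.
rewrite (@integral_segint (fun=> M)); last by move=> x _; exact: cvg_cst.
rewrite Rint_cst//; apply: (@le_trans _ _ ((M * (b - a))%:E - (M * (b - a) - y)%:E)%E).
  by rewrite -EFinB lee_fin opprB addrC subrK.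
by apply: leeB.
Unshelve. all: by end_near. Qed.

Lemma mean_limit (v : nat -> C -> R) (w : C -> \bar R) (z0 : C) (r : R) : 0 < r ->
  (forall N z, modc (z - z0) <= r -> csh (v N) z) ->
  (forall N z, modc (z - z0) <= r -> v N.+1 z <= v N z) ->
  (forall z, modc (z - z0) <= r -> (v N z)%:E @[N --> \oo] --> w z) ->
  (w z0 <= circle_mean w z0 r)%E.
Proof.
move=> r0 vc vd vw.
have onc s : modc (cpt z0 r s - z0) <= r by rewrite modc_cpt// ltW.
have z0r : modc (z0 - z0) <= r by rewrite subrr modc0 ltW.
have vle N : (w z0 <= (v N z0)%:E)%E.
  apply: (cvge_le _ (vw z0 z0r)); near=> m; rewrite lee_fin.
  have /nonincreasing_seqP h : forall n, v n.+1 z0 <= v n z0 by move=> n; exact: vd.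
  by apply: h; near: m; exact: nbhs_infty_ge.
case: (leP (w z0) -oo%E) => [|w0]; first by rewrite leeNy_eq => /eqP ->; exact: leNye.
have [y yE] : exists y : R, w z0 = y%:E.
  have := vle 0%N; case: (w z0) w0 => [y| |]//; by exists y.
have [M _ hM] := @cont_bounded R _ (v 0%N) (@compact_annulus R z0 0 r) (fun z hz => csh_cont (vc 0%N z (proj2 (andP hz)))).
have sub N : y <= cmean (v N \o cpt z0 r).
  have : v N z0 <= cmean (v N \o cpt z0 r).
    by apply: submean => // z zr; [exact: csh_cont (vc N z zr)|exact: csh_tst (vc N z (ltW zr))].
  by have := vle N; rewrite yE lee_fin; apply: le_trans.
have tp := tpi_gt0 R.
have := @integral_ge_limit (fun N => v N \o cpt z0 r) (w \o cpt z0 r) M (tpi * y) 0 tpi (ltW tp).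
move=> /(_ _ _ _ _ _)/wrap[].
- by move=> N x; apply: cont_cpt; exact: csh_cont (vc N _ (onc x)).
- by move=> N x _; exact: vd.
- move=> N x _; have -> : (v N \o cpt z0 r) x <= M; last by [].
  elim: N => [|N]; last by apply: le_trans; exact: vd.
  by apply: hM; rewrite /= modc_ge0/=; exact: onc.
- by move=> x _; exact: vw.
- by move=> N; have := sub N; rewrite /cmean ler_pdivlMl.
move=> h; rewrite yE /circle_mean -lee_pdivrMl ?invr_gt0 ?invrK//.
Unshelve. all: by end_near. Qed.

End MeanLimit.

(** * Summation *)

Section Sum.
Variable R : realType.
Local Notation C := (Cplx R).
Variables (D : set C) (psi : nat -> C * C -> R) (E : set (C * C)).

Lemma box_mono (m n : R) (q : C * C) : 0 < m -> m <= n -> box D m q -> box D n q.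
Proof.
move=> m0 mn [[q1 hD] q2]; split; last exact: le_trans q2 mn.
split=> [|zeta nD]; first exact: le_trans q1 mn.
by apply: le_trans (hD zeta nD); rewrite lef_pV2 ?posrE//; exact: lt_le_trans mn.
Qed.

Lemma box_near (q : C * C) : open D -> D q.1 -> exists (k0 : nat) (d : R), 0 < d /\
  forall p, modc (p.1 - q.1) < d -> modc (p.2 - q.2) < d -> forall k, (k0 <= k)%N -> box D k.+1%:R p.
Proof.
move=> oD Dq; have [e e0 he] := (openCP D).1 oD _ Dq.
(* The first three terms bound both coordinates of points close to [q]; the last makes [1 / k] at
   most [e / 2], below their distance to the complement of [D]. *)
pose X := modc q.1 + modc q.2 + e + 2 / e.
have [c1 c2] := (modc_ge0 q.1, modc_ge0 q.2).
have e2 : 0 < 2 / e by rewrite divr_gt0.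
have X0 : 0 < X by rewrite /X; lra.
have hX := archi_boundP (ltW X0); set k0 := Num.bound X in hX.
exists k0, (e / 2); split; first lra.
move=> p p1 p2 k kk; have kX : X < k.+1%:R.
  by apply: lt_le_trans hX _; rewrite ler_nat; exact: leqW.
apply: (box_mono X0 (ltW kX)); split; last first.
  by have := ler_modc_sub p.2 q.2; rewrite /X; lra.
split; first by have := ler_modc_sub p.1 q.1; rewrite /X; lra.
move=> zeta nD; have : e <= modc (zeta - q.1) by rewrite leNgt; apply/negP => /he.
move=> h; have h1 := ler_modc_dist zeta p.1 q.1; rewrite (modc_sym zeta p.1) in h1.
apply: le_trans (_ : e / 2 <= _); last lra.
rewrite -[leRHS]invrK lef_pV2 ?posrE//; last by rewrite invr_gt0; lra.
by rewrite invf_div /X; lra.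
Qed.

(* The partial sums of [psi] completed by the remainder of [\sum 2^-(k+1)], so as to be
   eventually nonincreasing. *)
Fixpoint psum (N : nat) (q : C * C) : R :=
  if N is M.+1 then psum M q + (psi M q + - (2^-1) ^+ M.+1) else 1.

Hypothesis oD : open D.
Hypothesis h1 : forall k q, D q.1 -> csh2 (psi k) q.
Hypothesis h2 : forall k q, box D k.+1%:R q -> psi k q <= (2^-1) ^+ k.+1.
Hypothesis h3 : forall q, E q -> exists k0, forall k, (k0 <= k)%N -> psi k q <= - 2^-1.
Hypothesis h4 : forall q, D q.1 -> ~ E q -> exists k0, forall k, (k0 <= k)%N -> - (2^-1) ^+ k <= psi k q.
Hypothesis h5 : forall q, E q -> D q.1.

Lemma csh2_psum N q : D q.1 -> csh2 (psum N) q.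
Proof.
move=> Dq; elim: N => [|N IH] /=; first exact: csh2_cst.
by apply: csh2_add => //; apply: csh2_add; [exact: h1|exact: csh2_cst].
Qed.

Lemma psum_le k0 q : (forall k, (k0 <= k)%N -> box D k.+1%:R q) ->
  forall m n, (k0 <= m)%N -> (m <= n)%N -> psum n q <= psum m q.
Proof.
move=> hb m n km; elim: n => [|n IH]; first by rewrite leqn0 => /eqP ->.
rewrite leq_eqVlt => /orP[/eqP -> //|]; rewrite ltnS => mn.
apply: le_trans (IH mn) => /=; rewrite gerDl subr_le0; apply: h2; apply: hb.
exact: leq_trans mn.
Qed.

Definition usum (q : C * C) : \bar R := limn (fun N => (psum N q)%:E).

Lemma usum_cvg q : D q.1 -> (psum N q)%:E @[N --> \oo] --> usum q.
Proof.
move=> Dq; have [k0 [d [d0 hd]]] := box_near oD Dq.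
have hb : forall k, (k0 <= k)%N -> box D k.+1%:R q by apply: hd; rewrite subrr modc0.
suff : cvgn (fun N => (psum N q)%:E) by [].
have : cvgn (fun N => (psum (N + k0) q)%:E).
  apply: ereal_nonincreasing_is_cvgn; apply/nonincreasing_seqP => n.
  by rewrite lee_fin; apply: (psum_le hb); rewrite ?leq_addl.
move=> /cvg_ex[l hl]; apply/cvg_ex; exists l.
by rewrite -(cvg_shiftn k0); exact: hl.
Qed.

Lemma usum_le k0 q N : D q.1 -> (forall k, (k0 <= k)%N -> box D k.+1%:R q) -> (k0 <= N)%N ->
  (usum q <= (psum N q)%:E)%E.
Proof.
move=> Dq hb kN; apply: (cvge_le _ (usum_cvg Dq)); near=> n.
rewrite lee_fin; apply: (psum_le hb) => //; near: n; exact: nbhs_infty_ge.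
Unshelve. all: by end_near. Qed.

Lemma usum_ltoo q : D q.1 -> (usum q < +oo)%E.
Proof.
move=> Dq; have [k0 [d [d0 hd]]] := box_near oD Dq.
have hb : forall k, (k0 <= k)%N -> box D k.+1%:R q by apply: hd; rewrite subrr modc0.
by apply: le_lt_trans (usum_le Dq hb (leqnn k0)) _; rewrite ltry.
Qed.

Lemma usum_usc q (c : R) : D q.1 -> (usum q < c%:E)%E -> exists2 d : R, 0 < d &
  forall p, modc (p.1 - q.1) < d -> modc (p.2 - q.2) < d -> D p.1 /\ (usum p < c%:E)%E.
Proof.
move=> Dq uc; have [k0 [d [d0 hd]]] := box_near oD Dq.
have hb : forall k, (k0 <= k)%N -> box D k.+1%:R q by apply: hd; rewrite subrr modc0.
have [N kN Nc] : exists2 N, (k0 <= N)%N & psum N q < c.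
  apply: contrapT => hn; move: uc; rewrite ltNge => /negP; apply.
  apply: (cvge_ge _ (usum_cvg Dq)); near=> N; rewrite lee_fin leNgt; apply/negP => h; apply: hn.
  by exists N => //; near: N; exact: nbhs_infty_ge.
have [cN _] := csh2_psum N Dq.
have [|d1 d10 hd1] := cN (c - psum N q); first by rewrite subr_gt0.
exists (Num.min d d1); first by rewrite lt_min d0.
move=> p; rewrite !lt_min => /andP[p1 p1'] /andP[p2 p2'].
have hbp := hd p p1 p2.
have Dp : D p.1 by have [hI _] := hbp k0 (leqnn k0); apply: inner_setD hI; rewrite ltr0n.
split=> //; apply: le_lt_trans (usum_le Dp hbp kN) _; rewrite lte_fin.
by have := hd1 p p1' p2'; rewrite ltr_norml => /andP[_]; lra.
Unshelve. all: by end_near. Qed.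

Lemma usum_target q : E q -> usum q = -oo%E.
Proof.
move=> Eq; have Dq := h5 Eq; have [k0 [d [d0 hd]]] := box_near oD Dq.
have hb : forall k, (k0 <= k)%N -> box D k.+1%:R q by apply: hd; rewrite subrr modc0.
have [k1 hk1] := h3 Eq; pose k2 := maxn k0 k1.
have dec j : psum (k2 + j) q <= psum k2 q - j%:R / 2.
  elim: j => [|j IH]; first by rewrite addn0 mul0r subr0.
  rewrite addnS /=; have := hk1 (k2 + j)%N (leq_trans (leq_maxr k0 k1) (leq_addr _ _)).
  have : 0 <= (2^-1) ^+ (k2 + j).+1 :> R by rewrite exprn_ge0// invr_ge0.
  have -> : j.+1%:R / 2 = j%:R / 2 + 2^-1 :> R by rewrite -natr1 mulrDl mul1r.
  by move: ((2^-1) ^+ _) => x; lra.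
case: (leP (usum q) -oo%E) => [|u0]; first by rewrite leeNy_eq => /eqP.
have := usum_ltoo Dq; have ule N : (k0 <= N)%N -> (usum q <= (psum N q)%:E)%E by exact: usum_le hb.
case: (usum q) u0 ule => [y| |]// _ ule _; exfalso.
have := archi_boundP (normr_ge0 (2 * (psum k2 q - y))); set j := Num.bound _ => hN.
have := ule (k2 + j)%N (leq_trans (leq_maxl k0 k1) (leq_addr _ _)).
rewrite lee_fin; have := dec j.
by have := ler_norm (2 * (psum k2 q - y)); lra.
Qed.

Lemma usum_off q : D q.1 -> ~ E q -> usum q <> -oo%E.
Proof.
move=> Dq nEq; have [k0 hk0] := h4 Dq nEq.
(* From [k0] on an increment of [psum] is at least [- 2^-N - 2^-(N+1)], exactly what the decrease of
   [3 * 2^-N] compensates; so [S] is nondecreasing. *)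
pose S N := psum N q - 3 * (2^-1) ^+ N.
have inc j : S k0 <= S (k0 + j)%N.
  elim: j => [|j IH]; first by rewrite addn0.
  apply: le_trans IH _; rewrite /S addnS /= exprS.
  by have := hk0 (k0 + j)%N (leq_addr _ _); move: ((2^-1) ^+ _) => x; lra.
suff : ((S k0)%:E <= usum q)%E by move=> h e; move: h; rewrite e leeNy_eq.
apply: (cvge_ge _ (usum_cvg Dq)); near=> N; rewrite lee_fin.
have kN : (k0 <= N)%N by near: N; exact: nbhs_infty_ge.
have := inc (N - k0)%N; rewrite subnKC// /S.
have : 0 <= (2^-1) ^+ N :> R by rewrite exprn_ge0// invr_ge0.
lra.
Unshelve. all: by end_near. Qed.

Lemma near2P (q : C * C) (P : C * C -> Prop) (d : R) : 0 < d ->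
  (forall p, modc (p.1 - q.1) < d -> modc (p.2 - q.2) < d -> P p) -> \forall p \near q, P p.
Proof.
move=> d0 hP; exists ([set z | modc (z - q.1) < d], [set z | modc (z - q.2) < d]).
  by split=> /=; apply/nearCP; exists d.
by move=> p [/= p1 p2]; exact: hP.
Qed.

Lemma cline_shift (a b : C * C) (x y : C) : cline a b y = cline (cline a b x) b (y - x).
Proof. by rewrite /cline /=; congr (_, _); rewrite -addrA -mulrDl [x + _]addrC subrK. Qed.

(** Monotone convergence needs one index from which the partial sums decrease on the whole closed
    disc. Compactness provides it, the index being encoded as the inverse of a small [d]. *)
Lemma usum_line_mean (a b : C * C) (z0 : C) (r : R) : 0 < r ->
  (forall z, modc (z - z0) <= r -> D (cline a b z).1) ->
  (usum (cline a b z0) <= circle_mean (fun z => usum (cline a b z)) z0 r)%E.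
Proof.
move=> r0 hD.
have [y d d' dd' hy d'0 k kd|x xK|d d0 hd] := @compact_unif R _
  (fun z d => 0 < d -> forall k : nat, d^-1 <= k%:R -> box D k.+1%:R (cline a b z)) (@compact_annulus R z0 0 r).
- by apply: hy; [exact: lt_le_trans dd'|apply: le_trans kd; rewrite lef_pV2 ?posrE//; exact: lt_le_trans dd'].
- have /hD Dx : modc (x - z0) <= r by case/andP: xK.
  have [k0 [d [d0 hd]]] := box_near oD Dx.
  have [d1 d10 hd1] := @cline_close R (cline a b x) b d d0.
  pose d2 := Num.min d1 (k0.+1%:R)^-1.
  have d20 : 0 < d2 by rewrite lt_min d10 invr_gt0 ltr0Sn.
  exists d2 => // y yd _ k kd.
  have lE := cline_shift a b x y.
  have [|p1 p2] := hd1 (y - x); first by rewrite subr0; move: yd; rewrite lt_min => /andP[].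
  rewrite lE; apply: hd => //.
  have : k0.+1%:R <= k%:R :> R.
    apply: le_trans kd; rewrite -[leLHS]invrK lef_pV2 ?posrE ?invr_gt0//.
    by rewrite ge_min lexx orbT.
  by rewrite ler_nat => /ltnW.
have [n hn] : exists n : nat, d^-1 <= n%:R.
  have d1 : 0 <= d^-1 by rewrite invr_ge0 ltW.
  by exists (Num.bound d^-1); apply/ltW; exact: archi_boundP.
have hb z : modc (z - z0) <= r -> forall k, (n <= k)%N -> box D k.+1%:R (cline a b z).
  move=> zr k nk; apply: hd => //; first by rewrite /= modc_ge0.
  by apply: le_trans hn _; rewrite ler_nat.
apply: (@mean_limit R (fun N z => psum (N + n) (cline a b z)) (fun z => usum (cline a b z))) => //.
- by move=> N z /hD Dz; apply: csh2_line; exact: csh2_psum.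
- by move=> N z /hb hz; apply: (psum_le hz); rewrite ?leq_addl.
- move=> z /hD Dz.
  by have := usum_cvg Dz; rewrite -(cvg_shiftn n).
Qed.

Lemma sum_of_steps : complete_pluripolar (D `*` setT) E.
Proof.
exists usum; split; last first.
  apply/seteqP; split=> [q [[Dq _] uq]|q Eq].
    by apply: contrapT => nEq; exact: usum_off Dq nEq uq.
  by split; [split=> //; exact: h5|exact: usum_target].
split.
- rewrite openE => q [Dq _]; have [d d0 hd] := (openCP D).1 oD _ Dq.
  by apply: (near2P d0) => p /hd.
- by move=> q [Dq _]; exact: usum_ltoo.
- move=> q [Dq _] c uc; have [d d0 hd] := usum_usc Dq uc.
  by apply: (near2P d0) => p p1 p2; case: (hd p p1 p2).
- move=> a b; split.
  + by move=> z [Dz _]; exact: usum_ltoo.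
  + move=> z [Dz _] c uc; have [d d0 hd] := usum_usc Dz uc.
    have [d1 d10 hd1] := @cline_close R (cline a b z) b d d0.
    apply/nearCP; exists d1 => // y yd.
    have lE := cline_shift a b z y.
    have [|p1 p2] := hd1 (y - z); first by rewrite subr0.
    by rewrite lE; case: (hd _ p1 p2).
  + move=> z r [Dz _] r0 hr; apply: usum_line_mean => // y yr.
    by have [] := hr y ((closed_ballCE z y r0).2 yr).
Qed.

End Sum.

(** * The theorem *)

Section Final.
Variable R : realType.
Local Notation C := (Cplx R).

(** Each [b] is coded by a rational point within half its isolation radius. Two points with the same
    code are closer than the larger of their radii, hence equal. *)
Lemma isolated_countable (B : set C) :
  (forall b, B b -> exists2 r : R, 0 < r & forall c, B c -> modc (c - b) < r -> c = b) -> countable B.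
Proof.
move=> hB.
have code b : exists c : rat * rat, B b -> exists r : R, [/\ 0 < r,
    forall c, B c -> modc (c - b) < r -> c = b &
    modc (mkC (ratr c.1) (ratr c.2) - b) < r / 2].
  have [Bb|nB] := pselect (B b); last by exists (0, 0).
  have [r r0 hr] := hB b Bb.
  have [q1 /andP[]] := @rat_in_itvoo R (reC b - r / 4) (reC b + r / 4) ltac:(rlra).
  rewrite !bnd_simp => h1 h2.
  have [q2 /andP[]] := @rat_in_itvoo R (imC b - r / 4) (imC b + r / 4) ltac:(rlra).
  rewrite !bnd_simp => h3 h4.
  exists (q1, q2) => _; exists r; split=> //=.
  have -> : mkC (ratr q1) (ratr q2) - b = mkC (ratr q1 - reC b) (ratr q2 - imC b).
    by apply: Cext; rewrite ?reCB ?imCB ?reC_mk ?imC_mk.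
  apply: le_lt_trans (modc_mk _ _) _.
  have : `|ratr q1 - reC b| < r / 4 by rewrite ltr_norml; apply/andP; split; rlra.
  have : `|ratr q2 - imC b| < r / 4 by rewrite ltr_norml; apply/andP; split; rlra.
  rlra.
have [F hF] := choice code.
apply/countable_injP; exists (choice.pickle \o F) => b c /set_mem Bb /set_mem Bc /= /(pcan_inj choice.pickleK) Fbc.
have [r [r0 hr br]] := hF b Bb; have [s [s0 hs cs]] := hF c Bc; rewrite Fbc in br.
set x := mkC _ _ in br cs.
have h1 := ler_modc_dist b x c; have h2 := ler_modc_dist c x b.
rewrite (modc_sym b x) in h1; rewrite (modc_sym c x) in h2.
by have [rs|sr] := leP r s; [apply: hs => //; rlra|apply/esym; apply: hr => //; rlra].
Qed.

(** The lists grow with [k], so each point of [B] is treated by all but finitely many summands, as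
    convergence over it requires. *)
Lemma countable_exhaustion (B : set C) : countable B ->
  exists l : nat -> seq C, (forall k b, b \in l k -> B b) /\
    forall b, B b -> exists k0, forall k, (k0 <= k)%N -> b \in l k.
Proof.
move=> /countable_injP[F Finj].
have ex n : exists s : seq C, (forall b, b \in s -> B b) /\ forall b, B b -> F b = n -> b \in s.
  have [[b [Bb Fb]]|hn] := pselect (exists b, B b /\ F b = n).
    exists [:: b]; split=> [c|c Bc Fc]; first by rewrite inE => /eqP ->.
    by rewrite inE; apply/eqP; apply: Finj; [exact: mem_set|exact: mem_set|rewrite Fc].
  by exists [::]; split=> // b Bb Fb; exfalso; apply: hn; exists b.
have [e he] := choice ex.
exists (fun k => flatten [seq e n | n <- iota 0 k]); split.
  by move=> k b /flatten_mapP[n _ /(he n).1].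
move=> b Bb; exists (F b).+1 => k kF; apply/flatten_mapP; exists (F b); last exact: (he _).2.
by rewrite mem_iota.
Qed.

(** A value filling in [f] at [b] on some disc would be an extension of the kind excluded, so
    [circles_meet_large] applies at every level. *)
Lemma essential_large (D A : set C) (f : C -> C) (b : C) (r : R) : 0 < r ->
  A b -> (forall z, modc (z - b) < r -> D z) ->
  (forall z, pball b r z -> hol f z) ->
  ~ (exists (U : set C) (g : C -> C), [/\ open U, U b, U `<=` D, holomorphic_on U g &
       forall z, U z -> ~ A z -> g z = f z]) ->
  forall M, 0 < M -> exists2 t0 : R, 0 < t0 & forall t, 0 < t < t0 ->
    exists2 z, modc (z - b) = t & M <= modc (f z).
Proof.
move=> r0 Ab rD fb next M M0; apply: (circles_meet_large r0 M0 fb) => s /andP[s0 sr] [a ha].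
apply: next; exists [set z | modc (z - b) < s], (fun u => if u == b then a else f u); split.
- apply/openCP => z /= zs; exists (s - modc (z - b)); first by rewrite subr_gt0.
  by move=> y yz; apply: le_lt_trans (ler_modc_dist _ z _) _; rlra.
- by rewrite /= subrr modc0.
- by move=> z /= zs; apply: rD; exact: lt_le_trans sr.
- by move=> z /= zs; apply/holP; exact: ha.
- by move=> z _ nA; case: eqVneq => // zb; case: nA; rewrite zb.
Qed.

End Final.
Theorem theorem4p3 (R : realType) (D A B : set (Cplx R)) (f : Cplx R -> Cplx R) :
  domain D ->
  closed_in D A ->
  polar A ->
  holomorphic_on (D `\` A) f ->
  B `<=` A ->
  B `&` accum_in D A = set0 ->
  (forall b, B b ->
     ~ (exists (U : set (Cplx R)) (g : Cplx R -> Cplx R),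
          [/\ open U, U b, U `<=` D, holomorphic_on U g &
              forall z, U z -> ~ A z -> g z = f z])) ->
  complete_pluripolar (D `*` setT)
    ([set p | (D `\` A) p.1 /\ p.2 = f p.1] `|` ((A `\` B) `*` setT)).

Proof.
move=> [oD _ _] [AD clA] pA holf BA Bacc next.
have nA z : D z -> ~ A z -> exists2 d : R, 0 < d & forall y, modc (y - z) < d -> ~ A y.
  move=> Dz nAz; have ncl : ~ closure A z by move=> /(clA z Dz).
  move: ncl => /existsNP[U /not_implyP[/nearCP[d d0 hd] nU]].
  by exists d => // y /hd Uy Ay; apply: nU; exists y.
have hf z : D z -> ~ A z -> holn f z.
  move=> Dz nAz; have [d d0 hd] := nA z Dz nAz; have [d1 d10 hd1] := (openCP D).1 oD _ Dz.
  exists (Num.min d d1); first by rewrite lt_min d0.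
  by move=> y; rewrite lt_min => /andP[/hd nAy /hd1 Dy]; apply/holP; apply: holf.
(* A point of [B] is no accumulation point of [A], so it is isolated in [A] and not merely in [B];
   the punctured discs about it therefore avoid [A]. *)
have iso b : B b -> exists2 r : R, 0 < r & forall c, A c -> modc (c - b) < r -> c = b.
  move=> Bb; have Db : D b by apply: AD; exact: BA.
  have nl : ~ limit_point A b.
    by move=> lA; have : (B `&` accum_in D A) b by []; rewrite Bacc.
  move: nl => /existsNP[U /not_implyP[/nearCP[d d0 hd] nU]].
  exists d => // c Ac /hd Uc; apply: contrapT => /eqP cb; apply: nU.
  by exists c; split.
have hB b : B b -> [/\ A b, D b & exists r : R, [/\ 0 < r,
    forall z, pball b r z -> hol f z, forall z, pball b r z -> ~ A z &
    forall M, 0 < M -> exists2 t0 : R, 0 < t0 & forall t, 0 < t < t0 ->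
      exists2 z, modc (z - b) = t & M <= modc (f z)]].
  move=> Bb; have Ab := BA b Bb; have Db := AD b Ab; split=> //.
  have [r1 r10 hr1] := iso b Bb; have [r2 r20 hr2] := (openCP D).1 oD _ Db.
  pose r := Num.min r1 r2; have r0 : 0 < r by rewrite lt_min r10.
  have rD z : modc (z - b) < r -> D z by rewrite lt_min => /andP[_ /hr2].
  have rA z : pball b r z -> ~ A z.
    move=> /andP[z0]; rewrite lt_min => /andP[zr _] Az; move: z0.
    by rewrite (hr1 z Az zr) subrr modc0 ltxx.
  have rf z : pball b r z -> hol f z.
    move=> zr; have [d d0 hd] := hf z (rD z (proj2 (andP zr))) (rA z zr).
    by apply: hd; rewrite subrr modc0.
  by exists r; split=> //; exact: (essential_large r0 Ab rD rf (next b Bb)).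
have [l [lB lex]] : exists l : nat -> seq (Cplx R), (forall k b, b \in l k -> B b) /\
    forall b, B b -> exists k0, forall k, (k0 <= k)%N -> b \in l k.
  apply: countable_exhaustion; apply: isolated_countable => b Bb.
  by have [r r0 hr] := iso b Bb; exists r => // c /BA; exact: hr.
(* With [de k = 2^-(k+1)] the upper bound [-1 + de k] is at most -1/2 and the lower bound
   [- (2 * de k)] is [- 2^-k]; [eta] only has to tend to 0. *)
pose de k : R := 2^-1 ^+ k.+1; pose eta k : R := k.+1%:R^-1.
have half0 : 0 <= 2^-1 :> R by rlra.
have half1 : 2^-1 <= 1 :> R by rlra.
have de01 k : 0 < de k <= 1.
  by rewrite exprn_gt0 ?invr_gt0//= exprn_ile1.
have de_half k : de k <= 2^-1.
  by rewrite /de exprS ler_piMr ?exprn_ile1.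
have de2 k : 2 * de k = 2^-1 ^+ k by rewrite /de exprS mulrA mulfV ?mul1r// pnatr_eq0.
have eta0 k : 0 < eta k by rewrite invr_gt0 ltr0n.
have eta_small (e : R) : 0 < e -> exists k0, forall k, (k0 <= k)%N -> eta k <= e.
  move=> e0; have X0 : 0 <= e^-1 by rewrite invr_ge0 ltW.
  exists (Num.bound e^-1) => k kk; rewrite -[leRHS]invrK lef_pV2 ?posrE ?invr_gt0 ?ltr0n//.
  by apply: le_trans (ltW (archi_boundP X0)) _; rewrite ler_nat; exact: leqW.
have n0 k : 0 < k.+1%:R :> R by rewrite ltr0n.
have [psi hpsi] := choice (fun k => step oD pA nA hf hB (n0 k) (de01 k) (eta0 k) (lB k)).
have far_ev q : D q.1 -> ~ A q.1 -> exists k0, forall k, (k0 <= k)%N -> far A (eta k) q.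
  move=> Dq nAq; have [d d0 hd] := nA _ Dq nAq; have [k0 hk0] := eta_small d d0.
  exists k0 => k /hk0 ke a Aa; apply: le_trans ke _; rewrite leNgt; apply/negP.
  by rewrite modc_sym => /hd.
have box_ev q : D q.1 -> exists k0, forall k, (k0 <= k)%N -> box D k.+1%:R q.
  move=> Dq; have [k0 [d [d0 hd]]] := box_near oD Dq.
  by exists k0; apply: hd; rewrite subrr modc0.
apply: (@sum_of_steps R D psi) => //.
- by move=> k q Dq; case: (hpsi k) => [[h _ _ _] _ _]; exact: h.
- by move=> k q bq; case: (hpsi k) => [[_ _ h _] _ _]; exact: h.
- move=> q Eq; have tq : target D A f B q by case: Eq => [[? ?]|[? _]]; [left|right].
  have Dq : D q.1 by case: tq => [[[]]|[/AD]].
  have [k0 hk0] := box_ev q Dq.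
  have [k1 hk1] : exists k1, forall k, (k1 <= k)%N -> A q.1 \/ far A (eta k) q.
    have [Aq|nAq] := pselect (A q.1); first by exists 0%N; left.
    by have [k1 hk1] := far_ev q Dq nAq; exists k1 => k /hk1; right.
  exists (maxn k0 k1) => k; rewrite geq_max => /andP[/hk0 bk /hk1 ak].
  case: (hpsi k) => [[_ _ _ h] _ _]; apply: le_trans (h q bk (conj tq ak)) _.
  by have := de_half k; rlra.
(* Off the set, [q] lies either over a point of [B], which the lists eventually contain, or off [A]
   and off the graph, where both distances eventually exceed [eta k]. *)
- move=> q Dq nEq; have [k0 hk0] := box_ev q Dq.
  have [Aq|nAq] := pselect (A q.1).
    have Bq : B q.1 by apply: contrapT => nB; apply: nEq; right; split.
    have [k1 hk1] := lex _ Bq.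
    exists (maxn k0 k1) => k; rewrite geq_max => /andP[/hk0 bk /hk1 bl].
    case: (hpsi k) => [_ _ h]; rewrite -de2.
    by have := h q.1 q.2 bl; rewrite -surjective_pairing; apply.
  have qf : 0 < modc (q.2 - f q.1).
    by rewrite modc_gt0 subr_eq0; apply/eqP => qf; apply: nEq; left; split.
  have [k1 hk1] := far_ev q Dq nAq; have [k2 hk2] := eta_small _ qf.
  exists (maxn k0 (maxn k1 k2)) => k; rewrite !geq_max => /andP[/hk0 bk /andP[/hk1 fk /hk2 ek]].
  by case: (hpsi k) => [_ h _]; rewrite -de2; exact: h.
- by move=> q [[[]]|[[/AD]]].
Qed.
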